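(* Let $X=\{X_n\}$ and $Y=\{Y_n\}$ be stationary ergodic processes, independent of each other, with values in $A$ and $\hat A$ respectively, and let $$W_n=\inf\{i\ge1:\rho_n(X_1^n,Y_i^{i+n-1})\le D\}\qquad(\inf\emptyset=+\infty).$$ (a) If $Y$ is i.i.d. and the average distortion $D_{\rm av}$ is finite, then for any $D\in(D_{\rm min},D_{\rm av})$, $$\frac1n\log W_n\to R_1(P_1,Q_1,D)\quad\text{with probability one.}$$ (b) If $Y$ is $\psi$-mixing and the distortion measure $\rho$ is bounded, then for any $D\in(D_{\rm min},D_{\rm av})$, $$\frac1n\log W_n\to R(\mathbb P,\mathbb Q,D)\quad\text{with probability one.}$$
   Context: $A,\hat A$ are complete separable metric spaces with their Borel $\sigma$-fields. $\mathbb P,\mathbb Q$ are the distributions of the processes $X,Y$ (indexed by $\mathbb Z$); $P_n,Q_n$ are the distributions of $X_1^n$ and $Y_1^n$, where $X_i^j=(X_i,\dots,X_j)$. $\rho:A\times\hat A\to[0,\infty)$ is measurable and $\rho_n(x_1^n,y_1^n)=\frac1n\sum_{i=1}^n\rho(x_i,y_i)$. $\log$ is natural. $H(W\|V)=E_W[\log\frac{dW}{dV}]$ if the density exists, $\infty$ otherwise. $D_{\rm av}=E_{P_1\times Q_1}[\rho(X_1,Y_1)]$. In (a), $D_{\rm min}=E_{P_1}[\operatorname{ess\,inf}_{Y_1\sim Q_1}\rho(X_1,Y_1)]$. In (b), $D_{\rm min}=\lim_nD_{\rm min}^{(n)}=\sup_nD_{\rm min}^{(n)}$, with $D_{\rm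 min}^{(n)}=E_{P_n}[\operatorname{ess\,inf}_{Y_1^n\sim Q_n}\rho_n(X_1^n,Y_1^n)]$. It is assumed that $D_{\rm min}<D_{\rm av}$. $R_n(P_n,Q_n,D)=\inf_{V_n}\frac1nH(V_n\|P_n\times Q_n)$, the infimum over all joint distributions $V_n$ on $A^n\times\hat A^n$ with $A^n$-marginal $P_n$ and $E_{V_n}[\rho_n(X_1^n,Y_1^n)]\le D$; $R_1(P_1,Q_1,D)$ is the case $n=1$, and $R(\mathbb P,\mathbb Q,D)=\lim_{n\to\infty}R_n(P_n,Q_n,D)$. $Y$ is $\psi$-mixing if for all $d$ large enough there is a finite constant $c_d$ such that $c_d^{-1}\mathbb Q(A)\mathbb Q(B)\le\mathbb Q(A\cap B)\le c_d\mathbb Q(A)\mathbb Q(B)$ for all events $A\in\sigma(Y_{-\infty}^0)$, $B\in\sigma(Y_d^\infty)$, and $c_d\to1$ as $d\to\infty$. *)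

(* Defs.v *)
From HB Require Import structures.
From mathcomp Require Import all_boot all_order all_algebra.
From mathcomp Require Import all_classical all_reals all_analysis.
From mathcomp Require Import ess_sup_inf.

Set Implicit Arguments.
Unset Strict Implicit.
Unset Printing Implicit Defensive.

Import Order.TTheory GRing.Theory Num.Theory.
Import numFieldNormedType.Exports.

Local Open Scope classical_set_scope.
Local Open Scope ring_scope.
Local Open Scope charge_scope.

(* [Complete] includes [Pointed], so these spaces are nonempty. *)
#[short(type="completeMetricType")]
HB.structure Definition CompleteMetric (R : numDomainType) :=
  {T of Metric R T & Complete T}.

Definition separable (T : topologicalType) : Prop :=
  exists2 S : set T, countable S & dense S.

Notation borel T := (g_sigma_algebraType (@open T)).

Section processes.
Context {d dT : measure_display} {Omega : measurableType d}
  {T : measurableType dT} {R : realType} (P : probability Omega R).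
Implicit Type X : int -> {mfun Omega >-> T}.

(* [block X i n] is X_i^{i+n-1} = (X_i, ..., X_{i+n-1}). *)
Definition block X (i : int) (n : nat) (w : Omega) : n.-tuple T :=
  [tuple X (i + k%:Z) w | k < n].

Lemma measurable_block X i n : measurable_fun setT (block X i n).
Proof.
apply/measurable_fun_tnthP => k.
rewrite (_ : _ \o _ = X (i + k%:Z)); first exact: measurable_funPT.
by apply/funext => w /=; rewrite /block tnth_mktuple.
Qed.

HB.instance Definition _ X i n :=
  isMeasurableFun.Build _ _ _ _ (block X i n) (@measurable_block X i n).

(* The law of X_1^n. *)
Definition law X (n : nat) : probability (n.-tuple T) R :=
  distribution P (block X 1 n).

(* The product sigma-field on two-sided sequences. *)
Definition path_sigma_field : set (set (int -> T)) :=
  <<s \bigcup_(i in [set: int])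
        preimage_set_system setT (fun x : int -> T => x i) measurable >>.

Definition path X (w : Omega) : int -> T := fun i => X i w.

Definition shift (x : int -> T) : int -> T := fun i => x (i + 1).

Definition stationary X : Prop :=
  forall E, path_sigma_field E ->
    P (path X @^-1` (shift @^-1` E)) = P (path X @^-1` E).

Definition ergodic X : Prop :=
  forall E, path_sigma_field E -> shift @^-1` E = E ->
    P (path X @^-1` E) = 0%E \/ P (path X @^-1` E) = 1%E.

(* The sigma-field generated by the X_i with i in J. *)
Definition sigma_field X (J : set int) : set (set Omega) :=
  <<s \bigcup_(i in J) preimage_set_system setT (X i) measurable >>.

Definition iid X : Prop :=
  (forall (s : seq int) (E : int -> set T), uniq s ->
    (forall i, measurable (E i)) ->
    P (\bigcap_(i in [set` s]) X i @^-1` E i) =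
      (\prod_(i <- s) P (X i @^-1` E i))%E) /\
  (forall i j (E : set T), measurable E -> P (X i @^-1` E) = P (X j @^-1` E)).

Definition psi_mixing X : Prop :=
  exists c : nat -> R,
    (\forall m \near \oo, forall E F : set Omega,
      sigma_field X [set i | i <= 0] E ->
      sigma_field X [set i | m%:Z <= i] F ->
      ((c m)^-1%:E * (P E * P F) <= P (E `&` F))%E /\
      (P (E `&` F) <= (c m)%:E * (P E * P F))%E) /\
    c m @[m --> \oo] --> (1 : R).

End processes.

Definition independent_processes (d d1 d2 : measure_display)
    (Omega : measurableType d) (T1 : measurableType d1)
    (T2 : measurableType d2) (R : realType) (P : probability Omega R)
    (X : int -> {mfun Omega >-> T1}) (Y : int -> {mfun Omega >-> T2}) : Prop :=
  forall E F : set Omega, sigma_field X setT E -> sigma_field Y setT F ->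
    P (E `&` F) = (P E * P F)%E.

Definition relative_entropy (d : measure_display) (T : measurableType d)
    (R : realType) (W V : probability T R) : \bar R :=
  if `[< W `<< V >]
  then (\int[W]_z lne (('d (charge_of_finite_measure W) '/d V) z))%E
  else +oo%E.

Section distortion.
Context {d1 d2 : measure_display} {T1 : measurableType d1}
  {T2 : measurableType d2} {R : realType} (rho : T1 -> T2 -> R).
Local Open Scope ereal_scope.

Definition rho_n (n : nat) (x : n.-tuple T1) (y : n.-tuple T2) : R :=
  (n%:R^-1 * \sum_(i < n) rho (tnth x i) (tnth y i))%R.

Definition admissible (n : nat) (p : probability (n.-tuple T1) R) (D : R)
    (V : probability (n.-tuple T1 * n.-tuple T2)%type R) : Prop :=
  (forall E, measurable E -> V (fst @^-1` E) = p E) /\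
  \int[V]_z (rho_n z.1 z.2)%:E <= D%:E.

(* R_n(P_n, Q_n, D); it is +oo when no joint law is admissible. *)
Definition rate_n (n : nat) (p : probability (n.-tuple T1) R)
    (q : probability (n.-tuple T2) R) (D : R) : \bar R :=
  ereal_inf [set (n%:R^-1)%:E * relative_entropy V (p \x q)
            | V in admissible p D].

Definition D_min_n (n : nat) (p : probability (n.-tuple T1) R)
    (q : probability (n.-tuple T2) R) : \bar R :=
  \int[p]_x ess_inf q (fun y => (rho_n x y)%:E).

Context {d : measure_display} {Omega : measurableType d}
  (P : probability Omega R).
Variables (X : int -> {mfun Omega >-> T1}) (Y : int -> {mfun Omega >-> T2}).

Definition D_av : \bar R :=
  \int[distribution P (X 1) \x distribution P (Y 1)]_z (rho z.1 z.2)%:E.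

Definition D_min_1 : \bar R :=
  \int[distribution P (X 1)]_x ess_inf (distribution P (Y 1))
                                       (fun y => (rho x y)%:E).

Definition D_min_sup : \bar R :=
  ereal_sup [set D_min_n (law P X n) (law P Y n) | n in [set n | (0 < n)%N]].

Definition rate_seq (D : R) (n : nat) : \bar R :=
  rate_n (law P X n) (law P Y n) D.

(* Meaningful only when [rate_seq D] converges: [limn] of a divergent sequence
   is an arbitrary value. *)
Definition rate (D : R) : \bar R := limn (rate_seq D).

(* [ereal_inf set0 = +oo], as wanted for a match that never occurs. *)
Definition waiting_time (D : R) (n : nat) (w : Omega) : \bar R :=
  ereal_inf [set i%:R%:E | i in [set i : nat |
    (0 < i)%N /\ (rho_n (block X 1 n w) (block Y i%:Z n w) <= D)%R]].

End distortion.

(* Main.v *)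
Require Import Defs.
From HB Require Import structures.
From mathcomp Require Import all_boot all_order all_algebra.
From mathcomp Require Import all_classical all_reals all_analysis.
From mathcomp Require Import ess_sup_inf measurable_realfun ring lra zify.

Set Implicit Arguments.
Unset Strict Implicit.
Unset Printing Implicit Defensive.

Import Order.TTheory GRing.Theory Num.Theory.
Import numFieldNormedType.Exports.

Local Open Scope classical_set_scope.
Local Open Scope ring_scope.

Local Notation path := Defs.path.
Local Notation shift := Defs.shift.

(** Let [q_n (x)] be the probability that an independent copy of [Y_1 ... Y_n]
    matches [x_1 ... x_n] within distortion [D] ([match_prob]). Everything rests on
    the almost sure asymptotics [q_n (X) = expR (- n (R + o (1)))], with [R] the
    rate of the statement.

    Given these asymptotics, the waiting time follows ([waiting_time_cvg]). By the
    union bound a match before time [expR (n (R - eps))] is unlikely; and by mixing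
    the windows of [Y] spaced by a fixed gap fail to match almost independently, so
    that one of the first [expR (n (R + eps))] succeeds. Both errors decay
    geometrically, and the Borel-Cantelli lemma concludes.

    The rate is computed by duality ([rate_duality]): the infimum of the relative
    entropy is the Legendre transform at [D] of the mean over [X] of the logarithmic
    moment [a |-> ln E (expR (a S_n))], where [S_n] is the distortion between a
    fixed [x_1 ... x_n] and [Y_1 ... Y_n]. The minimiser is the law of density
    [expR (a S_n)], normalised, with [a < 0] such that its mean distortion is [D].
    Such a tilt exists because [D] lies between [D_min] and [D_av]: as [a] tends to
    [-oo] the logarithmic moment divided by [a] tends to the essential infimum.

    The upper bound on [q_n (X)] is Chernoff's inequality. The lower bound tilts the
    law of [Y] so that the mean distortion is slightly below [D]; under the tilted
    law the distortion concentrates, and undoing the tilt costs the factor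
    [expR (- n (R + eps))]. Concentration is itself deduced from Chernoff bounds at
    nearby tilts ([tilted_lower_bound]), so that no tilted process is needed.

    When [Y] is i.i.d. the logarithmic moment of a block is the sum of those of its
    letters, Birkhoff's theorem ([birkhoff], proved here by Garsia's argument) gives
    its limit along [X], and a fixed tilt works because the limit is differentiable
    ([iid_match_prob]).

    When [Y] is psi-mixing and [rho] is bounded, the logarithmic moments are almost
    additive in the length of the block, up to a constant ([window_additive]). This
    gives their limit per letter with a uniform rate ([mean_window_rate]), hence the
    convergence of [R_n], and it expresses the moment of a long block as an ergodic
    average of moments of short blocks ([window_average]), hence the limit along
    [X]. This limit need not be seen to be differentiable: the lower bound cuts
    [1 ... n] into blocks of fixed length separated by gaps, and chooses for each
    path the tilt at which the mean of the sum over the blocks is right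
    ([block_tail]). The mixing factor per block is close to [1], and the gaps are
    short compared with the blocks. *)

(** * Exponential moments *)

(** From [expR (- u) >= 1 - u] one gets [expR u <= (1 - u)^-1], and the quadratic
    exceeds this inverse on [u <= 1/2]. *)
Lemma expR_quadratic (R : realType) (u : R) :
  u <= 1/2 -> expR u <= 1 + u + 2 * u ^+ 2.
Proof.
move=> u2.
have h : 1 - u <= expR (- u) by have := @expR_ge1Dx R (- u); lra.
have p : 0 < 1 - u by lra.
have : expR u <= (1 - u)^-1.
  by rewrite -[expR u]invrK -expRN lef_pV2 // posrE ?expR_gt0.
move=> /le_trans; apply; rewrite -[leLHS]mul1r ler_pdivrMr //.
have e : (1 + u + 2 * u ^+ 2) * (1 - u) = 1 + u ^+ 2 * (1 - 2 * u) by ring.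
rewrite e lerDl mulr_ge0 ?sqr_ge0 //; lra.
Qed.

(** Convexity of [expR] in tangent form, shifted from [expR_ge1Dx]. *)
Lemma expR_tangent (R : realType) (a b : R) : expR a * (1 + (b - a)) <= expR b.
Proof.
have -> : expR b = expR a * expR (b - a) by rewrite -expRD addrC subrK.
by rewrite ler_pM2l ?expR_gt0 // expR_ge1Dx.
Qed.

Section probability_integrals.
Context {d : measure_display} {T : measurableType d} {R : realType}.
Variable q : probability T R.
Implicit Types f g : T -> R.

Lemma bounded_integrable f (c : R) : measurable_fun setT f ->
  (forall y, `|f y| <= c) -> q.-integrable setT (EFin \o f).
Proof.
move=> mf fc; apply: measurable_bounded_integrable => //.
  by rewrite (le_lt_trans (probability_le1 q measurableT)) ?ltry.
by exists c; split; [exact: num_real | move=> x cx y _; apply: le_trans (fc y) _; exact: ltW].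
Qed.

Lemma integrable_cst (c : R) : q.-integrable setT (EFin \o cst c).
Proof. exact: finite_measure_integrable_cst. Qed.

Lemma Rintegral_cst1 (c : R) : \int[q]_y (cst c y) = c.
Proof. by rewrite Rintegral_cst //= probability_setT mulr1. Qed.

Lemma Rintegral_gt0 f : q.-integrable setT (EFin \o f) ->
  (forall y, 0 < f y) -> 0 < \int[q]_y f y.
Proof.
move=> intf f0; rewrite lt_neqAle Rintegral_ge0 ?andbT => [|y _]; last exact: ltW.
apply/eqP => i0.
have mf : measurable_fun setT (fun y => (f y)%:E) by exact: measurable_int intf.
have : (\int[q]_y `|(f y)%:E|)%E = 0%E.
  under eq_integral do rewrite gee0_abs ?lee_fin ?ltW //.
  by rewrite -[LHS]fineK ?(integrable_fin_num _ intf) // [fine _](esym i0).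
move/ae_eq_integral_abs => /(_ measurableT mf) ae0.
have : q.-negligible setT.
  case: ae0 => N [mN N0 sN]; exists N; split => // y _; apply: sN => /=.
  by move=> /(_ I) /eqP; rewrite eqe gt_eqF.
move/negligibleP => /(_ measurableT) q0.
by have /eqP := etrans (esym (probability_setT q)) q0; rewrite onee_eq0.
Qed.

End probability_integrals.

Section exponential_moments.
Context {d : measure_display} {T : measurableType d} {R : realType}.
Variable q : probability T R.
Implicit Types (h : T -> R) (a b t c : R).

Definition mgf h a : R := \int[q]_y expR (a * h y).
Definition lmgf h a : R := ln (mgf h a).
Definition tilted_mean h a : R := (\int[q]_y (h y * expR (a * h y))) / mgf h a.

(** [lmgf] and [tilted_mean] are total functions; these predicates say when they
    have their meaning. *)
Definition has_mgf h a := q.-integrable setT (EFin \o (fun y => expR (a * h y))).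
Definition has_tilt h a :=
  has_mgf h a /\ q.-integrable setT (EFin \o (fun y => h y * expR (a * h y))).

Lemma measurable_exp h a : measurable_fun setT h ->
  measurable_fun setT (fun y => expR (a * h y)).
Proof. by move=> mh; apply: measurableT_comp => //; apply: measurable_funM. Qed.

Lemma measurable_hexp h a : measurable_fun setT h ->
  measurable_fun setT (fun y => h y * expR (a * h y)).
Proof. by move=> mh; apply: measurable_funM => //; exact: measurable_exp. Qed.

Lemma has_mgf_le0 h a : measurable_fun setT h -> (forall y, 0 <= h y) ->
  a <= 0 -> has_mgf h a.
Proof.
move=> mh h0 a0; apply: (@bounded_integrable _ _ _ _ _ 1).
  exact: measurable_exp.
move=> y; rewrite ger0_norm ?expR_ge0 // expR_le1.
by rewrite mulr_le0_ge0.
Qed.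

(** The maximum of [s * expR (a * s)] over [s >= 0] is of order [(- a)^-1]; so tilts
    [a < 0] exist for unbounded [h]. *)
Lemma hexp_le h a : (forall y, 0 <= h y) -> a < 0 ->
  forall y, 0 <= h y * expR (a * h y) <= (- a)^-1.
Proof.
move=> h0 a0 y; rewrite mulr_ge0 ?expR_ge0 //=.
have na : 0 < - a by rewrite oppr_gt0.
rewrite -[leRHS]mul1r ler_pdivlMr // mulrAC.
have -> : h y * - a = - (a * h y) by ring.
have := expR_tangent (a * h y) 0.
rewrite expR0; set e := expR _.
move=> H; have e0 : 0 <= e by exact: expR_ge0.
move: H; set z := a * h y => H; nra.
Qed.

Lemma has_tilt_lt0 h a : measurable_fun setT h -> (forall y, 0 <= h y) ->
  a < 0 -> has_tilt h a.
Proof.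
move=> mh h0 a0; split; first exact: has_mgf_le0 (ltW a0).
apply: (@bounded_integrable _ _ _ _ _ (- a)^-1).
  exact: measurable_hexp.
by move=> y; case/andP: (hexp_le h0 a0 y) => p ?; rewrite ger0_norm.
Qed.

Lemma has_tilt_bounded h a c : measurable_fun setT h ->
  (forall y, 0 <= h y <= c) -> has_tilt h a.
Proof.
move=> mh hc.
have e y : expR (a * h y) <= expR (`|a| * c).
  rewrite ler_expR; case/andP: (hc y) => y0 yc.
  rewrite (le_trans (ler_norm _)) // normrM (ger0_norm y0).
  exact: ler_wpM2l.
split.
  apply: (@bounded_integrable _ _ _ _ _ (expR (`|a| * c))).
    exact: measurable_exp.
  by move=> y; rewrite ger0_norm ?expR_ge0.
apply: (@bounded_integrable _ _ _ _ _ (c * expR (`|a| * c))).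
  exact: measurable_hexp.
move=> y; case/andP: (hc y) => y0 yc.
by rewrite ger0_norm ?mulr_ge0 ?expR_ge0 // ler_pM // expR_ge0.
Qed.

Lemma has_tilt0 h : q.-integrable setT (EFin \o h) -> has_tilt h 0.
Proof.
move=> ih; split.
  rewrite /has_mgf (_ : _ \o _ = EFin \o cst 1); first exact: integrable_cst.
  by apply/funext => y /=; rewrite mul0r expR0.
apply: eq_integrable ih => // y _ /=.
by rewrite mul0r expR0 mulr1.
Qed.

Lemma mgf_gt0 h a : has_mgf h a -> 0 < mgf h a.
Proof. by move=> i; apply: Rintegral_gt0 => // y; exact: expR_gt0. Qed.

Lemma expR_lmgf h a : has_mgf h a -> expR (lmgf h a) = mgf h a.
Proof. by move=> i; rewrite lnK // posrE mgf_gt0. Qed.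

Lemma mgf0 h : mgf h 0 = 1.
Proof.
rewrite /mgf -[RHS](@Rintegral_cst1 _ _ _ q 1).
by apply: eq_Rintegral => y _; rewrite mul0r expR0.
Qed.

Lemma lmgf0 h : lmgf h 0 = 0. Proof. by rewrite /lmgf mgf0 ln1. Qed.

Lemma tilted_mean0 h : tilted_mean h 0 = \int[q]_y h y.
Proof.
rewrite /tilted_mean mgf0 divr1; apply: eq_Rintegral => y _.
by rewrite mul0r expR0 mulr1.
Qed.

Lemma mgf_le1 h a : measurable_fun setT h -> (forall y, 0 <= h y) ->
  a <= 0 -> mgf h a <= 1.
Proof.
move=> mh h0 a0; rewrite -[leRHS](@Rintegral_cst1 _ _ _ q 1).
apply: le_Rintegral => //.
- exact: has_mgf_le0.
- exact: integrable_cst.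
- by move=> y _; rewrite expR_le1 mulr_le0_ge0.
Qed.

Lemma lmgf_le0 h a : measurable_fun setT h -> (forall y, 0 <= h y) ->
  a <= 0 -> lmgf h a <= 0.
Proof. by move=> *; apply: ln_le0; exact: mgf_le1. Qed.

Lemma tilted_mean_ge0 h a : (forall y, 0 <= h y) -> 0 <= tilted_mean h a.
Proof.
move=> h0; apply: divr_ge0; apply: Rintegral_ge0 => y _.
  by rewrite mulr_ge0 ?expR_ge0.
exact: expR_ge0.
Qed.

(** Convexity of [lmgf], with its derivative [tilted_mean]: integrate
    [expR_tangent] against the weight [expR (a * h)]. This replaces every use of
    differentiability of [lmgf]. *)
Lemma lmgf_tangent h a b : has_tilt h a -> has_mgf h b ->
  lmgf h a + (b - a) * tilted_mean h a <= lmgf h b.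
Proof.
move=> [ia iha] ib; set m := tilted_mean h a.
have M0 := mgf_gt0 ia.
rewrite -ler_expR (expRD (lmgf h a)) (expR_lmgf ia) (expR_lmgf ib).
have pt y : expR ((b - a) * m) *
    ((1 - (b - a) * m) * expR (a * h y) + (b - a) * (h y * expR (a * h y)))
    <= expR (b * h y).
  have := expR_tangent ((b - a) * m) ((b - a) * h y).
  rewrite -(ler_pM2r (expR_gt0 (a * h y))).
  have -> : expR (b * h y) = expR ((b - a) * h y) * expR (a * h y).
    by rewrite -expRD; congr expR; ring.
  by apply: le_trans; rewrite le_eqVlt; apply/orP; left; apply/eqP; ring.
have i1 : q.-integrable setT (EFin \o (fun y => (1 - (b - a) * m) * expR (a * h y))).
  by have := integrableZl measurableT (1 - (b - a) * m) ia; apply: eq_integrable.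
have i2 : q.-integrable setT (EFin \o (fun y => (b - a) * (h y * expR (a * h y)))).
  by have := integrableZl measurableT (b - a) iha; apply: eq_integrable.
have i3 : q.-integrable setT (EFin \o (fun y =>
    ((1 - (b - a) * m) * expR (a * h y) + (b - a) * (h y * expR (a * h y))))).
  by have := integrableD measurableT i1 i2; apply: eq_integrable.
have i4 : q.-integrable setT (EFin \o (fun y => expR ((b - a) * m) *
    ((1 - (b - a) * m) * expR (a * h y) + (b - a) * (h y * expR (a * h y))))).
  by have := integrableZl measurableT (expR ((b - a) * m)) i3; apply: eq_integrable.
have := @le_Rintegral _ _ _ q setT _ _ measurableT i4 ib (fun y _ => pt y).
rewrite RintegralZl // RintegralD // !RintegralZl //.
rewrite -/(mgf h a) -/(mgf h b).
have -> : \int[q]_y (h y * expR (a * h y)) = m * mgf h a.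
  by rewrite /m /tilted_mean divfK // gt_eqF.
apply: le_trans; rewrite le_eqVlt; apply/orP; left; apply/eqP; ring.
Qed.

(** The converse of [lmgf_tangent] up to second order: [expR_quadratic] applied to
    [t * (h - m)], whose first-order term vanishes under the tilted law of mean
    [m]. *)
Lemma lmgf_quadratic h a t c : measurable_fun setT h ->
  (forall y, 0 <= h y <= c) -> `|t| * c <= 1/2 ->
  lmgf h (a + t) <= lmgf h a + t * tilted_mean h a + 2 * (t * c) ^+ 2.
Proof.
move=> mh hc tc; set m := tilted_mean h a.
have [ia iha] := has_tilt_bounded a mh hc.
have [iat _] := has_tilt_bounded (a + t) mh hc.
have M0 := mgf_gt0 ia.
have N : \int[q]_y (h y * expR (a * h y)) = m * mgf h a.
  by rewrite /m /tilted_mean divfK // gt_eqF.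
have m0 : 0 <= m by apply: tilted_mean_ge0 => y; case/andP: (hc y).
have mc : m <= c.
  rewrite -(ler_pM2r M0) -N /mgf -RintegralZl //.
  apply: le_Rintegral => //.
    by have := integrableZl measurableT c ia; apply: eq_integrable.
  by move=> y _; rewrite ler_wpM2r ?expR_ge0 //; case/andP: (hc y).
have key : mgf h (a + t) <= mgf h a * (expR (t * m) * (1 + 2 * (t * c) ^+ 2)).
  pose k := 1 + 2 * (t * c) ^+ 2 - t * m.
  have pt y : expR ((a + t) * h y) <=
      expR (t * m) * (k * expR (a * h y) + t * (h y * expR (a * h y))).
    have /andP[y0 yc] := hc y.
    have hm : `|h y - m| <= c by rewrite ler_norml; lra.
    have u2 : `|t * (h y - m)| <= 1/2.
      by rewrite normrM (le_trans _ tc) // ler_wpM2l.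
    have /expR_quadratic H : t * (h y - m) <= 1/2.
      by rewrite (le_trans (ler_norm _)).
    have sq : (t * (h y - m)) ^+ 2 <= (t * c) ^+ 2.
      rewrite -(real_normK (num_real (t * (h y - m)))).
      rewrite -(real_normK (num_real (t * c))).
      rewrite lerXn2r ?nnegrE // !normrM ler_wpM2l //.
      by rewrite (le_trans hm) // ler_norm.
    have -> : expR ((a + t) * h y) =
        expR (a * h y) * expR (t * m) * expR (t * (h y - m)).
      by rewrite -!expRD; congr expR; ring.
    have -> : expR (t * m) * (k * expR (a * h y) + t * (h y * expR (a * h y)))
       = expR (a * h y) * expR (t * m) * (1 + t * (h y - m) + 2 * (t * c) ^+ 2).
      by rewrite /k; ring.
    rewrite ler_wpM2l ?mulr_ge0 ?expR_ge0 // (le_trans H) //.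
    by rewrite lerD2l ler_wpM2l.
  have i1 : q.-integrable setT (EFin \o (fun y => k * expR (a * h y))).
    by have := integrableZl measurableT k ia; apply: eq_integrable.
  have i2 : q.-integrable setT (EFin \o (fun y => t * (h y * expR (a * h y)))).
    by have := integrableZl measurableT t iha; apply: eq_integrable.
  have i3 : q.-integrable setT (EFin \o (fun y =>
      (k * expR (a * h y) + t * (h y * expR (a * h y))))).
    by have := integrableD measurableT i1 i2; apply: eq_integrable.
  have i4 : q.-integrable setT (EFin \o (fun y => expR (t * m) *
      (k * expR (a * h y) + t * (h y * expR (a * h y))))).
    by have := integrableZl measurableT (expR (t * m)) i3; apply: eq_integrable.
  have := @le_Rintegral _ _ _ q setT _ _ measurableT iat i4 (fun y _ => pt y).
  rewrite RintegralZl // RintegralD // !RintegralZl // N -/(mgf h a).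
  move=> /le_trans; apply; rewrite le_eqVlt; apply/orP; left; apply/eqP.
  by rewrite /k; ring.
rewrite -ler_expR expR_lmgf // !expRD expR_lmgf // -mulrA (le_trans key) //.
by rewrite ler_pM2l // ler_pM2l ?expR_gt0 // expR_ge1Dx.
Qed.

(** Tilting: of the mass of [expR (a * h)], the part carried by [h > hi] and
    the part carried by [h < lo] are small by Chernoff bounds, and on
    [lo <= h <= hi] the weight is at most [expR (a * lo)]. *)
Lemma tilted_lower_bound h a t lo hi : measurable_fun setT h ->
  a <= 0 -> 0 <= t -> has_mgf h (a - t) -> has_mgf h a -> has_mgf h (a + t) ->
  mgf h a <= expR (a * lo) * fine (q [set y | h y <= hi])
             + expR (- t * hi) * mgf h (a + t) + expR (t * lo) * mgf h (a - t).
Proof.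
move=> mh a0 t0 im i0 ip.
pose B := [set y | h y <= hi].
have mB : measurable B.
  rewrite /B -[X in measurable X]setTI.
  by apply: measurable_fun_ler => //.
have pt y : expR (a * h y) <= expR (a * lo) * \1_B y
    + expR (- t * hi) * expR ((a + t) * h y)
    + expR (t * lo) * expR ((a - t) * h y).
  have e1 : expR (- t * hi) * expR ((a + t) * h y) =
      expR (a * h y) * expR (t * (h y - hi)).
    by rewrite -!expRD; congr expR; ring.
  have e2 : expR (t * lo) * expR ((a - t) * h y) =
      expR (a * h y) * expR (t * (lo - h y)).
    by rewrite -!expRD; congr expR; ring.
  rewrite e1 e2 indicE.
  have E0 := expR_ge0 (a * h y).
  have E1 := expR_ge0 (t * (h y - hi)).
  have E2 := expR_ge0 (t * (lo - h y)).
  have E3 := expR_ge0 (a * lo).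
  have [hlo|hlo] := ltP (h y) lo.
    have : 1 <= expR (t * (lo - h y)).
      by rewrite -expR0 ler_expR mulr_ge0 // subr_ge0 ltW.
    move=> H; have : 0 <= (y \in B)%:R :> R by [].
    move=> H2; rewrite -[leLHS]add0r lerD //.
    by rewrite ler_peMr.
  have [hhi|hhi] := ltP hi (h y).
    have H : 1 <= expR (t * (h y - hi)).
      by rewrite -expR0 ler_expR mulr_ge0 // subr_ge0 ltW.
    rewrite -addrA addrCA -[leLHS]addr0 lerD //.
      by rewrite ler_peMr.
  rewrite mem_set // mulr1 -addrA -[leLHS]addr0 lerD //.
  by rewrite ler_expR ler_wnM2l.
have iB : q.-integrable setT (EFin \o (fun y => expR (a * lo) * \1_B y)).
  have := integrableZl measurableT (expR (a * lo)) (integrable_indic q mB).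
  by apply: eq_integrable.
have i1 : q.-integrable setT (EFin \o (fun y => expR (- t * hi) * expR ((a + t) * h y))).
  by have := integrableZl measurableT (expR (- t * hi)) ip; apply: eq_integrable.
have i2 : q.-integrable setT (EFin \o (fun y => expR (t * lo) * expR ((a - t) * h y))).
  by have := integrableZl measurableT (expR (t * lo)) im; apply: eq_integrable.
have i3 : q.-integrable setT (EFin \o (fun y => expR (a * lo) * \1_B y
    + expR (- t * hi) * expR ((a + t) * h y))).
  by have := integrableD measurableT iB i1; apply: eq_integrable.
have i4 : q.-integrable setT (EFin \o (fun y => expR (a * lo) * \1_B y
    + expR (- t * hi) * expR ((a + t) * h y)
    + expR (t * lo) * expR ((a - t) * h y))).
  by have := integrableD measurableT i3 i2; apply: eq_integrable.
have := @le_Rintegral _ _ _ q setT _ _ measurableT i0 i4 (fun y _ => pt y).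
rewrite !RintegralD // !RintegralZl //; last exact: integrable_indic.
rewrite -!/(mgf h _) (_ : \int[q]_x \1_B x = fine (q B)) //.
by rewrite /Rintegral integral_indic // setIT.
Qed.

(** Chernoff's bound: as [a <= 0], the weight [expR (a * h)] is at least
    [expR (a * c)] on the event. *)
Lemma chernoff_lower h a c : measurable_fun setT h -> a <= 0 -> has_mgf h a ->
  fine (q [set y | h y <= c]) <= expR (lmgf h a - a * c).
Proof.
move=> mh a0 ia; rewrite expRD expR_lmgf // mulrC.
pose B := [set y | h y <= c].
have mB : measurable B.
  by rewrite /B -[X in measurable X]setTI; apply: measurable_fun_ler.
have -> : fine (q [set y | h y <= c]) = \int[q]_x \1_B x.
  by rewrite /Rintegral integral_indic // setIT.
rewrite /mgf -RintegralZl //.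
apply: le_Rintegral => //.
- exact: integrable_indic.
- by have := integrableZl measurableT (expR (- (a * c))) ia; apply: eq_integrable.
move=> y _; rewrite indicE -expRD.
have [|_] := boolP (y \in B); last exact: expR_ge0.
rewrite inE /B /= => hc; rewrite -[leLHS]expR0 ler_expR.
rewrite -mulrN -mulrDr; nra.
Qed.

End exponential_moments.

(** * Continuity of the tilted mean *)
Section tilted_continuity.
Context {d : measure_display} {T : measurableType d} {R : realType}.
Variable q : probability T R.
Implicit Types (h : T -> R) (a : R).

Let continuous_exp h (y : T) : continuous (fun a : R => expR (a * h y)).
Proof.
move=> a; apply: continuous_comp; last exact: continuous_expR.
by apply: cvgM; [exact: cvg_id | exact: cvg_cst].
Qed.

Let continuous_hexp h (y : T) : continuous (fun a : R => h y * expR (a * h y)).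
Proof.
move=> a; apply: cvgM; first exact: cvg_cst.
exact: continuous_exp.
Qed.

Lemma continuous_tilted_mean_itv h (u v k1 k2 : R) : measurable_fun setT h ->
  (forall a y, a \in `]u, v[%classic -> `|expR (a * h y)| <= k1) ->
  (forall a y, a \in `]u, v[%classic -> `|h y * expR (a * h y)| <= k2) ->
  {in `]u, v[%classic, continuous (tilted_mean q h)}.
Proof.
move=> mh b1 b2 a Ia.
have I1 b : `]u, v[%classic b -> q.-integrable setT (EFin \o (fun y => expR (b * h y))).
  move=> Ib; apply: (@bounded_integrable _ _ _ _ _ k1); first exact: measurable_exp.
  by move=> y; apply: b1; rewrite inE.
have I2 b : `]u, v[%classic b -> q.-integrable setT (EFin \o (fun y => h y * expR (b * h y))).
  move=> Ib; apply: (@bounded_integrable _ _ _ _ _ k2); first exact: measurable_hexp.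
  by move=> y; apply: b2; rewrite inE.
rewrite /tilted_mean; apply: cvgM.
  apply: (@continuity_under_integral _ _ _ q (fun b y => h y * expR (b * h y)) _
    measurableT u v I2 _ (cst k2)) => //.
  - by apply: aeW => y _ b _; exact: continuous_hexp.
  - exact: integrable_cst.
  - by move=> b Ib; apply: aeW => y _; apply: b2; rewrite inE.
apply: cvgV.
  by rewrite gt_eqF // mgf_gt0 //; apply: I1; rewrite inE in Ia.
apply: (@continuity_under_integral _ _ _ q (fun b y => expR (b * h y)) _
    measurableT u v I1 _ (cst k1)) => //.
- by apply: aeW => y _ b _; exact: continuous_exp.
- exact: integrable_cst.
- by move=> b Ib; apply: aeW => y _; apply: b1; rewrite inE.
Qed.

Lemma continuous_tilted_mean_lt0 h a : measurable_fun setT h ->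
  (forall y, 0 <= h y) -> a < 0 -> {for a, continuous (tilted_mean q h)}.
Proof.
move=> mh h0 a0.
apply: (@continuous_tilted_mean_itv h (a - 1) (a / 2) 1 (- (a / 2))^-1 mh).
- move=> b y; rewrite inE /= in_itv /= => /andP[_ b2].
  rewrite ger0_norm ?expR_ge0 // expR_le1 mulr_le0_ge0 //; lra.
- move=> b y; rewrite inE /= in_itv /= => /andP[_ b2].
  have a2 : a / 2 < 0 by lra.
  have b0 : b < 0 by lra.
  have /andP[p1 p2] := hexp_le h0 b0 y.
  rewrite ger0_norm // (le_trans p2) // lef_pV2 ?posrE; lra.
- by rewrite inE /= in_itv /=; lra.
Qed.

Lemma continuous_tilted_mean_bounded h a (c : R) : measurable_fun setT h ->
  (forall y, 0 <= h y <= c) -> {for a, continuous (tilted_mean q h)}.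
Proof.
move=> mh hc.
have E b y : b \in `](a - 1), (a + 1)[%classic ->
    `|expR (b * h y)| <= expR ((`|a| + 1) * c).
  rewrite inE /= in_itv /= => /andP[b1 b2].
  rewrite ger0_norm ?expR_ge0 // ler_expR (le_trans (ler_norm _)) //.
  rewrite normrM; apply: ler_pM => //.
    have := ler_norm a; have := ler_norm (- a); rewrite normrN => ? ?.
    rewrite ler_norml; lra.
  by have /andP[? ?] := hc y; rewrite ger0_norm.
apply: (@continuous_tilted_mean_itv h (a - 1) (a + 1)
  (expR ((`|a| + 1) * c)) (c * expR ((`|a| + 1) * c)) mh) => //.
- move=> b y bi; rewrite normrM; apply: ler_pM => //; last exact: E.
  by have /andP[? ?] := hc y; rewrite ger0_norm.
- by rewrite inE /= in_itv /=; lra.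
Qed.

End tilted_continuity.

(** * Integrals, densities and image measures *)
Section measure_facts.
Context {d : measure_display} {T : measurableType d} {R : realType}.
Local Open Scope ereal_scope.

(** Stated without integrability: compare positive and negative parts. *)
Lemma integrable_le_integral (mu : {measure set T -> \bar R}) (b k : T -> \bar R) :
  measurable_fun setT b -> measurable_fun setT k ->
  (forall x, b x <= k x) -> \int[mu]_x b x <= \int[mu]_x k x.
Proof.
move=> mb mk bk; rewrite integralE [leRHS]integralE leeB//.
- apply: ge0_le_integral => //.
  + exact: measurable_funepos.
  + exact: measurable_funepos.
  + by move=> x _; apply: (@funepos_le _ _ setT) => //; rewrite inE.
- apply: ge0_le_integral => //.
  + exact: measurable_funeneg.
  + exact: measurable_funeneg.
  + by move=> x _; apply: (@funeneg_le _ _ setT) => //; rewrite inE.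
Qed.

Lemma ae_le_integral (mu : {measure set T -> \bar R}) (b k : T -> \bar R) :
  measurable_fun setT b -> measurable_fun setT k ->
  {ae mu, forall x, b x <= k x} -> \int[mu]_x b x <= \int[mu]_x k x.
Proof.
move=> mb mk bk.
have mm : measurable_fun setT (fun x => maxe (b x) (k x)).
  exact: measurable_maxe.
rewrite [leRHS](@ae_eq_integral _ _ _ _ setT (fun x => maxe (b x) (k x))) //.
  apply: integrable_le_integral => // x.
  by rewrite le_max lexx.
by apply: filterS bk => x bk _; rewrite max_r.
Qed.

Lemma measurable_lne : measurable_fun setT (@lne R).
Proof.
have -> : @lne R = fun x => if x == +oo then +oo else
    if x <= 0 then -oo else (ln (fine x))%:E.
  by apply/funext => -[r| |] //=; rewrite ?lee_fin ?leNye.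
apply: measurable_fun_ifT => //.
  apply: (measurable_fun_bool true); rewrite setTI.
  rewrite (_ : _ @^-1` _ = [set +oo]); first exact: emeasurable_set1.
  by apply/seteqP; split => x /= /eqP.
apply: measurable_fun_ifT => //.
  apply: (measurable_fun_bool true); rewrite setTI.
  rewrite (_ : _ @^-1` _ = [set` `]-oo, 0%E]]); first exact: emeasurable_itv.
  by apply/seteqP; split => x /=; rewrite in_itv.
apply/measurable_EFinP; apply: measurableT_comp; first exact: measurable_ln.
exact: fine_measurable.
Qed.

(** The proofs are arguments of the set function so that its measure structures
    can be inferred from the term. *)
Definition with_density (mu : {measure set T -> \bar R}) (f : T -> \bar R)
    (mf : measurable_fun setT f) (f0 : forall x, 0 <= f x)
    (f1 : \int[mu]_x f x = 1) (A : set T) : \bar R := \int[mu]_(x in A) f x.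

Section with_density_measure.
Variables (mu : {measure set T -> \bar R}) (f : T -> \bar R).
Variables (mf : measurable_fun setT f) (f0 : forall x, 0 <= f x).
Variable f1 : \int[mu]_x f x = 1.
Local Notation nu := (@with_density mu f mf f0 f1).

Let nu0 : nu set0 = 0. Proof. by rewrite /with_density integral_set0. Qed.
Let nu_ge0 A : 0 <= nu A. Proof. exact: integral_ge0. Qed.
Let nu_sigma : semi_sigma_additive nu.
Proof. exact: semi_sigma_additive_nng_induced. Qed.

HB.instance Definition _ := isMeasure.Build _ _ _ nu nu0 nu_ge0 nu_sigma.

Let nu1 : nu setT = 1. Proof. by []. Qed.

HB.instance Definition _ := Measure_isProbability.Build _ _ _ nu nu1.

End with_density_measure.

End measure_facts.

Section image_measure.
Context {d d' : measure_display} {X : measurableType d} {Y : measurableType d'}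
  {R : realType} (mu : {measure set X -> \bar R})
  (nu : {measure set Y -> \bar R}) (phi : X -> Y).
Hypothesis mphi : measurable_fun setT phi.
Hypothesis muphi : forall E, measurable E -> mu (phi @^-1` E) = nu E.
Local Open Scope ereal_scope.

Lemma ge0_integral_image (h : Y -> \bar R) : measurable_fun setT h ->
  (forall y, 0 <= h y) -> \int[mu]_x h (phi x) = \int[nu]_y h y.
Proof.
move=> mh h0.
rewrite (@eq_measure_integral _ _ _ _ (pushforward mu phi) nu) => [|E mE _].
  by rewrite (ge0_integral_pushforward mphi).
exact/esym/muphi.
Qed.

Lemma integrable_image (h : Y -> \bar R) : nu.-integrable setT h ->
  mu.-integrable setT (fun x => h (phi x)).
Proof.
move=> /integrableP[mh hoo]; apply/integrableP; split.
  exact: measurableT_comp.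
rewrite (@ge0_integral_image (abse \o h)) // => [|y]; last exact: abse_ge0.
exact: measurableT_comp.
Qed.

Lemma integral_image (h : Y -> \bar R) : nu.-integrable setT h ->
  \int[mu]_x h (phi x) = \int[nu]_y h y.
Proof.
move=> ih; have mh := measurable_int _ ih.
rewrite (@eq_measure_integral _ _ _ _ (pushforward mu phi) nu) => [|E mE _].
  rewrite (integral_pushforward mphi) //; exact: integrable_image.
exact/esym/muphi.
Qed.

End image_measure.

Section densities.
Context {d : measure_display} {T : measurableType d} {R : realType}.
Local Open Scope ereal_scope.
Variables (mu nu : probability T R).
Hypothesis numu : nu `<< mu.
Local Notation g := (Radon_Nikodym_SigmaFinite.f nu mu).

Lemma density_measurable : measurable_fun setT g.
Proof.
apply: measurable_int.
exact: (Radon_Nikodym_SigmaFinite.f_integrable numu).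
Qed.

Lemma relative_entropyE : relative_entropy nu mu = \int[nu]_z lne (g z).
Proof.
rewrite /relative_entropy asboolT //; apply: ae_eq_integral => //.
- apply: measurableT_comp; first exact: measurable_lne.
  by apply: measurable_int; exact: Radon_Nikodym_integrable.
- by apply: measurableT_comp; [exact: measurable_lne | exact: density_measurable].
apply: null_dominates_ae_eq numu _ => //.
apply: ae_eq_comp.
by apply: ae_eq_sym; exact: ae_eq_Radon_Nikodym_SigmaFinite.
Qed.

(** [nu] does not charge the set where its density vanishes, although [mu] may. *)
Lemma density_pos : {ae nu, forall z, 0 < g z}.
Proof.
exists [set z | g z <= 0]; split.
- rewrite -[X in measurable X]setTI; apply: emeasurable_fun_infty_c => //.
  exact: density_measurable.
- rewrite (Radon_Nikodym_SigmaFinite.f_integral numu); last first.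
    rewrite -[X in measurable X]setTI; apply: emeasurable_fun_infty_c => //.
    exact: density_measurable.
  apply: integral0_eq => z /= gz; apply/eqP.
  by rewrite eq_le gz (Radon_Nikodym_SigmaFinite.f_ge0 numu).
- by move=> z /= /negP; rewrite -leNgt.
Qed.

Lemma integral_density (f : T -> \bar R) : (forall z, 0 <= f z) ->
  measurable_fun setT f -> \int[nu]_z f z = \int[mu]_z (f z * g z).
Proof.
by move=> f0 mf; rewrite Radon_Nikodym_SigmaFinite.change_of_variables.
Qed.

End densities.


(** * Duality: the rate function as a Legendre transform *)
Section duality.
Context {d1 d2 : measure_display} {S : measurableType d1}
  {T : measurableType d2} {R : realType}.
Variables (p : probability S R) (q : probability T R) (f : S -> T -> R).
Hypothesis mf : measurable_fun setT (fun z : S * T => f z.1 z.2).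
Hypothesis f0 : forall x y, 0 <= f x y.

Let mfx x : measurable_fun setT (f x).
Proof. exact: (measurableT_comp mf (pair1_measurable x)). Qed.

Let has_mgfx x a : a <= 0 -> has_mgf q (f x) a.
Proof. by move=> a0; exact: (@has_mgf_le0 _ _ _ q (f x)). Qed.

Let has_tiltx x a : a < 0 -> has_tilt q (f x) a.
Proof. by move=> a0; exact: (@has_tilt_lt0 _ _ _ q (f x)). Qed.

Lemma measurable_Rintegral_section (g : S * T -> R) : measurable_fun setT g ->
  (forall z, 0 <= g z) -> measurable_fun setT (fun x => \int[q]_y g (x, y)).
Proof.
move=> mg g0; apply: measurableT_comp; first exact: fine_measurable.
apply: (measurable_fun_fubini_tonelli_F (fun z => (g z)%:E)) => //.
by apply/measurable_EFinP.
Qed.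

Let mexp a : measurable_fun setT (fun z : S * T => expR (a * f z.1 z.2)).
Proof. by apply: measurableT_comp => //; apply: measurable_funM. Qed.

Lemma measurable_mgf a : measurable_fun setT (fun x => mgf q (f x) a).
Proof.
apply: (measurable_Rintegral_section (mexp a)) => z; exact: expR_ge0.
Qed.

Lemma measurable_lmgf a : measurable_fun setT (fun x => lmgf q (f x) a).
Proof. by apply: measurableT_comp; [exact: measurable_ln | exact: measurable_mgf]. Qed.

Let mhexp a : measurable_fun setT (fun z : S * T => f z.1 z.2 * expR (a * f z.1 z.2)).
Proof. exact: measurable_funM. Qed.

Lemma measurable_tilted_mean a : a < 0 ->
  measurable_fun setT (fun x => tilted_mean q (f x) a).
Proof.
move=> a0.
have -> : (fun x => tilted_mean q (f x) a) = (fun x =>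
    \int[q]_y (f x y * expR (a * f x y)) * expR (- lmgf q (f x) a)).
  apply/funext => x; rewrite expRN expR_lmgf //; exact: has_mgfx (ltW a0).
apply: measurable_funM.
  apply: (measurable_Rintegral_section (mhexp a)) => z.
  by rewrite mulr_ge0 ?expR_ge0.
apply: measurableT_comp => //; apply: measurable_funN; exact: measurable_lmgf.
Qed.

Hypothesis int_f : (\int[p \x q]_z (f z.1 z.2)%:E < +oo)%E.

Let mean x : \bar R := (\int[q]_y (f x y)%:E)%E.

Let mean_ge0 x : (0 <= mean x)%E.
Proof. by apply: integral_ge0 => y _; rewrite lee_fin. Qed.

Let mean_int : (\int[p]_x mean x = \int[p \x q]_z (f z.1 z.2)%:E)%E.
Proof.
rewrite (fubini_tonelli1 (fun z => (f z.1 z.2)%:E)) //.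
  by apply/measurable_EFinP.
by move=> z; rewrite lee_fin.
Qed.

Let measurable_mean : measurable_fun setT mean.
Proof.
apply: (measurable_fun_fubini_tonelli_F (fun z => (f z.1 z.2)%:E)) => //.
  by apply/measurable_EFinP.
by move=> z; rewrite lee_fin.
Qed.

Let mean_integrable : p.-integrable setT mean.
Proof.
apply/integrableP; split => //.
by under eq_integral do rewrite gee0_abs //; rewrite mean_int.
Qed.

Let finite_mean x : mean x \is a fin_num -> q.-integrable setT (EFin \o f x).
Proof.
move=> fx; apply/integrableP; split; first exact/measurable_EFinP.
under eq_integral do rewrite /= ger0_norm //.
by move: fx; rewrite ge0_fin_numE.
Qed.

Let finite_meanE x : mean x \is a fin_num -> mean x = (\int[q]_y f x y)%:E.
Proof. by move=> fx; rewrite /Rintegral fineK. Qed.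

(** Jensen's inequality; the mean may be infinite at some [x]. *)
Lemma lmgf_mean x a : a <= 0 -> ((- lmgf q (f x) a)%:E <= (- a)%:E * mean x)%E.
Proof.
rewrite le_eqVlt => /predU1P[->|a0]; first by rewrite lmgf0 oppr0 mul0e.
have [fx|fx] := boolP (mean x \is a fin_num); last first.
  move: fx; rewrite ge0_fin_numE // -leNgt leye_eq => /eqP ->.
  by rewrite mulry gtr0_sg ?oppr_gt0 // mul1e leey.
rewrite finite_meanE // -EFinM lee_fin.
have := lmgf_tangent (has_tilt0 (finite_mean fx)) (has_mgfx x (ltW a0)).
by rewrite lmgf0 tilted_mean0 subr0 add0r mulNr lerN2.
Qed.

Lemma lmgf_integrable a : a <= 0 -> p.-integrable setT (fun x => (lmgf q (f x) a)%:E).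
Proof.
move=> a0; apply: le_integrable (integrableZl measurableT (- a) mean_integrable) => //.
  by apply/measurable_EFinP; exact: measurable_lmgf.
move=> x _ /=; rewrite ler0_norm ?lmgf_le0 //.
rewrite gee0_abs; first exact: lmgf_mean.
by rewrite mule_ge0 // lee_fin oppr_ge0.
Qed.

Lemma tilted_mean_le_lmgf x a : a < 0 -> - a * tilted_mean q (f x) a <= - lmgf q (f x) a.
Proof.
move=> a0; have := lmgf_tangent (has_tiltx x a0) (has_mgfx x (lexx 0)).
rewrite lmgf0; lra.
Qed.

Let tilted_mean_le x a : a < 0 -> ((tilted_mean q (f x) a)%:E <= mean x)%E.
Proof.
move=> a0; have na : 0 < - a by rewrite oppr_gt0.
have na' : (0%:E < (- a)%:E)%E by rewrite lte_fin.
rewrite -(@lee_pmul2l _ (- a)%:E) //.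
by apply: le_trans (lmgf_mean x (ltW a0)); rewrite -EFinM lee_fin tilted_mean_le_lmgf.
Qed.

Lemma tilted_mean_integrable a : a < 0 ->
  p.-integrable setT (fun x => (tilted_mean q (f x) a)%:E).
Proof.
move=> a0; apply: le_integrable mean_integrable => //.
  by apply/measurable_EFinP; exact: measurable_tilted_mean.
move=> x _ /=; rewrite ger0_norm ?tilted_mean_ge0 //.
by rewrite gee0_abs // tilted_mean_le.
Qed.

Definition mean_lmgf a : R := \int[p]_x lmgf q (f x) a.
Definition mean_tilt a : R := \int[p]_x tilted_mean q (f x) a.

Lemma EFin_mean_lmgf a : a <= 0 ->
  ((mean_lmgf a)%:E = \int[p]_x (lmgf q (f x) a)%:E)%E.
Proof.
move=> a0; rewrite /mean_lmgf /Rintegral fineK //.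
by apply: integrable_fin_num => //; exact: lmgf_integrable.
Qed.

Lemma EFin_mean_tilt a : a < 0 ->
  ((mean_tilt a)%:E = \int[p]_x (tilted_mean q (f x) a)%:E)%E.
Proof.
move=> a0; rewrite /mean_tilt /Rintegral fineK //.
by apply: integrable_fin_num => //; exact: tilted_mean_integrable.
Qed.

Lemma mean_lmgf0 : mean_lmgf 0 = 0.
Proof.
rewrite /mean_lmgf -[RHS](@Rintegral_cst1 _ _ _ p 0).
by apply: eq_Rintegral => x _; rewrite lmgf0.
Qed.

(** [mean_tilt] is the slope of [mean_lmgf], by integrating [lmgf_tangent]. *)
Lemma mean_lmgf_tangent a b : a < 0 -> b <= 0 ->
  mean_lmgf a + (b - a) * mean_tilt a <= mean_lmgf b.
Proof.
move=> a0 b0; rewrite /mean_lmgf /mean_tilt.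
have i1 : p.-integrable setT (EFin \o (fun x => (b - a) * tilted_mean q (f x) a)).
  have := integrableZl measurableT (b - a) (tilted_mean_integrable a0).
  by apply: eq_integrable.
rewrite -RintegralZl //; last exact: tilted_mean_integrable.
rewrite -RintegralD //; last exact: lmgf_integrable (ltW a0).
apply: le_Rintegral => //.
- by have := integrableD measurableT (lmgf_integrable (ltW a0)) i1; apply: eq_integrable.
- exact: lmgf_integrable.
- by move=> x _; apply: lmgf_tangent; [exact: has_tiltx | exact: has_mgfx].
Qed.

Lemma continuous_mean_tilt a : a < 0 -> {for a, continuous mean_tilt}.
Proof.
move=> a0.
have tI b : `](a - 1), 0[%classic b -> b < 0 by rewrite /= in_itv /= => /andP[].
apply: (@continuity_under_integral _ _ _ p (fun b x => tilted_mean q (f x) b) _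
  measurableT (a - 1) 0 _ _ (fun x => fine (mean x))).
- by move=> b /tI b0; exact: tilted_mean_integrable.
- apply: aeW => x _ b; rewrite inE => /tI b0.
  exact: continuous_tilted_mean_lt0.
- apply: le_integrable mean_integrable => //.
    apply/measurable_EFinP; apply: measurableT_comp => //.
  move=> x _ /=; have [fx|fx] := boolP (mean x \is a fin_num).
    by rewrite -[in leRHS](fineK fx).
  move: fx; rewrite ge0_fin_numE // -leNgt leye_eq => /eqP ->.
  by rewrite normr0 leey.
- move=> b /tI b0.
  apply: filterS (integrable_ae measurableT mean_integrable) => x /(_ I) fx _.
  by rewrite ger0_norm ?tilted_mean_ge0 // -lee_fin fineK // tilted_mean_le.
- by rewrite inE /= in_itv /=; lra.
Qed.

(** By monotone convergence: as [a] increases to [0], [f * expR (a * f)] increases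
    to [f], and its mean is at most the tilted mean since [mgf <= 1]. *)
Lemma mean_tilt_large D : (D%:E < \int[p \x q]_z (f z.1 z.2)%:E)%E ->
  exists2 a : R, a < 0 & D < mean_tilt a.
Proof.
move=> Df; apply: contrapT => nex.
have le_D a : a < 0 -> mean_tilt a <= D.
  by move=> a0; rewrite leNgt; apply/negP => ?; apply: nex; exists a.
pose a_ n : R := - (n.+1%:R)^-1.
have a_lt0 n : a_ n < 0 by rewrite oppr_lt0 invr_gt0.
pose g_ n (z : S * T) : \bar R := (f z.1 z.2 * expR (a_ n * f z.1 z.2))%:E.
have g0 n z : (0 <= g_ n z)%E by rewrite lee_fin mulr_ge0 ?expR_ge0.
have mg n : measurable_fun setT (g_ n).
  by apply/measurable_EFinP; exact: mhexp.
have cvg_a : a_ n @[n --> \oo] --> (0 : R).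
  by rewrite -oppr0; apply: cvgN; exact: cvg_harmonic.
have cvg_g z : g_ n z @[n --> \oo] --> (f z.1 z.2)%:E.
  apply: cvg_EFin; first by apply: nearW.
  rewrite /= -[X in _ --> X]mulr1; apply: cvgM; first exact: cvg_cst.
  rewrite -expR0; apply: continuous_cvg; first exact: continuous_expR.
  by rewrite -(mul0r (f z.1 z.2)); apply: cvgM => //; exact: cvg_cst.
have nd_g z : {homo g_ ^~ z : n m / (n <= m)%N >-> (n <= m)%E}.
  move=> n m nm; rewrite lee_fin ler_wpM2l // ler_expR ler_wpM2r //.
  by rewrite lerN2 lef_pV2 ?posrE // ler_nat.
have := @cvg_monotone_convergence _ _ _ (p \x q)%E setT measurableT g_ mg
  (fun n z _ => g0 n z) (fun z _ => nd_g z).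
under [X in _ --> X -> _]eq_integral => z _.
  rewrite (cvg_lim _ (cvg_g z)) //; over.
move=> cvgI; move: Df; rewrite ltNge => /negP; apply.
rewrite -(cvg_lim _ cvgI) //; apply: lime_le.
  by apply/cvg_ex; eexists; exact: cvgI.
apply: nearW => n.
rewrite fubini_tonelli1 //.
apply: (@le_trans _ _ (\int[p]_x (tilted_mean q (f x) (a_ n))%:E)%E).
  apply: ge0_le_integral => //.
  - by move=> x _; apply: integral_ge0.
  - by apply: measurable_fun_fubini_tonelli_F.
  - by apply/measurable_EFinP; exact: measurable_tilted_mean.
  move=> x _; have [i1 i2] := has_tiltx x (a_lt0 n).
  rewrite /fubini_F /g_ /= -[leLHS]fineK; last exact: integrable_fin_num.
  rewrite lee_fin ler_pdivlMr ?mgf_gt0 // ler_piMr ?mgf_le1 //; last exact: ltW.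
  by apply: fine_ge0; apply: integral_ge0 => y _; rewrite lee_fin mulr_ge0 ?expR_ge0.
by rewrite -EFin_mean_tilt // lee_fin le_D.
Qed.

Lemma ess_inf_lt_fin x : ess_inf q (fun y => (f x y)%:E) \is a fin_num.
Proof.
rewrite ge0_fin_numE; last by apply/ess_infP/aeW => y; rewrite lee_fin.
rewrite ltey; apply/eqP => /ess_inf_eqyP [N [mN N0 sN]].
have : N = setT by apply/seteqP; split => // y _; apply: sN.
move=> NT; have /eqP := etrans (esym (probability_setT q)) (etrans (congr1 q (esym NT)) N0).
by rewrite onee_eq0.
Qed.

(** Below by the almost sure bound [f x >= e]; above by Chernoff's bound on the
    set [f x <= e + eps], whose probability is positive. *)
Lemma cvg_lmgf_ess_inf x :
  ((- lmgf q (f x) (- n.+1%:R) / n.+1%:R)%:E)%E @[n --> \oo]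
    --> ess_inf q (fun y => (f x y)%:E).
Proof.
have /fineK <- := ess_inf_lt_fin x.
set e := fine _.
have fe : {ae q, forall y, e <= f x y}.
  have : {ae q, forall y, (e%:E <= (f x y)%:E)%E}.
    by apply/ess_infP; rewrite /e fineK // ess_inf_lt_fin.
  by apply: filterS => y; rewrite lee_fin.
apply: cvg_EFin; first exact: nearW.
have lo n : e <= - lmgf q (f x) (- n.+1%:R) / n.+1%:R.
  rewrite ler_pdivlMr // lerNr -ler_expR expR_lmgf; last first.
    by apply: has_mgfx; rewrite oppr_le0 ler0n.
  rewrite -[leRHS](@Rintegral_cst1 _ _ _ q) -lee_fin /mgf /Rintegral.
  rewrite !fineK; [|apply: integrable_fin_num..] => //; last 2 first.
  - exact: integrable_cst.
  - apply: has_mgfx; rewrite oppr_le0; exact: ler0n.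
  apply: ae_le_integral => //.
  - by apply/measurable_EFinP; exact: measurable_exp.
  - by apply/measurable_EFinP.
  apply: filterS fe => y ey; rewrite lee_fin ler_expR mulNr lerN2 mulrC.
  by rewrite ler_wpM2l.
have hi eps : 0 < eps -> exists k, forall n,
    - lmgf q (f x) (- n.+1%:R) / n.+1%:R <= e + eps + k / n.+1%:R.
  move=> eps0; pose B := [set y | f x y <= e + eps].
  have mB : measurable B.
    by rewrite /B -[X in measurable X]setTI; apply: measurable_fun_ler.
  have B0 : 0 < fine (q B).
    rewrite fine_gt0 // ltey_eq fin_num_measure // andbT lt0e measure_ge0 andbT.
    apply/eqP => B0.
    have : ((e + eps)%:E <= ess_inf q (fun y => (f x y)%:E))%E.
      apply/ess_infP; exists B; split => // y /= /negP.
      by rewrite lee_fin -ltNge => /ltW.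
    rewrite -[in leRHS](fineK (ess_inf_lt_fin x)) lee_fin -/e; lra.
  exists (- ln (fine (q B))) => n.
  have := @chernoff_lower _ _ _ q (f x) (- n.+1%:R) (e + eps) (mfx x).
  rewrite oppr_le0 ler0n => /(_ isT).
  have h : has_mgf q (f x) (- n.+1%:R) by apply: has_mgfx; rewrite oppr_le0 ler0n.
  move=> /(_ h); rewrite -/B -ler_ln ?posrE ?expR_gt0 // expRK => H.
  rewrite ler_pdivrMr // mulrDl divfK ?pnatr_eq0 //.
  move: H; lra.
apply/cvgrPdist_le => eps eps0.
have [k hk] := hi (eps / 2) ltac:(lra).
have cvgk : k / n.+1%:R @[n --> \oo] --> (0 : R).
  by rewrite -(mulr0 k); apply: cvgM; [exact: cvg_cst | exact: cvg_harmonic].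
have e2 : 0 < eps / 2 by lra.
move/cvgrPdist_le : cvgk => /(_ _ e2); apply: filterS => n.
rewrite sub0r normrN => kn.
rewrite distrC ger0_norm ?subr_ge0 //.
have h : - lmgf q (f x) (- n.+1%:R) / n.+1%:R - e <= eps.
  rewrite lerBlDr (le_trans (hk n)) // -addrA addrC lerD2r.
  rewrite [leRHS](splitr eps) lerD2l (le_trans _ kn) //; exact: ler_norm.
  exact: h.
exact: lo.
Qed.

(** This turns the condition [D_min < D] into one on exponential moments: the
    convergence of [cvg_lmgf_ess_inf] is dominated by the mean of [f x]. *)
Lemma mean_lmgf_ess_inf D :
  (\int[p]_x ess_inf q (fun y => (f x y)%:E) < D%:E)%E ->
  exists2 k : R, k < 0 & - mean_lmgf k < - k * D.
Proof.
move=> eD.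
have N0 n : - n.+1%:R <= 0 :> R by rewrite oppr_le0 ler0n.
have cvgI : (\int[p]_x (- lmgf q (f x) (- n.+1%:R) / n.+1%:R)%:E)%E @[n --> \oo]
    --> (\int[p]_x ess_inf q (fun y => (f x y)%:E))%E.
  have mu n : measurable_fun setT
      (fun x => (- lmgf q (f x) (- n.+1%:R) / n.+1%:R)%:E).
    apply/measurable_EFinP; apply: measurable_funM => //.
    by apply: measurable_funN; exact: measurable_lmgf.
  have [] // := @dominated_convergence _ _ _ p setT measurableT
    (fun n x => (- lmgf q (f x) (- n.+1%:R) / n.+1%:R)%:E)
    (fun x => ess_inf q (fun y => (f x y)%:E)) mean mu.
  - by apply: emeasurable_fun_cvg mu _ => x _; exact: cvg_lmgf_ess_inf.
  - by apply: aeW => x _; exact: cvg_lmgf_ess_inf.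
  apply: aeW => x n _.
  have h := lmgf_le0 q (mfx x) (f0 x) (N0 n).
  rewrite abse_EFin ger0_norm; last by rewrite divr_ge0 // oppr_ge0.
  rewrite EFinM muleC lee_pdivrMl //.
  by have := lmgf_mean x (N0 n); rewrite opprK.
have : \forall n \near \oo,
    (\int[p]_x (- lmgf q (f x) (- n.+1%:R) / n.+1%:R)%:E < D%:E)%E.
  apply: (cvgI [set y | (y < D%:E)%E]).
  by apply: open_nbhs_nbhs; split => //; exact: open_ereal_lt_ereal.
case=> n _ /(_ n (leqnn n)) /= H.
exists (- n.+1%:R); first by rewrite oppr_lt0 ltr0n.
rewrite opprK mulrC -ltr_pdivrMr // -lte_fin; apply: le_lt_trans H.
have i := lmgf_integrable (N0 n).
under [leRHS]eq_integral do rewrite mulNr -mulrN mulrC EFinM.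
rewrite integralZl // -EFin_mean_lmgf // -EFinM lee_fin.
by rewrite !mulNr mulrC.
Qed.

Let between_min_max (u v D : R) : u <= D -> D <= v ->
  Num.min u v <= D <= Num.max u v.
Proof. by move=> uD Dv; rewrite ge_min le_max uD Dv orbT. Qed.

(** Intermediate value theorem: the hypothesis forces [mean_tilt k < D] by the
    tangent at [k], while [mean_tilt] exceeds [D] near [0]. *)
Lemma mean_tilt_eq D : (exists2 k : R, k < 0 & - mean_lmgf k < - k * D) ->
  (D%:E < \int[p \x q]_z (f z.1 z.2)%:E)%E ->
  exists2 a : R, a < 0 & mean_tilt a = D.
Proof.
move=> [k k0 kD] /mean_tilt_large[b b0 bD].
have kD' : mean_tilt k < D.
  have nk : 0 < - k by rewrite oppr_gt0.
  rewrite -(ltr_pM2l nk); apply: le_lt_trans kD.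
  have h := mean_lmgf_tangent k0 (lexx 0).
  rewrite mean_lmgf0 in h.
  by move: (mean_lmgf k) (mean_tilt k) h => u v; lra.
have cont u v : v < 0 -> {within `[u, v], continuous mean_tilt}.
  move=> v0; apply: continuous_in_subspaceT => x.
  rewrite inE /= in_itv /= => /andP[_ xv].
  by apply: continuous_mean_tilt; exact: le_lt_trans v0.
have [kb|bk] := leP k b.
  have [|c] := @IVT _ mean_tilt k b D kb (cont _ _ b0).
    exact: between_min_max (ltW kD') (ltW bD).
  by rewrite in_itv /= => /andP[_ cb] <-; exists c => //; exact: le_lt_trans b0.
have [|c] := @IVT _ mean_tilt b k D (ltW bk) (cont _ _ k0).
  by rewrite minC maxC; exact: between_min_max (ltW kD') (ltW bD).
by rewrite in_itv /= => /andP[_ cb] <-; exists c => //; exact: le_lt_trans k0.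
Qed.

(** The normalisation depends on [z.1] only, which keeps the first marginal [p]. *)
Definition tilted_density a (z : S * T) : R :=
  expR (a * f z.1 z.2 - lmgf q (f z.1) a).

Let mlmgf1 a : measurable_fun setT (fun z : S * T => lmgf q (f z.1) a).
Proof. exact: (measurableT_comp (measurable_lmgf a) (measurable_fst)). Qed.

Lemma measurable_tilted_density a : measurable_fun setT (tilted_density a).
Proof.
apply: measurableT_comp => //; apply: measurable_funB => //.
exact: measurable_funM.
Qed.

Lemma tilted_density_section a x : a <= 0 ->
  (\int[q]_y (tilted_density a (x, y))%:E = 1)%E.
Proof.
move=> a0; rewrite /tilted_density /=.
have i := has_mgfx x a0.
under eq_integral do rewrite expRD mulrC EFinM.
rewrite integralZl // expRN expR_lmgf // -(fineK (integrable_fin_num _ i)) //.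
by rewrite -EFinM mulVf // gt_eqF // mgf_gt0.
Qed.

Lemma tilted_density_mass a : a <= 0 ->
  (\int[p \x q]_z (tilted_density a z)%:E = 1)%E.
Proof.
move=> a0; rewrite fubini_tonelli1.
- rewrite -[RHS](@probability_setT _ _ _ p) -[RHS]mul1e -integral_cst //.
  by apply: eq_integral => x _; exact: tilted_density_section.
- by apply/measurable_EFinP; exact: measurable_tilted_density.
- by move=> z; rewrite lee_fin expR_ge0.
Qed.

Lemma tilted_density_mean a : a < 0 ->
  (\int[p \x q]_z ((f z.1 z.2)%:E * (tilted_density a z)%:E) = (mean_tilt a)%:E)%E.
Proof.
move=> a0; rewrite fubini_tonelli1.
- rewrite EFin_mean_tilt //.
  apply: eq_integral => x _; rewrite /fubini_F /tilted_density /=.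
  have [i1 i2] := has_tiltx x a0.
  under eq_integral do rewrite -EFinM expRD mulrA mulrC EFinM.
  rewrite integralZl // expRN expR_lmgf // -(fineK (integrable_fin_num _ i2)) //.
  by rewrite -EFinM mulrC.
- apply: emeasurable_funM; first exact/measurable_EFinP.
  by apply/measurable_EFinP; exact: measurable_tilted_density.
- by move=> z; apply: mule_ge0; rewrite lee_fin ?f0 ?expR_ge0.
Qed.

(** Gibbs' inequality against the tilted law [expR w], integrated from
    [ln r >= w + 1 - expR w / r]: the mean of [w] is at least [a * D - mean_lmgf a]
    and that of [expR w / r] at most [1]. *)
Lemma relative_entropy_ge (V : probability (S * T)%type R) (a D : R) : a <= 0 ->
  (forall E, measurable E -> V (fst @^-1` E) = p E) ->
  (\int[V]_z (f z.1 z.2)%:E <= D%:E)%E ->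
  ((a * D - mean_lmgf a)%:E <= relative_entropy V (p \x q))%E.
Proof.
move=> a0 Vp VD.
have [numu|nnumu] := asboolP (V `<< (p \x q)%E); last first.
  by rewrite /relative_entropy asboolF // leey.
rewrite relative_entropyE //.
have mg := density_measurable numu.
set g := Radon_Nikodym_SigmaFinite.f V _ in mg *.
have g_ge0 z : (0 <= g z)%E by exact: Radon_Nikodym_SigmaFinite.f_ge0.
have g_fin z : g z \is a fin_num by exact: Radon_Nikodym_SigmaFinite.f_fin_num.
have mfE : measurable_fun setT (fun z : S * T => (f z.1 z.2)%:E).
  exact/measurable_EFinP.
have Vf0 : (0 <= \int[V]_z (f z.1 z.2)%:E)%E.
  by apply: integral_ge0 => z _; rewrite lee_fin.
have intVf : V.-integrable setT (fun z => (f z.1 z.2)%:E).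
  apply/integrableP; split => //.
  under eq_integral do rewrite gee0_abs ?lee_fin //.
  exact: le_lt_trans VD (ltry _).
have [intVl Vl] : V.-integrable setT (fun z => (lmgf q (f z.1) a)%:E) /\
    (\int[V]_z (lmgf q (f z.1) a)%:E)%E = (mean_lmgf a)%:E.
  have ml : measurable_fun setT (fun x => (lmgf q (f x) a)%:E).
    by apply/measurable_EFinP; exact: measurable_lmgf.
  have mfst : measurable_fun setT (@fst S T) by exact: measurable_fst.
  split; first exact: (integrable_image mfst Vp (lmgf_integrable a0)).
  rewrite EFin_mean_lmgf //; exact: (integral_image mfst Vp (lmgf_integrable a0)).
pose w z := a * f z.1 z.2 - lmgf q (f z.1) a.
have mw : measurable_fun setT w.
  apply: measurable_funB; first exact: measurable_funM.
  exact: mlmgf1.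
have intVw : V.-integrable setT (EFin \o w).
  have := integrableB measurableT (integrableZl measurableT a intVf) intVl.
  by apply: eq_integrable.
have Vw : ((a * D - mean_lmgf a)%:E <= \int[V]_z (w z)%:E)%E.
  rewrite (_ : \int[V]_z (w z)%:E =
      a%:E * \int[V]_z (f z.1 z.2)%:E - (mean_lmgf a)%:E)%E; last first.
    rewrite -Vl -integralZl // -integralB //; last exact: integrableZl.
  have fV : (\int[V]_z (f z.1 z.2)%:E)%E \is a fin_num by exact: integrable_fin_num.
  rewrite -(fineK fV) -EFinM -EFinB lee_fin lerD2r ler_wnM2l //.
  by rewrite -lee_fin fineK.
(* the ratio [expR w / g], set to [0] where the density [g] vanishes *)
pose u z := if fine (g z) <= 0 then 0 else expR (w z - ln (fine (g z))).
have mfg : measurable_fun setT (fun z => fine (g z)) by exact: measurableT_comp.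
have mu_ : measurable_fun setT (fun z => (u z)%:E).
  apply/measurable_EFinP; apply: measurable_fun_ifT => //.
    exact: measurable_fun_ler.
  apply: measurableT_comp => //; apply: measurable_funB => //.
  by apply: measurableT_comp => //; exact: measurable_ln.
have u0 z : (0 <= (u z)%:E)%E.
  by rewrite lee_fin /u; case: ifP => // _; exact: expR_ge0.
have mexpw : measurable_fun setT (fun z => (expR (w z))%:E).
  by apply/measurable_EFinP; exact: measurableT_comp.
have norm1 := tilted_density_mass a0; rewrite -/w in norm1.
have Vu : (\int[V]_z (u z)%:E <= 1)%E.
  rewrite -norm1 (integral_density numu) //; apply: ge0_le_integral => //.
  - by move=> z _; rewrite mule_ge0.
  - exact: emeasurable_funM.
  move=> z _; rewrite -/(g z) -(fineK (g_fin z)) -EFinM lee_fin /u.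
  have [g_le0|g_gt0] := leP (fine (g z)) 0; first by rewrite mul0r expR_ge0.
  by rewrite expRD expRN lnK ?posrE // divfK ?gt_eqF.
have intVu : V.-integrable setT (EFin \o u).
  apply/integrableP; split => //.
  under eq_integral do rewrite /= ger0_norm -?lee_fin //.
  exact: le_lt_trans Vu (ltry _).
apply: le_trans Vw _.
apply: (@le_trans _ _ (\int[V]_z (w z + (1 - u z))%:E)%E).
  rewrite (_ : \int[V]_z (w z + (1 - u z))%:E = \int[V]_z (w z)%:E
     + (1%:E - \int[V]_z (u z)%:E))%E.
    by rewrite leeDl // sube_ge0 // ge0_fin_numE ?integral_ge0 // (le_lt_trans Vu) ?ltry.
  have i1 : V.-integrable setT (EFin \o cst 1%R) by exact: integrable_cst.
  have c1 : (\int[V]_z (EFin \o cst 1%R) z = 1)%E.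
    transitivity (\int[V]_z (cst 1 z))%:E; last by rewrite Rintegral_cst1.
    by rewrite /Rintegral fineK //; exact: integrable_fin_num.
  rewrite -[in RHS]c1 -integralB // -integralD //.
  by have := integrableB measurableT i1 intVu.
apply: ae_le_integral => //.
- apply/measurable_EFinP; apply: measurable_funD => //.
  by apply: measurable_funB => //; exact/measurable_EFinP.
- by apply: measurableT_comp => //; exact: measurable_lne.
apply: filterS (density_pos numu) => z; rewrite -/(g z) => gz.
have fgz : 0 < fine (g z) by rewrite fine_gt0 // gz ltey_eq g_fin.
have -> : lne (g z) = (ln (fine (g z)))%:E by rewrite -{1}(fineK (g_fin z)) lne_EFin.
rewrite lee_fin /u (leNgt (fine (g z))) fgz /=.
have := @expR_ge1Dx R (w z - ln (fine (g z))); lra.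
Qed.

(** The logarithm of the tilted density is affine in [f], so its entropy is
    explicit; with [mean_tilt a = D] it attains the bound of
    [relative_entropy_ge]. *)
Lemma relative_entropy_tilted (a : R) : a < 0 ->
  exists V : probability (S * T)%type R,
    [/\ forall E, measurable E -> V (fst @^-1` E) = p E,
        (\int[V]_z (f z.1 z.2)%:E = (mean_tilt a)%:E)%E &
        (relative_entropy V (p \x q) = (a * mean_tilt a - mean_lmgf a)%:E)%E].
Proof.
move=> a0; pose g z := (tilted_density a z)%:E.
have mg : measurable_fun setT g.
  by apply/measurable_EFinP; exact: measurable_tilted_density.
have g0 z : (0 <= g z)%E by rewrite lee_fin expR_ge0.
pose V : probability (S * T)%type R :=
  with_density mg g0 (tilted_density_mass (ltW a0)).
have Vmu : V `<< (p \x q)%E.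
  apply/null_content_dominatesP => A mA A0.
  rewrite /V /= /with_density; apply: null_set_integral => //.
  by apply: measurable_funTS.
pose pq : probability (S * T)%type R := (p \x q)%E.
have gE : ae_eq pq setT (Radon_Nikodym_SigmaFinite.f V pq) g.
  apply: integral_ae_eq => //.
    exact: Radon_Nikodym_SigmaFinite.f_integrable.
  move=> E _ mE; rewrite -(@Radon_Nikodym_SigmaFinite.f_integral _ _ _ V pq Vmu) //.
have Vp E : measurable E -> V (fst @^-1` E) = p E.
  move=> mE; have mE1 : measurable (fst @^-1` E : set (S * T)).
    by rewrite -[X in measurable X]setTI; exact: measurable_fst.
  have mE2 : measurable_fun setT (fun z : S * T => (\1_E z.1 : R)%:E).
    apply/measurable_EFinP; apply: (measurableT_comp _ (@measurable_fst _ _ S T)).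
    exact: measurable_indic.
  have -> : V (fst @^-1` E) = (\int[V]_z (\1_E z.1)%:E)%E.
    by rewrite -[RHS]/(\int[V]_z (\1_(fst @^-1` E) z)%:E)%E integral_indic // setIT.
  rewrite (integral_density Vmu) //.
  rewrite (@ae_eq_integral _ _ _ _ setT (fun z => (\1_E z.1)%:E * g z)%E) //.
  - rewrite fubini_tonelli1.
    + rewrite -[E in RHS]setIT -integral_indic //.
      apply: eq_integral => x _; rewrite /fubini_F /=.
      rewrite indicE; case: (x \in E) => /=.
        under eq_integral do rewrite mul1e.
        exact: tilted_density_section (ltW a0).
      under eq_integral do rewrite mul0e.
      exact: integral0.
    + exact: emeasurable_funM.
    + move=> z; apply: mule_ge0; last exact: g0.
      by rewrite lee_fin.
  - by apply: emeasurable_funM => //; exact: density_measurable.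
  - exact: emeasurable_funM.
  - exact: ae_eqe_mul2l.
have mf1 : measurable_fun setT (fun z : S * T => (f z.1 z.2)%:E).
  exact/measurable_EFinP.
have Vf : (\int[V]_z (f z.1 z.2)%:E = (mean_tilt a)%:E)%E.
  have fz0 z : (0 <= (f z.1 z.2)%:E)%E by rewrite lee_fin.
  apply: etrans (integral_density Vmu fz0 mf1) _.
  apply: etrans _ (tilted_density_mean a0).
  apply: ae_eq_integral => //.
  - by apply: emeasurable_funM => //; exact: density_measurable.
  - exact: emeasurable_funM.
  - exact: ae_eqe_mul2l.
exists V; split => //.
have intf : V.-integrable setT (fun z => (f z.1 z.2)%:E).
  apply/integrableP; split => //.
  by under eq_integral do rewrite gee0_abs ?lee_fin //; rewrite Vf ltry.
have intl := integrable_image (@measurable_fst _ _ S T) Vp (lmgf_integrable (ltW a0)).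
have Vl := integral_image (@measurable_fst _ _ S T) Vp (lmgf_integrable (ltW a0)).
rewrite (relative_entropyE Vmu).
rewrite (@ae_eq_integral _ _ _ V setT
  (fun z => a%:E * (f z.1 z.2)%:E - (lmgf q (f z.1) a)%:E))%E //.
- rewrite integralB //; last exact: integrableZl.
  by rewrite integralZl // Vf Vl -EFin_mean_lmgf // ltW.
- by apply: measurableT_comp; [exact: measurable_lne | exact: density_measurable].
- apply: emeasurable_funB; first exact: emeasurable_funM.
  by apply/measurable_EFinP; exact: mlmgf1.
apply: null_dominates_ae_eq Vmu _ => //.
apply: ae_eq_trans (ae_eq_comp (@lne R) gE) _.
apply: aeW => z _.
by rewrite -[LHS]/(lne (tilted_density a z)%:E) lne_EFin ?expR_gt0 // expRK.
Qed.

(** The lower bound [relative_entropy_ge] meets [relative_entropy_tilted] at the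
    tilt of mean [D]. *)
Theorem rate_duality (D : R) : (exists2 k : R, k < 0 & - mean_lmgf k < - k * D) ->
  (D%:E < \int[p \x q]_z (f z.1 z.2)%:E)%E ->
  exists a : R, [/\ a < 0, mean_tilt a = D &
    ereal_inf [set relative_entropy V (p \x q)%E | V in
      [set V : probability (S * T)%type R |
        (forall E, measurable E -> V (fst @^-1` E) = p E) /\
        (\int[V]_z (f z.1 z.2)%:E <= D%:E)%E]] = (a * D - mean_lmgf a)%:E].
Proof.
move=> Dlo Dhi; have [a a0 aD] := mean_tilt_eq Dlo Dhi.
exists a; split => //; apply/eqP; rewrite eq_le; apply/andP; split.
  have [V [Vp Vf VH]] := relative_entropy_tilted a0.
  by apply: ereal_inf_lbound; exists V; rewrite ?VH ?aD //; split; rewrite // Vf aD.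
by apply: le_ereal_inf_tmp => _ [V [Vp VD] <-]; exact: relative_entropy_ge (ltW a0) Vp VD.
Qed.

End duality.

(** * Weighted integrals *)
Section finite_density.
Context {d : measure_display} {T : measurableType d} {R : realType}.
Local Open Scope ereal_scope.
Variables (mu : probability T R) (f : T -> \bar R).
Variables (f0 : forall x, 0 <= f x) (intf : mu.-integrable setT f).

(** As for [with_density], the proofs are arguments for the sake of inference. *)
Definition finite_density (mf : measurable_fun setT f)
  (fi : mu.-integrable setT f) (f_ge0 : forall x, 0 <= f x) (A : set T) : \bar R :=
  \int[mu]_(x in A) f x.

Let mf : measurable_fun setT f := measurable_int mu intf.
Local Notation nu := (finite_density mf intf f0).

Let nu0 : nu set0 = 0. Proof. by rewrite /finite_density integral_set0. Qed.
Let nu_ge0 A : 0 <= nu A. Proof. exact: integral_ge0. Qed.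
Let nu_sigma : semi_sigma_additive nu.
Proof. exact: semi_sigma_additive_nng_induced. Qed.

HB.instance Definition _ := isMeasure.Build _ _ _ nu nu0 nu_ge0 nu_sigma.

Let nu_fin : fin_num_fun nu.
Proof.
by move=> A mA; apply: integrable_fin_num => //; exact: integrableS intf.
Qed.

HB.instance Definition _ := Measure_isFinite.Build _ _ _ nu nu_fin.

(** The density is almost everywhere the Radon-Nikodym derivative, for which the
    change of variables is known. *)
Lemma integral_finite_density (h : T -> \bar R) : (forall x, 0 <= h x) ->
  measurable_fun setT h -> \int[nu]_x h x = \int[mu]_x (h x * f x).
Proof.
move=> h0 mh.
have numu : nu `<< mu.
  apply/null_content_dominatesP => A mA A0.
  by apply: null_set_integral => //; exact: measurable_funTS.
rewrite -(Radon_Nikodym_SigmaFinite.change_of_variables numu) //.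
have mRN : measurable_fun setT (Radon_Nikodym_SigmaFinite.f nu mu).
  by apply: measurable_int; exact: (Radon_Nikodym_SigmaFinite.f_integrable numu).
apply: ae_eq_integral => //.
- exact: emeasurable_funM.
- exact: emeasurable_funM.
apply: ae_eqe_mul2l; apply: integral_ae_eq => //.
  exact: Radon_Nikodym_SigmaFinite.f_integrable.
by move=> E _ mE; rewrite -(Radon_Nikodym_SigmaFinite.f_integral numu).
Qed.

End finite_density.

Section weighted.
Context {d d' : measure_display} {Omega : measurableType d}
  {T : measurableType d'} {R : realType}.
Variables (P : probability Omega R) (V : Omega -> T).
Hypothesis mV : measurable_fun setT V.
Local Open Scope ereal_scope.
Variable w : Omega -> \bar R.
Hypotheses (w0 : forall x, 0 <= w x) (intw : P.-integrable setT w).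
Variable K : R.
Hypothesis K0 : (0 <= K)%R.

Let mw : measurable_fun setT w := measurable_int P intw.
Let nu := finite_density mw intw w0.
Let push (mu : {measure set Omega -> \bar R}) : {measure set T -> \bar R} :=
  measure_function_pushforward__canonical__measure_function_Measure mu mV.
Let m1 := push nu.
Let m2 := mscale (NngNum K0) (push P).

Let m1_int (h : T -> \bar R) : (forall y, 0 <= h y) -> measurable_fun setT h ->
  \int[m1]_y h y = \int[P]_x (h (V x) * w x).
Proof.
move=> h0 mh; rewrite (ge0_integral_pushforward mV) //.
apply: (integral_finite_density w0 intw (h := h \o V)) => [x|]; first exact: h0.
exact: measurableT_comp.
Qed.

Let m2_int (h : T -> \bar R) : (forall y, 0 <= h y) -> measurable_fun setT h ->
  \int[m2]_y h y = K%:E * \int[P]_x h (V x).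
Proof.
move=> h0 mh; rewrite ge0_integral_mscale // (ge0_integral_pushforward mV) //.
Qed.

(** Two measures on [T] that compare on sets compare on functions: here the law
    of [V] weighted by [w] against [K] times the law of [V]. *)
Lemma weighted_le :
  (forall F, measurable F -> \int[P]_(x in V @^-1` F) w x <= K%:E * P (V @^-1` F)) ->
  forall h : T -> \bar R, (forall y, 0 <= h y) -> measurable_fun setT h ->
  \int[P]_x (h (V x) * w x) <= K%:E * \int[P]_x h (V x).
Proof.
move=> wK h h0 mh; rewrite -m1_int // -m2_int //.
by apply: ge0_le_measure_integral => // S mS; exact: wK.
Qed.

Lemma weighted_ge :
  (forall F, measurable F -> K%:E * P (V @^-1` F) <= \int[P]_(x in V @^-1` F) w x) ->
  forall h : T -> \bar R, (forall y, 0 <= h y) -> measurable_fun setT h ->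
  K%:E * \int[P]_x h (V x) <= \int[P]_x (h (V x) * w x).
Proof.
move=> wK h h0 mh; rewrite -m1_int // -m2_int //.
by apply: ge0_le_measure_integral => // S mS; exact: wK.
Qed.

End weighted.

(** * Path spaces *)
Section path_space.
Context {dT : measure_display} {T : measurableType dT}.
Implicit Types (J : set int) (x : int -> T).

Definition coord_gen J : set (set (int -> T)) :=
  \bigcup_(i in J) preimage_set_system setT (fun x : int -> T => x i) measurable.

(** All the sigma-fields [sigma (x_i, i in J)] live on one carrier, so that a
    function of a window is also a function of any larger window. *)
Definition pathType J := g_sigma_algebraType (coord_gen J).

Lemma measurable_coord J i : J i ->
  measurable_fun setT (fun x : pathType J => x i).
Proof.
move=> Ji _ B mB; apply: sub_sigma_algebra.
by exists i => //; exists B.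
Qed.

Lemma measurable_to_path d (S : measurableType d) J (f : S -> int -> T) :
  (forall i, J i -> measurable_fun setT (fun s => f s i)) ->
  measurable_fun setT (f : S -> pathType J).
Proof.
move=> mf; apply: (@measurability _ _ S (pathType J) setT f (coord_gen J)) => //.
move=> _ [_ [i Ji [B mB <-]] <-].
by have := mf i Ji measurableT B mB; rewrite !setTI.
Qed.

Lemma measurable_widen J J' E : J `<=` J' ->
  measurable (E : set (pathType J)) -> measurable (E : set (pathType J')).
Proof.
move=> JJ' mE; rewrite -[E]setTI.
have : measurable_fun setT (id : pathType J' -> pathType J).
  by apply: measurable_to_path => i /JJ' Ji; exact: measurable_coord.
exact.
Qed.

Definition shiftz (i : int) x : int -> T := fun j => x (j + i).

Lemma measurable_shiftz (i : int) J J' : (forall j, J' j -> J (j + i)) ->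
  measurable_fun setT (shiftz i : pathType J -> pathType J').
Proof.
by move=> h; apply: measurable_to_path => j /h Jj; exact: measurable_coord.
Qed.

Lemma shiftzD (i j : int) x : shiftz i (shiftz j x) = shiftz (i + j) x.
Proof. by apply/funext => k; rewrite /shiftz addrA. Qed.

Lemma shiftz0 x : shiftz 0 x = x.
Proof. by apply/funext => k; rewrite /shiftz addr0. Qed.

End path_space.

Section path_law.
Context {d dT : measure_display} {Omega : measurableType d}
  {T : measurableType dT} {R : realType} (P : probability Omega R).
Implicit Type X : int -> {mfun Omega >-> T}.

Lemma measurable_path X J : measurable_fun setT (path X : Omega -> pathType J).
Proof. by apply: measurable_to_path => i _; exact: measurable_funPT. Qed.

Lemma measurable_path_preimage X J (E : set (pathType J)) :
  measurable E -> measurable (path X @^-1` E).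
Proof. move=> mE; rewrite -[X in measurable X]setTI.
exact: (@measurable_path X J measurableT E mE). Qed.

Lemma sigma_field_path X J (E : set (pathType J)) :
  measurable E -> sigma_field X J (path X @^-1` E).
Proof.
move=> mE; rewrite -[X in sigma_field _ _ X]setTI.
pose Omega' := g_sigma_algebraType (\bigcup_(i in J)
  preimage_set_system setT (X i) measurable).
have : measurable_fun setT (path X : Omega' -> pathType J).
  apply: measurable_to_path => i Ji _ B mB; apply: sub_sigma_algebra.
  by exists i => //; exists B.
exact.
Qed.

Definition full_path X : Omega -> pathType (T := T) setT := path X.

HB.instance Definition _ X := isMeasurableFun.Build _ _ _ _ (full_path X)
  (@measurable_path X setT).

Definition path_law X : probability (pathType (T := T) setT) R :=
  distribution P (full_path X).

Lemma stationary_shiftz X (i : int) (E : set (pathType setT)) :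
  stationary P X -> measurable E ->
  P (path X @^-1` (shiftz i @^-1` E)) = P (path X @^-1` E).
Proof.
move=> sX.
have mS j (F : set (pathType (T := T) setT)) : measurable F ->
    measurable (shiftz j @^-1` F : set (pathType setT)).
  move=> mF; rewrite -[X in measurable X]setTI.
  exact: (@measurable_shiftz _ _ j setT setT).
have pos n F : measurable (F : set (pathType setT)) ->
    P (path X @^-1` (shiftz n%:Z @^-1` F)) = P (path X @^-1` F).
  elim: n F => [|n ih] F mF.
    by congr (P _); apply/funext => w /=; rewrite shiftz0.
  rewrite -(ih _ mF) -(sX (shiftz n%:Z @^-1` F)); last exact: mS.
  congr (P _); apply/funext => w /=; congr F.
  by apply/funext => j; rewrite /shiftz /shift -addrA -PoszD addn1.
move=> mE; case: i => n; first exact: pos.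
rewrite -(pos n.+1 _ (mS (Negz n) _ mE)).
by rewrite NegzE; congr (P _); apply/funext => w /=; rewrite !shiftzD addNr shiftz0.
Qed.

Lemma ge0_integral_shiftz X (i : int) (h : pathType setT -> \bar R) :
  stationary P X -> measurable_fun setT h -> (forall x, 0 <= h x)%E ->
  (\int[P]_w h (shiftz i (path X w)) = \int[P]_w h (path X w))%E.
Proof.
move=> sX mh h0.
have e1 := @ge0_integral_image _ _ _ _ _ P (path_law X)
  (fun w => shiftz i (path X w) : pathType setT).
have e2 := @ge0_integral_image _ _ _ _ _ P (path_law X) (full_path X).
rewrite e1 //.
- by rewrite -e2 // => E mE.
- apply: (measurableT_comp (@measurable_shiftz _ _ i setT setT _)) => //.
  exact: measurable_path.
- by move=> E mE; exact: (stationary_shiftz i sX mE).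
Qed.

End path_law.

(** * Mixing *)
Section mixing.
Context {d dT : measure_display} {Omega : measurableType d}
  {T : measurableType dT} {R : realType} (P : probability Omega R).
Variable Y : int -> {mfun Omega >-> T}.
Local Open Scope ereal_scope.

(** The form of psi-mixing used throughout, at a fixed gap [e] and any position
    [i]; independent letters are the case [c = 1], [e = 0]. *)
Definition mixing (c : R) (e : nat) : Prop :=
  forall (i : int) (E : set (pathType [set j | (j <= i)%R]))
    (F : set (pathType [set j | (i + e.+1%:Z <= j)%R])),
  measurable E -> measurable F ->
  (c^-1)%:E * (P (path Y @^-1` E) * P (path Y @^-1` F)) <=
    P (path Y @^-1` E `&` path Y @^-1` F) /\
  P (path Y @^-1` E `&` path Y @^-1` F) <=
    c%:E * (P (path Y @^-1` E) * P (path Y @^-1` F)).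

Section mixing_functions.
Variables (c : R) (e : nat).
Hypotheses (c0 : (0 < c)%R) (Ymix : mixing c e).
Local Open Scope ring_scope.
Implicit Types f g : (int -> T) -> R.

Local Notation Emean f := (\int[P]_w f (path Y w)).

Lemma bounded_path_integrable J f (b : R) :
  measurable_fun setT (f : pathType J -> R) -> (forall y, 0 <= f y <= b) ->
  P.-integrable setT (fun w => (f (path Y w))%:E).
Proof.
move=> mf fb; apply: (@bounded_integrable _ _ _ P (fun w => f (path Y w)) b).
  exact: measurableT_comp mf (@measurable_path _ _ _ _ Y J).
by move=> w; have /andP[? ?] := fb (path Y w); rewrite ger0_norm.
Qed.

(** Pass from events to functions one variable at a time. *)
Lemma mixing_integral (i : int) f g (b : R) :
  measurable_fun setT (f : pathType [set j | j <= i] -> R) ->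
  measurable_fun setT (g : pathType [set j | i + e.+1%:Z <= j] -> R) ->
  (forall y, 0 <= f y <= b) -> (forall y, 0 <= g y <= b) ->
  c^-1 * (Emean f * Emean g) <= Emean (fun y => f y * g y) <=
  c * (Emean f * Emean g).
Proof.
move=> mf mg fb gb.
set J1 := [set j | j <= i] in mf; set J2 := [set j | i + e.+1%:Z <= j] in mg.
have f0 y : 0 <= f y by case/andP: (fb y).
have g0 y : 0 <= g y by case/andP: (gb y).
have if_ := bounded_path_integrable mf fb.
have ig_ := bounded_path_integrable mg gb.
have mY J := @measurable_path _ _ _ _ Y J.
have mFY J (F : set (pathType J)) : measurable F -> measurable (path Y @^-1` F).
  exact: measurable_path_preimage.
have EfE : (\int[P]_w (f (path Y w))%:E = (Emean f)%:E)%E.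
  by rewrite /Rintegral fineK // integrable_fin_num.
have EgE : (\int[P]_w (g (path Y w))%:E = (Emean g)%:E)%E.
  by rewrite /Rintegral fineK // integrable_fin_num.
have Ef0 : 0 <= Emean f by exact: Rintegral_ge0.
(* first the function [f] of the past against events of the future *)
have step1 F : measurable (F : set (pathType J2)) ->
    ((c^-1 * Emean f)%:E * P (path Y @^-1` F) <=
       \int[P]_(w in path Y @^-1` F) (f (path Y w))%:E <=
     (c * Emean f)%:E * P (path Y @^-1` F))%E.
  move=> mF; have mYF := mFY _ _ mF.
  pose w1 w := (\1_(path Y @^-1` F) w : R)%:E.
  have w10 w : (0 <= w1 w)%E by rewrite lee_fin.
  have iw1 : P.-integrable setT w1 by exact: integrable_indic.
  have PF : (fine (P (path Y @^-1` F)))%:E = P (path Y @^-1` F).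
    by rewrite fineK // fin_num_measure.
  have PF0 : 0 <= fine (P (path Y @^-1` F)) by rewrite fine_ge0.
  have restr : (\int[P]_(w in path Y @^-1` F) (f (path Y w))%:E =
      \int[P]_w ((f (path Y w))%:E * w1 w))%E.
    rewrite integral_mkcond; apply: eq_integral => w _.
    by rewrite /w1 epatch_indic.
  have rect E : measurable (E : set (pathType J1)) ->
      (\int[P]_(w in path Y @^-1` E) w1 w = P (path Y @^-1` E `&` path Y @^-1` F))%E.
    by move=> mE; rewrite setIC; apply: integral_indic; exact: mFY.
  have mfE : measurable_fun setT (fun y : pathType J1 => (f y)%:E) by exact/measurable_EFinP.
  have fE0 (y : pathType J1) : (0 <= (f y)%:E)%E by rewrite lee_fin.
  rewrite restr; apply/andP; split.
    have K0 : 0 <= c^-1 * fine (P (path Y @^-1` F)) by rewrite mulr_ge0 // invr_ge0 ltW.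
    have := weighted_ge (mY J1) w10 iw1 K0 _ fE0 mfE.
    rewrite EfE EFinM PF -muleA (muleC (P _)) muleA -EFinM; apply=> E mE.
    rewrite rect // -muleA (muleC (P (path Y @^-1` F))).
    by have [+ _] := Ymix mE mF.
  have K0 : 0 <= c * fine (P (path Y @^-1` F)) by rewrite mulr_ge0 // ltW.
  have := weighted_le (mY J1) w10 iw1 K0 _ fE0 mfE.
  rewrite EfE EFinM PF -muleA (muleC (P _)) muleA -EFinM; apply=> E mE.
  rewrite rect // -muleA (muleC (P (path Y @^-1` F))).
  by have [_ +] := Ymix mE mF.
have fgE : (\int[P]_w ((g (path Y w))%:E * (f (path Y w))%:E) =
    (Emean (fun y => (f y * g y)%R))%:E)%E.
  transitivity (\int[P]_w (f (path Y w) * g (path Y w))%:E)%E.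
    by apply: eq_integral => w _; rewrite -EFinM mulrC.
  rewrite /Rintegral fineK //; apply: integrable_fin_num => //.
  apply: (@bounded_integrable _ _ _ P (fun w => f (path Y w) * g (path Y w)) (b * b)).
    apply: measurable_funM; first exact: measurableT_comp mf (mY J1).
    exact: measurableT_comp mg (mY J2).
  move=> w; have /andP[? ?] := fb (path Y w); have /andP[? ?] := gb (path Y w).
  by rewrite ger0_norm ?mulr_ge0 // ler_pM.
have fE0 w : (0 <= (f (path Y w))%:E)%E by rewrite lee_fin.
have gE0 (y : pathType J2) : (0 <= (g y)%:E)%E by rewrite lee_fin.
have mgE : measurable_fun setT (fun y : pathType J2 => (g y)%:E) by exact/measurable_EFinP.
rewrite -!lee_fin -fgE !mulrA !(EFinM _ (Emean g)) -EgE; apply/andP; split.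
  have K0 : 0 <= c^-1 * Emean f by rewrite mulr_ge0 // invr_ge0 ltW.
  by apply: (weighted_ge (mY J2) fE0 if_ K0 _ gE0 mgE) => F /step1 /andP[].
have K0 : 0 <= c * Emean f by rewrite mulr_ge0 // ltW.
by apply: (weighted_le (mY J2) fE0 if_ K0 _ gE0 mgE) => F /step1 /andP[].
Qed.

(** By induction on the number of windows: the product over the earlier ones is a
    function of the past of the last gap. *)
Lemma mixing_blocks (a : int) (k : nat) (f : nat -> (int -> T) -> R) (b : R) m :
  let start j : int := a + (j * (k + e))%N%:Z in
  (forall j, measurable_fun setT
     (f j : pathType [set i | start j <= i < start j + k%:Z] -> R)) ->
  (forall j y, 0 <= f j y <= b) ->
  c ^- m * \prod_(j < m) Emean (f j) <= Emean (fun y => \prod_(j < m) f j y) <=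
  c ^+ m * \prod_(j < m) Emean (f j).
Proof.
move=> start mf fb; elim: m => [|m ih].
  under eq_Rintegral do rewrite big_ord0.
  by rewrite !big_ord0 expr0 invr1 mul1r (Rintegral_cst1 P 1) lexx.
pose i := start m - e.+1%:Z.
have f0 j y : 0 <= f j y by case/andP: (fb j y).
have b0 : 0 <= b by have /andP[h1 h2] := fb 0%N point; exact: le_trans h2.
pose F y := \prod_(j < m) f j y.
have Fb y : 0 <= F y <= b ^+ m.
  apply/andP; split; first by apply: prodr_ge0.
  rewrite -[X in b ^+ X]card_ord -prodr_const; apply: ler_prod => j _; exact: fb.
have mF n : (n <= m)%N ->
    measurable_fun setT ((fun y => \prod_(j < n) f j y) : pathType [set j | j <= i] -> R).
  elim: n => [|n ihn] nm.
    rewrite (_ : (fun y : int -> T => _) = cst 1) //.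
    by apply/funext => y; rewrite big_ord0.
  rewrite (_ : (fun y : int -> T => _) = fun y => (\prod_(j < n) f j y) * f n y); last first.
    by apply/funext => y; rewrite big_ord_recr.
  apply: measurable_funM; first exact: ihn (ltnW nm).
  move=> _ B mB; apply: (@measurable_widen _ _ [set i | start n <= i < start n + k%:Z]).
    move=> l /= /andP[_ h]; rewrite /i /start; move: h; rewrite /start.
    have : (n.+1 * (k + e) <= m * (k + e))%N by rewrite leq_mul2r nm orbT.
    rewrite mulSn; lia.
  exact: mf.
have mfm : measurable_fun setT (f m : pathType [set j | i + e.+1%:Z <= j] -> R).
  move=> _ B mB; apply: (@measurable_widen _ _ [set i | start m <= i < start m + k%:Z]).
    by move=> l /= /andP[h _]; rewrite /i subrK.
  exact: mf.
have Fb' y : 0 <= F y <= b ^+ m + b.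
  by have /andP[-> h] := Fb y; rewrite (le_trans h) // lerDl.
have fb' y : 0 <= f m y <= b ^+ m + b.
  by have /andP[-> h] := fb m y; rewrite (le_trans h) // lerDr exprn_ge0.
have := mixing_integral (mF m (leqnn m)) mfm Fb' fb'.
under [Emean (fun y => \prod_(j < m.+1) f j y)]eq_Rintegral do rewrite big_ord_recr /=.
rewrite big_ord_recr /= => /andP[lo hi].
have Efm0 : 0 <= Emean (f m) by apply: Rintegral_ge0 => w _.
have ci : 0 <= c^-1 by rewrite invr_ge0 ltW.
move: ih => /andP[ih1 ih2]; apply/andP; split.
  apply: le_trans lo; rewrite exprS invfM -!mulrA ler_wpM2l //.
  by rewrite mulrA ler_wpM2r.
have c0' : 0 <= c by exact: ltW.
by apply: le_trans hi _; rewrite exprS -!mulrA ler_wpM2l // mulrA ler_wpM2r.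
Qed.

End mixing_functions.

(** Stationarity moves the gap from the origin to any position. *)
Lemma psi_mixing_mixing (c : R) : stationary P Y -> psi_mixing P Y -> (1 < c)%R ->
  exists e, mixing c e.
Proof.
move=> sY [c_ [[N _ Nmix] c1]] lt1c.
have [N' _ hN'] : \forall m \near \oo, (c_ m < c)%R.
  exact: (cvgr_lt _ c1).
have [N'' _ hN''] : \forall m \near \oo, (0 < c_ m)%R.
  by apply: (cvgr_gt _ c1).
pose m := (N + N' + N'').+1.
have cm : (c_ m < c)%R by apply: hN' => /=; rewrite /m; lia.
have cm0 : (0 < c_ m)%R by apply: hN'' => /=; rewrite /m; lia.
exists (N + N' + N'')%N => i E F mE mF.
have mE0 : measurable (shiftz (- i) @^-1` E : set (pathType [set j | (j <= 0)%R])).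
  rewrite -[X in measurable X]setTI.
  apply: (@measurable_shiftz _ _ (- i)%R _ [set j | (j <= i)%R] _) => //= j /=.
  by rewrite subr_le0.
have mF0 : measurable (shiftz (- i) @^-1` F : set (pathType [set j | (m%:Z <= j)%R])).
  rewrite -[X in measurable X]setTI.
  apply: (@measurable_shiftz _ _ (- i)%R _ [set j | (i + m%:Z <= j)%R] _) => //= j /=.
  by rewrite lerBrDl.
have wE : measurable (E : set (pathType setT)) by exact: measurable_widen mE.
have wF : measurable (F : set (pathType setT)) by exact: measurable_widen mF.
have := Nmix m _ _ _ (sigma_field_path mE0) (sigma_field_path mF0).
have -> : P (path Y @^-1` (shiftz (- i) @^-1` E)) = P (path Y @^-1` E).
  exact: stationary_shiftz.
have -> : P (path Y @^-1` (shiftz (- i) @^-1` F)) = P (path Y @^-1` F).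
  exact: stationary_shiftz.
have -> : P (path Y @^-1` (shiftz (- i) @^-1` E) `&` path Y @^-1` (shiftz (- i) @^-1` F))
    = P (path Y @^-1` E `&` path Y @^-1` F).
  rewrite -[RHS](@stationary_shiftz _ _ _ _ _ P Y (- i)%R (E `&` F)) //.
  exact: measurableI.
have pp : 0 <= P (path Y @^-1` E) * P (path Y @^-1` F) by rewrite mule_ge0.
move=> /(_ _) [|h1 h2]; first by rewrite /= /m; lia.
split; [apply: le_trans h1|apply: le_trans h2 _]; rewrite lee_wpmul2r // lee_fin.
  by rewrite lef_pV2 ?posrE // ?ltW // (lt_trans _ lt1c).
exact: ltW.
Qed.

(** * Independent coordinates *)
Section iid_mixing.
Implicit Types (J : set int) (s : seq int) (B : int -> set T).

Let cylinder s B : set (int -> T) := [set x | forall i, B i (x i)].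

Let cyl J : set (set (int -> T)) := [set E | exists s B,
  [/\ uniq s, {in s, forall i, J i}, forall i, measurable (B i),
      forall i, i \notin s -> B i = setT & E = cylinder s B]].

Let cylinderE s B : (forall i, i \notin s -> B i = setT) ->
  cylinder s B = \bigcap_(i in [set` s]) [set x | B i (x i)].
Proof.
move=> BT; apply/seteqP; split => x; first by move=> h i _; exact: h.
move=> h i; have [si|si] := boolP (i \in s); first exact: h.
by rewrite BT.
Qed.

Let cylI J : setI_closed (cyl J).
Proof.
move=> _ _ [s1 [B1 [u1 J1 m1 T1 ->]]] [s2 [B2 [u2 J2 m2 T2 ->]]].
exists (undup (s1 ++ s2)), (fun i => B1 i `&` B2 i); split.
- exact: undup_uniq.
- by move=> i; rewrite mem_undup mem_cat => /orP[/J1|/J2].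
- by move=> i; exact: measurableI.
- move=> i; rewrite mem_undup mem_cat negb_or => /andP[/T1 -> /T2 ->].
  by rewrite setIT.
- by apply/seteqP; split => x; [move=> [h1 h2] i; split; [exact: h1|exact: h2]|
    move=> h; split => i; have [] := h i].
Qed.

Let measurable_cyl J : @measurable _ (pathType (T := T) J) = <<s cyl J >>.
Proof.
apply/seteqP; split; apply: smallest_sub; try exact: smallest_sigma_algebra.
  move=> _ [i Ji [B mB <-]]; apply: sub_sigma_algebra.
  exists [:: i], (fun j => if j == i then B else setT); split => //.
  - by move=> j; rewrite inE => /eqP ->.
  - by move=> j; case: ifP.
  - by move=> j; rewrite inE => /negbTE ->.
  apply/seteqP; split => x /=.
    by move=> [_ Bx] j; case: eqP => // ->.
  by move=> /(_ i); rewrite eqxx; split.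
move=> _ [s [B [us Js mB BT ->]]]; rewrite cylinderE //.
apply: fin_bigcap_measurable; first exact: finite_seq.
move=> i si; rewrite -[X in measurable X]setTI.
exact: (@measurable_coord _ _ J i (Js _ si) measurableT _ (mB i)).
Qed.

Let measurable_cyl_sub J E : cyl J E -> measurable (E : set (pathType J)).
Proof. by move=> cE; rewrite measurable_cyl; exact: sub_sigma_algebra. Qed.

(* Both sides are finite measures in [E]; they agree on the pi-system of
   cylinders. *)
Let extend_cyl J (G : set Omega) : measurable G ->
  (forall E, cyl J E -> P (path Y @^-1` E `&` G) = P (path Y @^-1` E) * P G) ->
  forall E, measurable (E : set (pathType J)) ->
    P (path Y @^-1` E `&` G) = P (path Y @^-1` E) * P G.
Proof.
move=> mG h E mE.
have PG0 : (0 <= fine (P G))%R by rewrite fine_ge0.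
have mY := @measurable_path _ _ _ _ Y J.
pose m1 : {measure set (pathType J) -> \bar R} :=
  measure_function_pushforward__canonical__measure_function_Measure (mrestr P mG) mY.
pose m2 : {measure set (pathType J) -> \bar R} :=
  mscale (NngNum PG0)
    (measure_function_pushforward__canonical__measure_function_Measure P mY).
have PGE : (fine (P G))%:E = P G by rewrite fineK // fin_num_measure.
have cT : cyl J setT.
  exists [::], (fun=> setT); split => //.
  by apply/seteqP; split.
have : m1 E = m2 E.
  apply: (@measure_unique _ R (pathType J) (cyl J) (fun=> setT) (measurable_cyl J)
    (@cylI J) (fun=> cT)) => //.
  - by apply: bigcup_const; exists 0%N.
  - by move=> A cA; rewrite /m1 /m2 /= /mscale /= PGE muleC -h.
  - move=> _; rewrite /m1 /= /mrestr /pushforward preimage_setT setTI.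
    by rewrite (le_lt_trans (probability_le1 P mG)) ?ltry.
by rewrite /m1 /m2 /= /mscale /= PGE muleC.
Qed.

Hypothesis iidY : iid P Y.

Let prob_cylinder s B : uniq s -> (forall i, measurable (B i)) ->
  (forall i, i \notin s -> B i = setT) ->
  P (path Y @^-1` (cylinder s B)) = \prod_(i <- s) P (Y i @^-1` B i).
Proof.
by move=> us mB BT; rewrite cylinderE // preimage_bigcap -(iidY.1 s B).
Qed.

(** Extend the product rule from cylinders first in [E], then in [F]. *)
Lemma iid_independent J1 J2 E F : J1 `&` J2 = set0 ->
  measurable (E : set (pathType J1)) -> measurable (F : set (pathType J2)) ->
  P (path Y @^-1` E `&` path Y @^-1` F) = P (path Y @^-1` E) * P (path Y @^-1` F).
Proof.
move=> J12 mE mF.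
apply: (@extend_cyl J1) => //; first exact: measurable_path_preimage mF.
move=> {mE}E cE; rewrite setIC muleC.
apply: (@extend_cyl J2) => //.
  exact: measurable_path_preimage (measurable_cyl_sub cE).
move=> {mF}F cF.
move: cF cE => [s1 [B1 [u1 Js1 m1 T1 ->]]] [s2 [B2 [u2 Js2 m2 T2 ->]]].
have s12 i : i \in s1 -> i \in s2 -> False.
  by move=> /Js1 h1 /Js2 h2; have : (J1 `&` J2) i by []; rewrite J12.
have u12 : uniq (s1 ++ s2).
  rewrite cat_uniq u1 u2 andbT /=; apply/hasPn => i i2.
  by apply/negP => i1; exact: s12 i1 i2.
have -> : path Y @^-1` cylinder s1 B1 `&` path Y @^-1` cylinder s2 B2 =
    path Y @^-1` cylinder (s1 ++ s2) (fun i => B1 i `&` B2 i).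
  by apply/seteqP; split => x; [move=> [h1 h2] i; split; [exact: h1|exact: h2]|
    move=> h; split => i; have [] := h i].
rewrite !prob_cylinder // ?big_cat /=; last 2 first.
- by move=> i; exact: measurableI.
- by move=> i; rewrite mem_cat negb_or => /andP[/T1 -> /T2 ->]; rewrite setIT.
congr (_ * _); apply: eq_big_seq => i si.
  by rewrite [B2 i]T2 ?setIT //; apply/negP; exact: s12.
by rewrite [B1 i]T1 ?setTI //; apply/negP => /s12; exact.
Qed.

Lemma iid_mixing : mixing 1 0.
Proof.
move=> i E F mE mF; rewrite invr1 !mul1e.
rewrite (iid_independent _ mE mF) //.
by apply/seteqP; split => // j [] /= ij; rewrite leNgt => /negP; apply; lia.
Qed.

End iid_mixing.

End mixing.

(** * Two independent processes *)
Section independent_paths.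
Context {d d1 d2 : measure_display} {Omega : measurableType d}
  {T1 : measurableType d1} {T2 : measurableType d2} {R : realType}
  (P : probability Omega R).
Variables (X : int -> {mfun Omega >-> T1}) (Y : int -> {mfun Omega >-> T2}).
Hypothesis XY : independent_processes P X Y.
Local Notation S1 := (pathType (T := T1) setT).
Local Notation S2 := (pathType (T := T2) setT).

Lemma independent_paths_law (C : set (S1 * S2)) : measurable C ->
  P [set w | C (path X w, path Y w)] = (path_law P X \x path_law P Y)%E C.
Proof.
move=> mC.
have mZ : measurable_fun setT (fun w => (full_path X w, full_path Y w)).
  by apply: measurable_fun_pair; exact: measurable_funPT.
pose m' : {measure set (S1 * S2) -> \bar R} :=
  measure_function_pushforward__canonical__measure_function_Measure P mZ.
rewrite (@product_measure_unique _ _ _ _ _ _ _ m') // => E F mE mF.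
by apply: XY; exact: sigma_field_path.
Qed.

(** Conditioning on the path of [X] by Fubini's theorem for the product law. *)
Lemma independent_paths_le (C : set (S1 * S2)) (eps : R) : measurable C ->
  (forall x : S1, P [set w | C (x, path Y w)] <= eps%:E)%E ->
  (P [set w | C (path X w, path Y w)] <= eps%:E)%E.
Proof.
move=> mC Ceps; rewrite independent_paths_law //.
have eps0 : 0 <= eps.
  by rewrite -lee_fin; apply: le_trans (Ceps point); exact: measure_ge0.
have sec x : path_law P Y (xsection C x) = P [set w | C (x, path Y w)].
  rewrite /path_law /distribution /pushforward; congr (P _).
  by apply/funext => w; rewrite /= xsectionE.
rewrite /product_measure1 -[leRHS]mule1 -(@probability_setT _ _ _ (path_law P X)).
rewrite -integral_cst //; apply: ge0_le_integral => //.
- exact: measurable_fun_xsection.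
- by move=> x _; rewrite /= sec.
Qed.

End independent_paths.

(** * The ergodic theorem *)
Section ergodic_theorem.
Context {d dT : measure_display} {Omega : measurableType d}
  {T : measurableType dT} {R : realType} (P : probability Omega R).
Variable X : int -> {mfun Omega >-> T}.
Hypotheses (sX : stationary P X) (eX : ergodic P X).
Local Notation S := (pathType (T := T) setT).
Local Notation mu := (path_law P X).

Let tau : S -> S := shift.

Let measurable_tau : measurable_fun setT tau.
Proof. exact: (@measurable_shiftz _ _ 1 setT setT). Qed.

Let mu_tau E : measurable E -> mu (tau @^-1` E) = mu E.
Proof. by move=> mE; exact: sX. Qed.

Section maximal.
Variable h : S -> R.
Hypotheses (mh : measurable_fun setT h) (ih : mu.-integrable setT (EFin \o h)).

(** The maximum of [0] and of the first [n] partial sums of [h] along the orbit of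
    [x], in the recursive form that the maximal inequality needs. *)
Fixpoint max_partial_sum n (x : S) : R :=
  if n is n'.+1 then Num.max 0 (h x + max_partial_sum n' (tau x)) else 0.
Local Notation M := max_partial_sum.

Let M_ge0 n x : 0 <= M n x.
Proof. by case: n => //= n; rewrite le_max lexx. Qed.

Let M_nd n x : M n x <= M n.+1 x.
Proof.
elim: n x => [|n ih'] x; first exact: M_ge0.
by rewrite /= ge_max le_max lexx /= le_max lerD2l ih' orbT.
Qed.

Let M_homo x : {homo M ^~ x : n m / (n <= m)%N >-> n <= m}.
Proof. by apply/nondecreasing_seqP => n; exact: M_nd. Qed.

Let sum_le_M n x : \sum_(i < n) h (shiftz i%:Z x) <= M n x.
Proof.
elim: n x => [|n ih'] x; first by rewrite big_ord0.
rewrite big_ord_recl shiftz0 /= le_max lerD2l (le_trans _ (ih' (tau x))) ?orbT //.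
apply: ler_sum => i _; rewrite (_ : shiftz _ x = shiftz i%:Z (tau x)) //.
apply/funext => j; rewrite /tau /shiftz /shift /bump /= -addrA -PoszD.
by rewrite addnC.
Qed.

Let mM n : measurable_fun setT (M n).
Proof.
elim: n => [|n ih'] //=; apply: measurable_maxr => //.
by apply: measurable_funD => //; exact: measurableT_comp ih' measurable_tau.
Qed.

Let iM n : mu.-integrable setT (EFin \o M n).
Proof.
elim: n => [|n ih']; first exact: integrable_cst.
have it : mu.-integrable setT (fun x => (M n (tau x))%:E).
  exact: (integrable_image measurable_tau mu_tau ih').
have := integrableD measurableT (integrable_abse ih) it.
apply: le_integrable => //; first by apply/measurable_EFinP; exact: mM.
move=> x _; rewrite -[leRHS]/(`|(`|h x| + M n (tau x))%:E|)%E lee_fin.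
rewrite [leLHS]ger0_norm // [leRHS]ger0_norm; last by rewrite addr_ge0 ?M_ge0.
by rewrite /= ge_max addr_ge0 ?M_ge0 //= lerD2r ler_norm.
Qed.

Let E := [set x : S | forall K : nat, exists n, K%:R < M n x].

Let mE : measurable E.
Proof.
have -> : E = \bigcap_(K in [set: nat]) \bigcup_(n in [set: nat]) [set x | K%:R < M n x].
  apply/seteqP; split => x.
    by move=> Ex K _; have [n ?] := Ex K; exists n.
  by move=> Ex K; have [n _ ?] := Ex K I; exists n.
apply: bigcap_measurable => // K _; apply: bigcup_measurable => n _.
by rewrite -[X in measurable X]setTI; apply: measurable_fun_ltr.
Qed.

Let tauE : tau @^-1` E = E.
Proof.
apply/seteqP; split => x Ex K.
  have [n] := Ex (Num.truncn `|K%:R - h x|).+1.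
  have := truncnS_gt `|K%:R - h x|; have := ler_norm (K%:R - h x) => h1 h2 h3.
  exists n.+1; rewrite /= lt_max; apply/orP; right; lra.
have [[|n]] := Ex (Num.truncn (K%:R + `|h x|)).+1; first by rewrite /= ltNge ler0n.
rewrite /= lt_max ltNge ler0n /= => h1.
have := truncnS_gt (K%:R + `|h x|); have := ler_norm (h x) => h2 h3.
exists n; lra.
Qed.

(** Garsia's argument: [M n.+1 - M n \o tau = max (- M n \o tau) h] has
    nonnegative integral, and equals [h] eventually where [M] is unbounded. *)
Let max_partial_sum_bounded : (\int[mu]_x (h x)%:E < 0)%E -> mu E = 0%E.
Proof.
move=> h0.
have [//|E1] : mu E = 0%E \/ mu E = 1%E by exact: (eX mE tauE).
pose D n x := Num.max (- M n (tau x)) (h x).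
have DE n x : D n x = M n.+1 x - M n (tau x).
  rewrite /D /=; case: (leP 0 (h x + M n (tau x))) => h1.
    by rewrite addrK max_r //; lra.
  by rewrite add0r max_l //; lra.
have it n : mu.-integrable setT (fun x => (M n (tau x))%:E).
  exact: (integrable_image measurable_tau mu_tau (iM n)).
have D_ge0 n : (0 <= \int[mu]_x (D n x)%:E)%E.
  under eq_integral do rewrite DE EFinB.
  rewrite integralB //; last exact: iM.
  rewrite (integral_image measurable_tau mu_tau (iM n)).
  rewrite -integralB //; [|exact: iM..].
  by apply: integral_ge0 => x _; rewrite -EFinB lee_fin subr_ge0.
have mD n : measurable_fun setT (fun x => (D n x)%:E).
  apply/measurable_EFinP; apply: measurable_maxr => //.
  by apply: measurable_funN; exact: measurableT_comp (mM n) measurable_tau.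
have [] := @dominated_convergence _ _ _ mu setT measurableT
  (fun n x => (D n x)%:E) (EFin \o h) (abse \o (EFin \o h)) mD.
- exact/measurable_EFinP.
- exists (~` E); split; first exact: measurableC.
    by apply: etrans (probability_setC mu mE) _; rewrite E1 subee.
  move=> x /= nD Ex; apply: nD => _; apply: cvg_near_cst.
  have : E (tau x) by rewrite -[E _]/((tau @^-1` E) x) tauE.
  move=> /(_ (Num.truncn `|h x|).+1)[n hn]; exists n => // m /= nm.
  congr EFin; rewrite /D max_r //.
  have := truncnS_gt `|h x|; have := ler_norm (- h x); rewrite normrN => h1 h2.
  have := M_homo (tau x) nm; lra.
- exact: integrable_abse.
- apply: aeW => x n _; rewrite /= lee_fin /D.
  have := M_ge0 n (tau x); case: (leP (- M n (tau x)) (h x)) => // h1 h2.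
  by rewrite !ler0_norm; lra.
move=> _ _ cD; exfalso; move: h0; rewrite ltNge => /negP; apply.
rewrite -(cvg_lim _ cD) //; apply: lime_ge.
  by apply/cvg_ex; eexists; exact: cD.
exact: nearW.
Qed.

Lemma partial_sums_bounded : (\int[mu]_x (h x)%:E < 0)%E ->
  {ae P, forall w, exists K : R, forall n,
     \sum_(i < n) h (shiftz i%:Z (path X w)) <= K}.
Proof.
move=> /max_partial_sum_bounded E0; exists (path X @^-1` E); split.
- exact: measurable_path_preimage mE.
- exact: E0.
move=> w; apply: contra_notP => /= nE.
have : exists K : nat, forall n, M n (path X w) <= K%:R.
  apply: contrapT => h1; apply: nE => K; apply: contrapT => h2.
  by apply: h1; exists K => n; rewrite leNgt; apply/negP => ?; apply: h2; exists n.
by move=> [K hK]; exists K%:R => n; exact: le_trans (sum_le_M n _) (hK n).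
Qed.

End maximal.

(** Apply [partial_sums_bounded] to [h - m - eps] and to [m - eps - h], both of
    negative mean: the partial sums of [h] are within [eps * n] of [m * n], up to a
    constant. *)
Theorem birkhoff (h : S -> R) : measurable_fun setT h ->
  P.-integrable setT (fun w => (h (path X w))%:E) ->
  {ae P, forall w, n%:R^-1 * \sum_(i < n) h (shiftz i%:Z (path X w))
     @[n --> \oo] --> \int[P]_w h (path X w)}.
Proof.
move=> mh ih; set m := \int[P]_w h (path X w).
have ihmu : mu.-integrable setT (EFin \o h).
  apply/integrableP; split; first exact/measurable_EFinP.
  have /integrableP[_] := ih; rewrite -(@ge0_integral_image _ _ _ _ _ P mu
    (full_path X) _ _ (abse \o (EFin \o h))) //.
    by apply: measurableT_comp => //; exact/measurable_EFinP.
  by move=> x; exact: abse_ge0.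
have mE : (\int[mu]_x (h x)%:E = m%:E)%E.
  rewrite -(@integral_image _ _ _ _ _ P mu (full_path X) _ _ (EFin \o h)) //.
  by rewrite /m /Rintegral fineK // integrable_fin_num.
have key (s c : R) : s * m < c ->
    {ae P, forall w, exists K : R, forall n,
      s * \sum_(i < n) h (shiftz i%:Z (path X w)) <= c * n%:R + K}.
  move=> smc; pose g x := s * h x - c.
  have ig1 : mu.-integrable setT (fun x => (s * h x)%:E).
    by have := integrableZl measurableT s ihmu; apply: eq_integrable.
  have ig : mu.-integrable setT (EFin \o g).
    by have := integrableB measurableT ig1 (integrable_cst mu c); apply: eq_integrable.
  have mg : measurable_fun setT g.
    by apply: measurable_funB => //; exact: measurable_funM.
  have : (\int[mu]_x (g x)%:E < 0)%E.
    under eq_integral do rewrite EFinB.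
    rewrite integralB //; last exact: (integrable_cst mu c).
    under eq_integral do rewrite EFinM.
    rewrite integralZl // mE -[X in (_ - X)%E](_ : c%:E = _).
      by rewrite -EFinM -EFinB lte_fin; lra.
    by rewrite -[in LHS](Rintegral_cst1 mu c) /Rintegral fineK // (integrable_fin_num _ (integrable_cst mu c)).
  move=> /(partial_sums_bounded mg ig); apply: filterS => w [K hK].
  exists K => n; have := hK n.
  rewrite /g big_split /= -mulr_sumr sumr_const card_ord -mulr_natr.
  lra.
have eps0 k : 0 < k.+1%:R^-1 :> R by rewrite invr_gt0.
have h1 k : 1 * m < m + k.+1%:R^-1 by rewrite mul1r ltrDl.
have h2 k : -1 * m < - m + k.+1%:R^-1 by rewrite mulN1r ltrDl.
have A1 := ae_foralln (fun k => key _ _ (h1 k)).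
have A2 := ae_foralln (fun k => key _ _ (h2 k)).
apply: filterS2 A1 A2 => w H1 H2.
apply/cvgrPdist_le => eps eps_gt0.
pose k := Num.truncn (eps / 2)^-1.
have ke : k.+1%:R^-1 <= eps / 2.
  rewrite -[leRHS]invrK lef_pV2 ?posrE ?invr_gt0 ?ltr0n //; last by lra.
  exact: ltW (truncnS_gt _).
have [K1 hK1] := H1 k; have [K2 hK2] := H2 k.
pose N := (Num.truncn ((`|K1| + `|K2|) / (eps / 2))).+1.
exists N => // n /= Nn.
have n0 : 0 < n%:R :> R by rewrite ltr0n; apply: leq_trans Nn.
have nK : `|K1| + `|K2| <= eps / 2 * n%:R.
  rewrite mulrC -ler_pdivrMr; last by lra.
  apply: le_trans (ltW (truncnS_gt _)) _.
  by rewrite ler_nat.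
have := hK1 n; have := hK2 n; set A := \sum_(i < n) _ => h3 h4.
have := ler_norm K1; have := ler_norm K2 => h5 h6.
have := normr_ge0 K1; have := normr_ge0 K2 => h7 h8.
have kn : k.+1%:R^-1 * n%:R <= eps / 2 * n%:R by rewrite ler_wpM2r // ltW.
have e3 : m - n%:R^-1 * A = n%:R^-1 * (m * n%:R - A) by field; rewrite gt_eqF.
rewrite e3 normrM gtr0_norm ?invr_gt0 // ler_pdivrMl //.
have -> : n%:R * eps = eps / 2 * n%:R + eps / 2 * n%:R.
  by rewrite -mulrDl -splitr mulrC.
move: h3 h4 kn nK; rewrite ler_norml !mulrDl !mulNr mul1r.
move: (k.+1%:R^-1 * n%:R) (m * n%:R) (eps / 2 * n%:R) => u v z h3 h4 kn nK.
apply/andP; split; lra.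
Qed.

End ergodic_theorem.

(** * From matching probabilities to waiting times *)
Section borel_cantelli.
Context {d : measure_display} {Omega : measurableType d} {R : realType}
  (P : probability Omega R).

(** Borel-Cantelli lemma, for the exponentially small probabilities below. *)
Lemma borel_cantelli_geometric (A : nat -> set Omega) (K z : R) :
  (forall n, measurable (A n)) -> 0 <= K -> 0 < z < 1 ->
  (forall n, P (A n) <= (K * z ^+ n)%:E)%E ->
  {ae P, forall w, \forall n \near \oo, ~ A n w}.
Proof.
move=> mA K0 /andP[z0 z1] PA.
have nz : `|z| < 1 by rewrite gtr0_norm.
have fin : (\sum_(n <oo) P (A n) < +oo)%E.
  apply: (@le_lt_trans _ _ (K * (1 - z)^-1)%:E); last exact: ltry.
  apply: lime_le; first exact: is_cvg_nneseries.
  apply: nearW => n; apply: (@le_trans _ _ (series (geometric K z) n)%:E).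
    by rewrite /series /= -sumEFin; apply: lee_sum => i _; exact: PA.
  by rewrite lee_fin; exact: geometric_le_lim.
exists (lim_sup_set A); split.
- apply: bigcap_measurable => // k _; apply: bigcup_measurable => j _; exact: mA.
- exact: lim_sup_set_cvg0.
move=> w /= nA n _; apply: contrapT => nAn; apply: nA.
exists n => // m /= nm Am; apply: nAn; by exists m.
Qed.

End borel_cantelli.

Section distortion_paths.
Context {d1 d2 : measure_display} {T1 : measurableType d1}
  {T2 : measurableType d2} {R : realType} (rho : T1 -> T2 -> R).
Hypothesis rho_ge0 : forall x y, 0 <= rho x y.
Hypothesis mrho : measurable_fun setT (fun z : T1 * T2 => rho z.1 z.2).
Implicit Types (x : int -> T1) (y : int -> T2) (i j : int) (n : nat).

Definition psum x y i j n : R := \sum_(k < n) rho (x (i + k%:Z)) (y (j + k%:Z)).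

Lemma psum_ge0 x y i j n : 0 <= psum x y i j n.
Proof. by apply: sumr_ge0. Qed.

Lemma psumD x y i j n m :
  psum x y i j (n + m) = psum x y i j n + psum x y (i + n%:Z) (j + n%:Z) m.
Proof.
rewrite /psum big_split_ord /=; congr (_ + _).
by apply: eq_bigr => k _; rewrite !PoszD !addrA.
Qed.

Lemma psum_shiftz x y i j a b n :
  psum (shiftz a x) (shiftz b y) i j n = psum x y (i + a) (j + b) n.
Proof.
by apply: eq_bigr => k _; rewrite /shiftz -!addrA ![k%:Z + _]addrC.
Qed.

Lemma measurable_psum_right J x i j n : (forall k, (k < n)%N -> J (j + k%:Z)) ->
  measurable_fun setT (fun y : pathType (T := T2) J => psum x y i j n).
Proof.
move=> hJ; apply: measurable_sum => k.
have := measurableT_comp mrho (pair1_measurable (x (i + k%:Z))).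
move=> m1; apply: (measurableT_comp m1).
exact: (measurable_coord (hJ _ (ltn_ord k))).
Qed.

Lemma measurable_psum i j n : measurable_fun setT
  (fun z : pathType (T := T1) setT * pathType (T := T2) setT =>
     psum z.1 z.2 i j n).
Proof.
apply: measurable_sum => k.
have c1 := measurableT_comp (@measurable_coord _ T1 setT (i + k%:Z) I)
  (@measurable_fst _ _ (pathType (T := T1) setT) (pathType (T := T2) setT)).
have c2 := measurableT_comp (@measurable_coord _ T2 setT (j + k%:Z) I)
  (@measurable_snd _ _ (pathType (T := T1) setT) (pathType (T := T2) setT)).
exact: (measurableT_comp mrho (measurable_fun_pair c1 c2)).
Qed.

Context {d : measure_display} {Omega : measurableType d}
  (P : probability Omega R).
Variables (X : int -> {mfun Omega >-> T1}) (Y : int -> {mfun Omega >-> T2}).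
Local Notation S1 := (pathType (T := T1) setT).
Local Notation S2 := (pathType (T := T2) setT).

Lemma rho_n_block i j n w : rho_n rho (block X i n w) (block Y j n w) =
  n%:R^-1 * psum (path X w) (path Y w) i j n.
Proof.
by rewrite /rho_n /psum; congr (_ * _); apply: eq_bigr => k _; rewrite !tnth_mktuple.
Qed.

Variable D : R.

Definition match_prob n x : R :=
  fine (P [set w | psum x (path Y w) 1 1 n <= n%:R * D]).

Lemma measurable_match x j n :
  measurable [set y : S2 | psum x y 1 j n <= n%:R * D].
Proof.
rewrite -[X in measurable X]setTI; apply: measurable_fun_ler => //.
exact: measurable_psum_right.
Qed.

Hypothesis sY : stationary P Y.

Lemma match_probE j n x :
  P [set w | psum x (path Y w) 1 j n <= n%:R * D] = (match_prob n x)%:E.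
Proof.
rewrite /match_prob fineK; last first.
  apply: fin_num_measure.
  exact: (measurable_path_preimage Y (measurable_match x 1 n)).
rewrite -(stationary_shiftz (j - 1) sY (measurable_match x 1 n)).
congr (P _); apply/funext => w /=.
by rewrite -[x in RHS]shiftz0 psum_shiftz addr0 addrC subrK.
Qed.

Lemma measurable_match_prob n : measurable_fun setT (match_prob n : S1 -> R).
Proof.
pose C := [set z : S1 * S2 | psum z.1 z.2 1 1 n <= n%:R * D].
have mC : measurable C.
  rewrite -[X in measurable X]setTI; apply: measurable_fun_ler => //.
  exact: measurable_psum.
have -> : match_prob n = fun x : S1 => fine (path_law P Y (xsection C x)).
  apply/funext => x; rewrite /match_prob /path_law /distribution /pushforward.
  congr (fine (P _)); apply/funext => w /=; by rewrite xsectionE.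
apply: measurableT_comp; first exact: fine_measurable.
exact: measurable_fun_xsection.
Qed.

Hypothesis XY : independent_processes P X Y.

Lemma measurable_event (C : set (S1 * S2)) : measurable C ->
  measurable [set w | C (path X w, path Y w)].
Proof.
move=> mC; rewrite -[X in measurable X]setTI.
have mZ : measurable_fun setT (fun w => (full_path X w, full_path Y w)).
  by apply: measurable_fun_pair; exact: measurable_funPT.
exact: mZ.
Qed.

(** Union bound over the first [m] positions: given [X], each matches with
    probability [match_prob n], by stationarity of [Y]. *)
Lemma early_match (m n : nat) (q : R) : 0 <= q ->
  let A := [set w | match_prob n (path X w) <= q /\ exists2 i : nat,
    (i < m)%N & psum (path X w) (path Y w) 1 i.+1%:Z n <= n%:R * D] in
  measurable A /\ (P A <= (m%:R * q)%:E)%E.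
Proof.
move=> q0; pose B (i : nat) := [set z : S1 * S2 | psum z.1 z.2 1 i.+1%:Z n <= n%:R * D].
have mB (i : nat) : measurable (B i).
  rewrite -[X in measurable X]setTI; apply: measurable_fun_ler => //.
  exact: measurable_psum.
pose G := [set z : S1 * S2 | match_prob n z.1 <= q].
have mG : measurable G.
  rewrite -[X in measurable X]setTI; apply: measurable_fun_ler => //.
  exact: (measurableT_comp (measurable_match_prob n) (@measurable_fst _ _ _ _)).
pose C := G `&` \big[setU/set0]_(i < m) B i.
have mC : measurable C by apply: measurableI => //; exact: bigsetU_measurable.
move=> A; have -> : A = [set w | C (path X w, path Y w)].
  apply/seteqP; split => w [h1 h2]; split => //.
    by have [i im h] := h2; rewrite -bigcup_mkord; exists i.
  by move: h2; rewrite -bigcup_mkord => -[i im h]; exists i.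
split; first exact: measurable_event.
apply: (independent_paths_le XY) => // x.
have [xq|xq] := leP (match_prob n x) q; last first.
  rewrite (_ : [set w | _] = set0) ?measure0 ?lee_fin ?mulr_ge0 //.
  by apply/seteqP; split => w // [/= h _]; rewrite ltNge h in xq.
pose Bx (i : nat) := [set w | psum x (path Y w) 1 i.+1%:Z n <= n%:R * D].
have mBx (i : nat) : measurable (Bx i).
  exact: (measurable_path_preimage Y (measurable_match x i.+1%:Z n)).
apply: (@le_trans _ _ (\sum_(i < m) P (Bx i))%E).
  apply: (@le_trans _ _ (P (\big[setU/set0]_(i < m) Bx i))).
    apply: le_measure; rewrite ?inE.
    - have := measurable_xsection x mC => /(measurable_path_preimage Y).
      by congr measurable; apply/funext => w; rewrite /= xsectionE.
    - exact: bigsetU_measurable.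
    move=> w [_ /=]; rewrite -!bigcup_mkord => -[i im h]; by exists i.
  exact: Boole_inequality.
under eq_bigr do rewrite match_probE.
by rewrite sumEFin lee_fin sumr_const card_ord -[leLHS]mulr_natl ler_wpM2l.
Qed.

Variables (c : R) (e : nat).
Hypotheses (c1 : 1 <= c) (Ymix : @mixing _ _ _ _ _ P Y c e).

Let start n (j : nat) : int := 1 + (j * (n + e))%N%:Z.

(** By mixing, each further window spaced by [e] letters multiplies the
    probability of no match by at most [1 - match_prob n x / c]. *)
Lemma spaced_mismatch (J n : nat) x :
  let A := [set w : Omega | forall j : nat, (j < J)%N ->
       n%:R * D < psum x (path Y w) 1 (start n j) n] in
  (P A <= ((1 - match_prob n x / c) ^+ J)%:E)%E.
Proof.
move=> /=; have c0 : 0 < c by exact: lt_le_trans c1.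
set q := match_prob n x.
have q1 : q <= 1.
  rewrite -lee_fin /q -(match_probE 1); apply: probability_le1.
  exact: (measurable_path_preimage Y (measurable_match x 1 n)).
have qc : 0 <= 1 - q / c.
  rewrite subr_ge0 ler_pdivrMr // mul1r; exact: le_trans q1 c1.
elim: J => [|J ih].
  rewrite expr0; apply: probability_le1.
  by rewrite (_ : [set w | _] = setT) //; apply/seteqP; split.
pose i := start n J - e.+1%:Z.
pose E := [set y : int -> T2 | forall j : nat, (j < J)%N ->
  n%:R * D < psum x y 1 (start n j) n].
pose F := [set y : int -> T2 | psum x y 1 (start n J) n <= n%:R * D].
have mE : measurable (E : set (pathType [set j | j <= i])).
  have -> : E = \bigcap_(j in [set j | (j < J)%N])
      [set y | n%:R * D < psum x y 1 (start n j) n].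
    by apply/seteqP; split => y h j jJ; exact: h.
  apply: bigcap_measurableType => j /= jJ; rewrite -[X in measurable X]setTI.
  apply: measurable_fun_ltr => //; apply: measurable_psum_right => k kn /=.
  have : (j.+1 * (n + e) <= J * (n + e))%N by rewrite leq_mul2r jJ orbT.
  rewrite /i /start mulSn; lia.
have mF : measurable (F : set (pathType [set j | i + e.+1%:Z <= j])).
  rewrite -[X in measurable X]setTI.
  apply: measurable_fun_ler => //; apply: measurable_psum_right => k kn /=.
  by rewrite /i subrK lerDl.
have mE' := measurable_path_preimage Y mE.
have mF' := measurable_path_preimage Y mF.
have [lo _] := Ymix mE mF.
rewrite (_ : [set w | _] = path Y @^-1` E `\` (path Y @^-1` E `&` path Y @^-1` F)); last first.
  apply/seteqP; split => w /=.
    move=> h; split; first by move=> j jJ; apply: h; exact: ltnW.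
    by move=> [_]; rewrite /F /= leNgt h.
  move=> [h1 h2] j; rewrite ltnS leq_eqVlt => /predU1P[->|/h1//].
  by rewrite ltNge; apply/negP => h3; apply: h2.
rewrite measureD //; [|exact: measurableI|]; last first.
  by rewrite (le_lt_trans (probability_le1 P mE')) ?ltry.
rewrite setIA setIid; change (P (path Y @^-1` E) - P (path Y @^-1` E `&` path Y @^-1` F) <=
  ((1 - q / c) ^+ J.+1)%:E)%E.
move: ih lo.
rewrite -[P [set w | _]]/(P (path Y @^-1` E)) (match_probE _ n x : P (path Y @^-1` F) = _).
have fE : P (path Y @^-1` E) = (fine (P (path Y @^-1` E)))%:E by rewrite fineK // fin_num_measure.
have fEF : P (path Y @^-1` E `&` path Y @^-1` F) =
    (fine (P (path Y @^-1` E `&` path Y @^-1` F)))%:E.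
  by rewrite fineK // fin_num_measure //; exact: measurableI.
rewrite fEF fE -!EFinM -EFinB !lee_fin -/q => ih lo.
apply: (@le_trans _ _ (fine (P (path Y @^-1` E)) * (1 - q / c))).
  move: lo; rewrite mulrCA mulrA -mulrA [c^-1 * q]mulrC mulrBr mulr1; lra.
by rewrite exprSr ler_wpM2r.
Qed.

Lemma match_at (i n : nat) w : (0 < n)%N ->
  (rho_n rho (block X 1 n w) (block Y i%:Z n w) <= D) =
  (psum (path X w) (path Y w) 1 i n <= n%:R * D).
Proof.
by move=> n0; rewrite rho_n_block [LHS]ler_pdivrMl // ltr0n.
Qed.

Lemma waiting_time_ge (m n : nat) w : (0 < n)%N ->
  (forall i : nat, (i < m)%N -> n%:R * D < psum (path X w) (path Y w) 1 i.+1 n) ->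
  (m.+1%:R%:E <= waiting_time rho X Y D n w)%E.
Proof.
move=> n0 h; apply: le_ereal_inf_tmp => _ [[|i] /= [i0 +] <-]; first by [].
rewrite match_at // => hi; rewrite lee_fin ler_nat ltnS leqNgt.
by apply/negP => /h; rewrite ltNge hi.
Qed.

Lemma waiting_time_le (i n : nat) w : (0 < n)%N -> (0 < i)%N ->
  psum (path X w) (path Y w) 1 i n <= n%:R * D ->
  (waiting_time rho X Y D n w <= i%:R%:E)%E.
Proof.
move=> n0 i0 h; apply: ereal_inf_lbound; exists i => //=.
by rewrite match_at.
Qed.

Variable r : R.
Hypothesis r0 : 0 <= r.
Hypothesis aep : forall eps : R, 0 < eps -> {ae P, forall w, \forall n \near \oo,
  expR (- (n%:R * (r + eps))) <= match_prob n (path X w) <=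
  expR (- (n%:R * (r - eps)))}.

(* Union bound up to time [expR (n (r - 2 eps))]: the error is [expR (- n eps)]. *)
Let waiting_lower (eps : R) : 0 < eps -> {ae P, forall w, \forall n \near \oo,
  ((expR (n%:R * (r - 2 * eps)))%:E <= waiting_time rho X Y D n w)%E}.
Proof.
move=> eps0; pose m (n : nat) := Num.truncn (expR (n%:R * (r - 2 * eps))).
pose q (n : nat) := expR (- (n%:R * (r - eps))).
have q0 n : 0 <= q n by exact: expR_ge0.
have := @borel_cantelli_geometric _ _ _ P _ 1 (expR (- eps))
  (fun n => (early_match (m n) n (q0 n)).1) ler01.
have z1 : 0 < expR (- eps) < 1 by rewrite expR_gt0 expR_lt1 oppr_lt0 eps0.
move=> /(_ z1) bc.
have {}bc : {ae P, forall w, \forall n \near \oo, ~ (match_prob n (path X w) <= q n /\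
    exists2 i : nat, (i < m n)%N & psum (path X w) (path Y w) 1 i.+1%:Z n <= n%:R * D)}.
  apply: bc => n; apply: le_trans (early_match (m n) n (q0 n)).2 _.
  rewrite lee_fin mul1r; apply: (@le_trans _ _ (expR (n%:R * (r - 2 * eps)) * q n)).
    by rewrite ler_wpM2r // truncn_le expR_ge0.
  rewrite /q -expRD -expRM_natl ler_expR.
  suff -> : n%:R * (r - 2 * eps) - n%:R * (r - eps) = n%:R * - eps by [].
  by ring.
apply: filterS2 bc (aep eps0) => w bc aw.
near=> n.
have n0 : (0 < n)%N by near: n; exists 1%N.
have nA : ~ (match_prob n (path X w) <= q n /\ exists2 i : nat, (i < m n)%N &
    psum (path X w) (path Y w) 1 i.+1%:Z n <= n%:R * D) by near: n.
have /andP[_ up] : expR (- (n%:R * (r + eps))) <= match_prob n (path X w) <=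
  expR (- (n%:R * (r - eps))) by near: n.
apply: (@le_trans _ _ (m n).+1%:R%:E).
  by rewrite lee_fin ltW // truncnS_gt.
apply: waiting_time_ge => // i im; rewrite ltNge; apply/negP => h; apply: nA.
by split => //; exists i.
Unshelve. all: by end_near. Qed.

(* There are [J >= expR (n (r + 2 eps))] spaced windows; all fail with probability
   at most [expR (- J q / c) <= c expR (- n eps)]. The last one starts by time
   [J (n + e)], and the factor [n + e] costs the third [eps]. *)
Let waiting_upper (eps : R) : 0 < eps -> {ae P, forall w, \forall n \near \oo,
  (waiting_time rho X Y D n w <= (expR (n%:R * (r + 3 * eps)))%:E)%E}.
Proof.
move=> eps0; have c0 : 0 < c by exact: lt_le_trans c1.
pose J (n : nat) := (Num.truncn (expR (n%:R * (r + 2 * eps)))).+1.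
pose q (n : nat) := expR (- (n%:R * (r + eps))).
pose C (n : nat) := [set z : S1 * S2 | q n <= match_prob n z.1] `&`
  \bigcap_(j in [set j | (j < J n)%N])
    [set z : S1 * S2 | n%:R * D < psum z.1 z.2 1 (start n j) n].
have mC n : measurable (C n).
  apply: measurableI.
    rewrite -[X in measurable X]setTI; apply: measurable_fun_ler => //.
    exact: (measurableT_comp (measurable_match_prob n) (@measurable_fst _ _ _ _)).
  apply: bigcap_measurableType => j _.
  rewrite -[X in measurable X]setTI; apply: measurable_fun_ltr => //.
  exact: measurable_psum.
have PC n : (P [set w | C n (path X w, path Y w)] <= (c * expR (- eps) ^+ n)%:E)%E.
  apply: (independent_paths_le XY) => // x.
  have [qx|qx] := leP (q n) (match_prob n x); last first.
    rewrite (_ : [set w | _] = set0) ?measure0 ?lee_fin ?mulr_ge0 ?exprn_ge0 ?expR_ge0 ?(ltW c0) //.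
    by apply/seteqP; split => w // [/= h _]; rewrite ltNge h in qx.
  have mS : measurable [set w | C n (x, path Y w)].
    have := measurable_xsection x (mC n) => /(measurable_path_preimage Y).
    by congr measurable; apply/funext => w; rewrite /= xsectionE.
  apply: le_trans (le_trans (spaced_mismatch (J n) n x) _).
    apply: le_measure; rewrite ?inE //; last by move=> w [_ /= h] j jJ; exact: h.
    have -> : [set w : Omega | forall j : nat, (j < J n)%N ->
        n%:R * D < psum x (path Y w) 1 (start n j) n] = path Y @^-1`
       \bigcap_(j in [set j | (j < J n)%N])
         [set y | n%:R * D < psum x y 1 (start n j) n].
      by apply/seteqP; split.
    apply: (@measurable_path_preimage _ _ _ _ Y setT).
    apply: bigcap_measurableType => j _; rewrite -[X in measurable X]setTI.
    by apply: measurable_fun_ltr => //; exact: measurable_psum_right.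
  rewrite lee_fin.
  set p := match_prob n x in qx *.
  have q0 : 0 < q n by exact: expR_gt0.
  have p1 : p <= 1.
    rewrite -lee_fin /p -(match_probE 1); apply: probability_le1.
    exact: (measurable_path_preimage Y (measurable_match x 1 n)).
  have pc : 0 <= 1 - p / c.
    by rewrite subr_ge0 ler_pdivrMr // mul1r (le_trans p1).
  have Jgt : expR (n%:R * (r + 2 * eps)) <= (J n)%:R by rewrite ltW // truncnS_gt.
  set u := p / c * (J n)%:R.
  have u0 : expR (n%:R * eps) / c <= u.
    rewrite /u mulrAC ler_pM2r ?invr_gt0 //.
    apply: (@le_trans _ _ (q n * expR (n%:R * (r + 2 * eps)))).
      by rewrite /q -expRD ler_expR; lra.
    by apply: ler_pM => //; exact: expR_ge0.
  have ue : 0 < expR (n%:R * eps) / c by rewrite divr_gt0 // expR_gt0.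
  apply: (@le_trans _ _ (expR (- u))).
    rewrite /u -[X in _ <= expR X]mulNr expRM_natr; apply: lerXn2r; rewrite ?nnegrE ?expR_ge0 //.
    exact: expR_ge1Dx.
  rewrite expRN; apply: (@le_trans _ _ (expR (n%:R * eps) / c)^-1).
    rewrite lef_pV2 ?posrE ?expR_gt0 // (le_trans u0) //.
    by apply: le_trans (expR_ge1Dx u); rewrite lerDr.
  by rewrite invfM invrK mulrC -expRN -mulrN expRM_natl.
have z1 : 0 < expR (- eps) < 1 by rewrite expR_gt0 expR_lt1 oppr_lt0 eps0.
have := borel_cantelli_geometric (fun n => measurable_event (mC n)) (ltW c0) z1 PC.
move=> bc; apply: filterS2 bc (aep eps0) => w bc aw.
near=> n.
have n0 : (0 < n)%N by near: n; exists 1%N.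
have nC : ~ C n (path X w, path Y w) by near: n.
have /andP[dn _] : expR (- (n%:R * (r + eps))) <= match_prob n (path X w) <=
  expR (- (n%:R * (r - eps))) by near: n.
have [j jJ hj] : exists2 j : nat, (j < J n)%N &
    psum (path X w) (path Y w) 1 (start n j) n <= n%:R * D.
  apply: contrapT => h; apply: nC; split => //= j jJ /=.
  by rewrite ltNge; apply/negP => hj; apply: h; exists j.
have en : (n + e).+1%:R <= expR (n%:R * eps).
  have ne : (e.+1 <= n)%N by near: n; exists e.+1.
  have n8 : 8 / eps ^+ 2 <= n%:R by near: n; exact: nbhs_infty_ger.
  have e2 : n%:R * eps = n%:R * eps / 2 + n%:R * eps / 2 by lra.
  rewrite e2 expRD -expr2.
  have h1 := expR_ge1Dx (n%:R * eps / 2).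
  have h2 : 0 <= n%:R * eps / 2 by rewrite !mulr_ge0 // ltW.
  apply: (@le_trans _ _ ((n%:R * eps / 2) ^+ 2)); last first.
    by apply: lerXn2r; rewrite ?nnegrE ?expR_ge0 // (le_trans _ h1) // lerDr.
  move: n8; rewrite ler_pdivrMr ?exprn_gt0 // => n8.
  apply: (@le_trans _ _ (n%:R * 2)).
    by rewrite -natrM ler_nat muln2 -addnn -addnS leq_add2l.
  have -> : (n%:R * eps / 2) ^+ 2 = n%:R * (n%:R * eps ^+ 2 / 4) by field.
  by rewrite ler_wpM2l // ler_pdivlMr //; lra.
apply: (@le_trans _ _ (1 + j * (n + e))%N%:R%:E).
  exact: waiting_time_le.
have hJ : j%:R <= expR (n%:R * (r + 2 * eps)).
  by rewrite -truncn_ge_nat ?expR_ge0.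
have hE : 1 <= expR (n%:R * (r + 2 * eps)).
  by rewrite -[leLHS](@expR0 R) ler_expR mulr_ge0 // addr_ge0 // mulr_ge0 // ltW.
rewrite lee_fin natrD natrM.
have -> : n%:R * (r + 3 * eps) = n%:R * (r + 2 * eps) + n%:R * eps by ring.
rewrite expRD; apply: (@le_trans _ _ (expR (n%:R * (r + 2 * eps)) * (n + e).+1%:R)).
  by rewrite -[(n + e).+1%:R]natr1 mulrDr mulr1 addrC lerD // ler_wpM2r.
by rewrite ler_wpM2l // expR_ge0.
Unshelve. all: by end_near. Qed.

(** A match of conditional probability [expR (- n r)] occurs neither much before
    time [expR (n r)], by the union bound, nor much after, since [Y] offers about
    that many almost independent windows. *)
Theorem waiting_time_cvg : {ae P, forall w,
  ((n%:R^-1)%:E * lne (waiting_time rho X Y D n w))%E @[n --> \oo] --> r%:E}.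
Proof.
have lo k := waiting_lower (eps := k.+1%:R^-1) (ltac:(by rewrite invr_gt0)).
have up k := waiting_upper (eps := k.+1%:R^-1) (ltac:(by rewrite invr_gt0)).
apply: filterS2 (ae_foralln lo) (ae_foralln up) => w {}lo {}up.
have bounds (eps : R) : 0 < eps -> \forall n \near \oo,
  ((r - eps)%:E <= (n%:R^-1)%:E * lne (waiting_time rho X Y D n w) <= (r + eps)%:E)%E.
  move=> eps0; have [k hk] : exists k : nat, 3 * k.+1%:R^-1 <= eps.
    exists (Num.truncn (3 / eps)); rewrite ler_pdivrMr // mulrC -ler_pdivrMr //.
    by rewrite ltW // truncnS_gt.
  near=> n.
  have n0 : (0 < n)%N by near: n; exists 1%N.
  have nR : (0 : R) < n%:R by rewrite ltr0n.
  have l : ((expR (n%:R * (r - 2 * k.+1%:R^-1)))%:E <= waiting_time rho X Y D n w)%E.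
    by near: n; exact: lo.
  have u : (waiting_time rho X Y D n w <= (expR (n%:R * (r + 3 * k.+1%:R^-1)))%:E)%E.
    by near: n; exact: up.
  move: l u; case: (waiting_time rho X Y D n w) => [t| |] //; rewrite !lee_fin => l u.
  have t0 : 0 < t by apply: lt_le_trans l; exact: expR_gt0.
  rewrite lne_EFin // -EFinM !lee_fin ler_pdivlMl // ler_pdivrMl //.
  have k0 : 0 < k.+1%:R^-1 :> R by rewrite invr_gt0.
  rewrite -(ler_expR _ (ln t)) -(ler_expR (ln t)) lnK ?posrE //.
  move: k0 hk l u; set z := k.+1%:R^-1 => k0 hk l u.
  apply/andP; split.
    by apply: le_trans l; rewrite ler_expR ler_wpM2l //; lra.
  by apply: (le_trans u); rewrite ler_expR ler_wpM2l //; lra.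
apply/fine_cvgP; split.
  have := bounds 1 ltr01; apply: filterS => n /andP[h1 h2].
  by rewrite fin_numE; apply/andP; split; apply/eqP => h; rewrite h in h1 h2.
apply/cvgrPdist_le => eps eps0; have := bounds _ eps0; apply: filterS => n /=.
case: ((n%:R^-1)%:E * _)%E => [v| |] //=; rewrite ?lee_fin => /andP[h1 h2] //.
by rewrite ler_distlC h1 h2.
Unshelve. all: by end_near. Qed.

End distortion_paths.

(** * Tail bounds along a path *)

Lemma expRN1_le (R : realType) : expR (-1 : R) <= 1/2.
Proof.
have h : 2 <= expR (1 : R) by have := expR_ge1Dx (1 : R); rewrite -[1 + 1]/2.
by rewrite expRN mul1r lef_pV2 // posrE // expR_gt0.
Qed.

(* The final [-1] comes from [1 - 2 expR (-2) >= expR (-1)]. *)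
Lemma tilted_half (R : realType) (u v1 v2 Q a lo hi t : R) :
  expR u <= expR (a * lo) * Q + expR (- t * hi) * expR v1 + expR (t * lo) * expR v2 ->
  v1 - u - t * hi <= - 2 -> v2 - u + t * lo <= - 2 ->
  expR (u - a * lo - 1) <= Q.
Proof.
move=> H up dn; rewrite -!expRD in H.
have e1 : expR (- t * hi + v1) <= expR (u - 2).
  by rewrite ler_expR; move: up; rewrite mulNr; set s := t * hi; lra.
have e2 : expR (t * lo + v2) <= expR (u - 2).
  by rewrite ler_expR; move: dn; set s := t * lo; lra.
have z12 := expRN1_le R; have z0 : 0 < expR (-1 : R) by exact: expR_gt0.
have uz : expR (u - 2) = expR u * (expR (-1) * expR (-1)).
  by rewrite -!expRD; congr expR; ring.
have -> : u - a * lo - 1 = u + -1 - a * lo by ring.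
rewrite expRD expRN ler_pdivrMr ?expR_gt0 // expRD.
have u0 : 0 < expR u by exact: expR_gt0.
move: uz H e1 e2 z12 z0 u0; rewrite [Q * _]mulrC.
move: (expR _) (expR _) (expR _) (expR (-1)) (expR (a * lo) * Q) (expR u).
move=> p1 p2 p3 z s v -> H e1 e2 z12 z0 v0.
have hz : 2 * (z * z) + z <= 1 by nra.
have : v * (2 * (z * z) + z) <= v * 1 by rewrite ler_wpM2l // ltW.
rewrite mulrDr mulr1 [v * (2 * _)]mulrCA; lra.
Qed.

Section tails.
Context {d : measure_display} {T : measurableType d} {R : realType}
  (q : probability T R).
Implicit Types (h : T -> R) (a t : R).

(** When the two error terms of [tilted_lower_bound] are at most [expR (-2)] of the
    whole, the remaining mass lies in [lo, hi], and the lower tail is Chernoff's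
    bound up to a constant and to the width [hi - lo]. *)
Lemma tilted_lower_half h a t lo hi : measurable_fun setT h -> a <= 0 -> 0 <= t ->
  has_mgf q h (a - t) -> has_mgf q h a -> has_mgf q h (a + t) ->
  lmgf q h (a + t) - lmgf q h a - t * hi <= - 2 ->
  lmgf q h (a - t) - lmgf q h a + t * lo <= - 2 ->
  expR (lmgf q h a - a * lo - 1) <= fine (q [set y | h y <= hi]).
Proof.
move=> mh a0 t0 h1 h2 h3 up dn.
have := tilted_lower_bound lo hi mh a0 t0 h1 h2 h3.
by rewrite -!expR_lmgf // => H; exact: tilted_half H up dn.
Qed.

Lemma lmgf_shift h h' (c a : R) : measurable_fun setT h -> measurable_fun setT h' ->
  (forall y, 0 <= h y) -> (forall y, h y <= h' y <= h y + c) -> a <= 0 ->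
  lmgf q h a + a * c <= lmgf q h' a <= lmgf q h a.
Proof.
move=> mh mh' h0 hh' a0.
have h'0 y : 0 <= h' y by have /andP[l _] := hh' y; exact: le_trans l.
have i1 : has_mgf q h a by exact: has_mgf_le0.
have i2 : has_mgf q h' a by exact: has_mgf_le0.
apply/andP; split; rewrite -ler_expR ?expRD (expR_lmgf i1) (expR_lmgf i2); last first.
  apply: le_Rintegral => //= y _; rewrite ler_expR ler_wnM2l //.
  by case/andP: (hh' y).
rewrite mulrC -RintegralZl //.
apply: le_Rintegral => //=.
  have := integrableZl measurableT (expR (a * c)) i1.
  by apply: eq_integrable => // y _ /=; rewrite EFinM.
move=> y _; rewrite -expRD ler_expR -mulrDr ler_wnM2l // addrC.
by case/andP: (hh' y).
Qed.

Lemma lmgf_mono h a b : measurable_fun setT h -> (forall y, 0 <= h y) ->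
  a <= b -> has_mgf q h a -> has_mgf q h b -> lmgf q h a <= lmgf q h b.
Proof.
move=> mh h0 ab i1 i2; rewrite -ler_expR !expR_lmgf //.
by apply: le_Rintegral => //= y _; rewrite ler_expR ler_wpM2r.
Qed.

End tails.

Section maximizers.
Context {d1 d2 : measure_display} {S : measurableType d1}
  {T : measurableType d2} {R : realType}.
Variables (p : probability S R) (q : probability T R) (f : S -> T -> R).
Hypothesis mf : measurable_fun setT (fun z : S * T => f z.1 z.2).
Hypothesis f0 : forall x y, 0 <= f x y.
Hypothesis int_f : (\int[p \x q]_z (f z.1 z.2)%:E < +oo)%E.
Local Notation Lam := (mean_lmgf p q f).

(** The slope [Lam a / a] is monotone, as [Lam] is convex with [Lam 0 = 0]. *)
Lemma mean_lmgf_slope a k : a <= k -> k < 0 -> a / k * Lam k <= Lam a.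
Proof.
move=> ak k0.
have t1 := mean_lmgf_tangent mf f0 int_f k0 (le_trans ak (ltW k0)).
have t2 := mean_lmgf_tangent mf f0 int_f k0 (lexx 0).
rewrite mean_lmgf0 in t2; move: t1 t2.
move: (mean_lmgf p q f k) (mean_lmgf p q f a) (mean_tilt p q f k) => u v s t1 t2.
have h : u <= k * s by lra.
apply: le_trans t1; rewrite mulrAC ler_ndivrMr //.
nra.
Qed.

(** Otherwise the slope bound puts [Lam a] above [a * D], contrary to the tangent
    at [a], which passes below [Lam 0 = 0]. *)
Lemma maximizer_ge a k D : k < 0 -> k * D < Lam k -> a < 0 ->
  mean_tilt p q f a = D -> k <= a.
Proof.
move=> k0 kD a0 aD; rewrite leNgt; apply/negP => ak.
have t2 := mean_lmgf_tangent mf f0 int_f a0 (lexx 0).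
have := mean_lmgf_slope (ltW ak) k0.
rewrite mean_lmgf0 aD in t2; move: kD t2.
move: (mean_lmgf p q f k) (mean_lmgf p q f a) => u v kD t2.
rewrite mulrAC ler_ndivrMr // => h; nra.
Qed.

End maximizers.

Section windows.
Context {d1 d2 d : measure_display} {T1 : measurableType d1}
  {T2 : measurableType d2} {R : realType} (rho : T1 -> T2 -> R).
Hypothesis rho_ge0 : forall x y, 0 <= rho x y.
Hypothesis mrho : measurable_fun setT (fun z : T1 * T2 => rho z.1 z.2).
Context {Omega : measurableType d} (P : probability Omega R).
Variable Y : int -> {mfun Omega >-> T2}.
Hypothesis sY : stationary P Y.
Implicit Types (x : int -> T1) (y : int -> T2).
Local Notation S1 := (pathType (T := T1) setT).
Local Notation S2 := (pathType (T := T2) setT).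

Definition window_lmgf (n : nat) (a : R) x : R :=
  lmgf P (fun w => psum rho x (path Y w) 1 1 n) a.

Lemma measurable_psum_path x (i j : int) n :
  measurable_fun setT (fun w => psum rho x (path Y w) i j n).
Proof.
have m := measurable_psum_right (J := setT) mrho x i (j := j) (n := n) (fun _ _ => I).
exact: measurableT_comp m (@measurable_path _ _ _ _ Y setT).
Qed.

Lemma psum_mgf x (i j : int) n a : mgf P (fun w => psum rho x (path Y w) i j n) a =
  mgf P (fun w => psum rho (shiftz (i - 1) x) (path Y w) 1 1 n) a.
Proof.
rewrite /mgf /Rintegral; congr fine.
pose h (y : S2) := (expR (a * psum rho (shiftz (i - 1) x) y 1 1 n))%:E.
have mh : measurable_fun setT h.
  apply/measurable_EFinP; apply: measurable_exp.
  exact: measurable_psum_right.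
rewrite -(ge0_integral_shiftz (j - 1) sY mh) => [|y]; last by rewrite lee_fin expR_ge0.
apply: eq_integral => w _; rewrite /h psum_shiftz.
by rewrite ![1 + (_ - 1)]addrC !subrK.
Qed.

Lemma psum_lmgf x (i j : int) n a : lmgf P (fun w => psum rho x (path Y w) i j n) a =
  window_lmgf n a (shiftz (i - 1) x).
Proof. by rewrite /window_lmgf /lmgf psum_mgf. Qed.

Lemma measurable_window_lmgf n a :
  measurable_fun setT (window_lmgf n a : S1 -> R).
Proof.
have mp := measurable_psum mrho 1 1 n.
have m := measurable_lmgf (f := fun (x : S1) (y : S2) => psum rho x y 1 1 n)
  (path_law P Y) mp a.
rewrite (_ : window_lmgf n a = fun x : S1 => lmgf (path_law P Y) (fun y => psum rho x y 1 1 n) a) //.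
apply/funext => x; rewrite /window_lmgf /lmgf /mgf /Rintegral.
congr (ln (fine _)).
pose h (y : S2) := (expR (a * psum rho x y 1 1 n))%:E.
have mh : measurable_fun setT h.
  apply/measurable_EFinP; apply: measurable_exp.
  exact: measurable_psum_right.
apply: (ge0_integral_image (@measurable_path _ _ _ _ Y setT) _ mh).
- by [].
- by move=> y; rewrite lee_fin expR_ge0.
Qed.

Lemma psum_has_mgf x (i j : int) n a : a <= 0 ->
  has_mgf P (fun w => psum rho x (path Y w) i j n) a.
Proof.
move=> a0; apply: has_mgf_le0 => //; first exact: measurable_psum_path.
by move=> w; exact: psum_ge0.
Qed.

(** Chernoff's bound on a path [x] along which the log-moments have a rate [L]. *)
Lemma match_prob_upper D a (L : R) x : a <= 0 ->
  n%:R^-1 * window_lmgf n a x @[n --> \oo] --> L ->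
  forall eps : R, 0 < eps -> \forall n \near \oo,
  match_prob rho P Y D n x <= expR (- (n%:R * (a * D - L - eps))).
Proof.
move=> a0 cvL eps eps0.
near=> n.
have n0 : (0 < n%:R :> R) by rewrite ltr0n; near: n; exists 1%N.
have hL : n%:R^-1 * window_lmgf n a x <= L + eps.
  by near: n; apply: (cvgr_le _ cvL); rewrite ltrDl.
have := chernoff_lower (n%:R * D) (measurable_psum_path x 1 1 n) a0
  (psum_has_mgf x 1 1 n a0).
move/le_trans; apply; rewrite ler_expR -/(window_lmgf n a x).
move: hL; rewrite ler_pdivrMl // => hL.
have -> : - (n%:R * (a * D - L - eps)) = n%:R * (L + eps) - a * (n%:R * D) by ring.
by rewrite lerB.
Unshelve. all: by end_near. Qed.

(** The matching lower bound when [Lam] is nearly linear with slope [D'] around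
    [a]: tilting by [a] then concentrates the distortion per letter around [D'].
    Convergence at the three points [a], [a + t] and [a - t] suffices. *)
Lemma match_prob_lower D' eta (a t : R) (Lam : R -> R) x :
  a <= 0 -> 0 < t -> a + t <= 0 -> 0 < eta ->
  Lam (a + t) - Lam a <= t * (D' + eta / 2) ->
  Lam (a - t) - Lam a <= - t * (D' - eta / 2) ->
  (forall b, b \in [:: a; a + t; a - t] ->
     n%:R^-1 * window_lmgf n b x @[n --> \oo] --> Lam b) ->
  forall eps : R, 0 < eps -> \forall n \near \oo,
  expR (n%:R * (Lam a - a * (D' - eta) - eps)) <= match_prob rho P Y (D' + eta) n x.
Proof.
move=> a0 t0 at0 eta0 up dn cvL eps eps0.
pose s := t * eta / 8.
have s0 : 0 < s by rewrite divr_gt0 // mulr_gt0.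
pose del := Num.min s (eps / 2).
have del0 : 0 < del by rewrite lt_min s0 divr_gt0.
have ev b : b \in [:: a; a + t; a - t] ->
    \forall n \near \oo, `|Lam b - n%:R^-1 * window_lmgf n b x| <= del.
  by move=> /cvL /cvgrPdist_le; exact.
have [N1 _ H1] := ev a (mem_head _ _).
have [N2 _ H2] : \forall n \near \oo, `|Lam (a + t) - n%:R^-1 * window_lmgf n (a + t) x| <= del.
  by apply: ev; rewrite !inE eqxx orbT.
have [N3 _ H3] : \forall n \near \oo, `|Lam (a - t) - n%:R^-1 * window_lmgf n (a - t) x| <= del.
  by apply: ev; rewrite !inE eqxx !orbT.
near=> n.
have n0 : (0 < n%:R :> R) by rewrite ltr0n; near: n; exists 1%N.
have n1 : (N1 <= n)%N by near: n; exists N1.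
have n2 : (N2 <= n)%N by near: n; exists N2.
have n3 : (N3 <= n)%N by near: n; exists N3.
have near_lam b : `|Lam b - n%:R^-1 * window_lmgf n b x| <= del ->
    n%:R * (Lam b - del) <= window_lmgf n b x <= n%:R * (Lam b + del).
  rewrite ler_distlC => /andP[h1 h2].
  move: h1 h2; rewrite ler_pdivlMl // ler_pdivrMl // => h1 h2.
  by rewrite h1 h2.
have at2 : a - t <= 0 by rewrite subr_le0 (le_trans a0) // ltW.
have big : 2 <= n%:R * (2 * s).
  rewrite -ler_pdivrMr ?mulr_gt0 //; near: n; exact: nbhs_infty_ger.
have big2 : 1 <= n%:R * (eps / 2).
  rewrite -ler_pdivrMr ?divr_gt0 //; near: n; exact: nbhs_infty_ger.
have ds : n%:R * del <= n%:R * s by rewrite ler_pM2l // ge_min lexx.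
have de : n%:R * del <= n%:R * (eps / 2) by rewrite ler_pM2l // ge_min lexx orbT.
have := @tilted_lower_half _ _ _ P (fun w => psum rho x (path Y w) 1 1 n) a t
  (n%:R * (D' - eta)) (n%:R * (D' + eta)) (measurable_psum_path x 1 1 n) a0 (ltW t0)
  (psum_has_mgf x 1 1 n at2) (psum_has_mgf x 1 1 n a0) (psum_has_mgf x 1 1 n at0).
rewrite -!/(window_lmgf n _ x).
have /andP[l1 u1] := near_lam _ (H1 n n1).
have /andP[l2 u2] := near_lam _ (H2 n n2).
have /andP[l3 u3] := near_lam _ (H3 n n3).
have up' : n%:R * (Lam (a + t) - Lam a) <= n%:R * (t * (D' + eta / 2)).
  by rewrite ler_pM2l.
have dn' : n%:R * (Lam (a - t) - Lam a) <= n%:R * (- t * (D' - eta / 2)).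
  by rewrite ler_pM2l.
rewrite -/(match_prob rho P Y (D' + eta) n x).
move: l1 u1 l2 u2 l3 u3 up' dn' big big2 ds de.
move: (window_lmgf n a x) (window_lmgf n (a + t) x) (window_lmgf n (a - t) x).
move: (match_prob _ _ _ _ _ _) => Q v1 v2 v3.
have e1 : t * (n%:R * D') = n%:R * (t * D') by ring.
have e2 : t * (n%:R * eta) = n%:R * (t * eta) by ring.
have e3 : n%:R * (t * (eta / 2)) = n%:R * (t * eta) / 2 by ring.
have e4 : n%:R * (- t * D') = - (n%:R * (t * D')) by ring.
have e5 : n%:R * (- t * (eta / 2)) = - (n%:R * (t * eta) / 2) by ring.
have e6 : n%:R * (t * eta / 8) = n%:R * (t * eta) / 8 by ring.
have e7 : n%:R * (2 * (t * eta / 8)) = n%:R * (t * eta) / 4 by field.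
have e8 : a * (n%:R * D') = n%:R * (a * D') by ring.
have e9 : a * (n%:R * eta) = n%:R * (a * eta) by ring.
have e10 : n%:R * (a * D' - a * eta) = n%:R * (a * D') - n%:R * (a * eta) by ring.
rewrite /s !mulrDr !mulrN e7 ?e10 e8 e9 e1 e2 e3 e4 e5 e6 [n%:R * (eps / 2)]mulrA.
move: (n%:R * (a * D')) (n%:R * (a * eta)) (n%:R * eps) (n%:R * Lam a) (n%:R * del)
  (n%:R * (t * D')) (n%:R * (t * eta)) (n%:R * Lam (a + t)) (n%:R * Lam (a - t)).
move=> x1 x2 x3 x4 x5 x6 x7 x8 x9 l1 u1 l2 u2 l3 u3 up' dn' big big2 ds de H.
apply: le_trans (H _ _); [rewrite ler_expR|..]; lra.
Unshelve. all: by end_near. Qed.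

Definition block_sum k e m x y : R := \sum_(j < m)
  psum rho x y (1 + (j * (k + e))%N%:Z) (1 + (j * (k + e))%N%:Z) k.

Lemma block_sum_ge0 k e m x y : 0 <= block_sum k e m x y.
Proof. by apply: sumr_ge0 => j _; exact: psum_ge0. Qed.

Lemma measurable_block_sum k e m x :
  measurable_fun setT (fun w => block_sum k e m x (path Y w)).
Proof. by apply: measurable_sum => j; exact: measurable_psum_path. Qed.

Lemma block_has_mgf k e m a x b :
  (forall y (i : int), expR (a * psum rho x y i i k) <= b) ->
  has_mgf P (fun w => block_sum k e m x (path Y w)) a.
Proof.
move=> ab; have b0 : 0 <= b by apply: le_trans (ab point 1); exact: expR_ge0.
apply: (@bounded_integrable _ _ _ P _ (b ^+ m)).
  by apply: measurable_exp; exact: measurable_block_sum.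
move=> w; rewrite ger0_norm ?expR_ge0 // /block_sum mulr_sumr expR_sum.
rewrite -[X in b ^+ X]card_ord -prodr_const; apply: ler_prod => j _.
by rewrite expR_ge0 ab.
Qed.

(** The exponential of a block sum is a product over spaced windows, so mixing
    costs a factor [c] per window. *)
Lemma block_lmgf c e k m a x b : 0 < c -> mixing P Y c e ->
  (forall y (i : int), expR (a * psum rho x y i i k) <= b) ->
  `|lmgf P (fun w => block_sum k e m x (path Y w)) a -
    \sum_(j < m) window_lmgf k a (shiftz (j * (k + e))%N%:Z x)| <= m%:R * ln c.
Proof.
move=> c0 Ymix ab.
pose start (j : nat) : int := 1 + (j * (k + e))%N%:Z.
pose f (j : nat) (y : int -> T2) := expR (a * psum rho x y (start j) (start j) k).
have mf j : measurable_fun setT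
    (f j : pathType [set i | start j <= i < start j + k%:Z] -> R).
  apply: measurable_exp; apply: measurable_psum_right => // l lk /=.
  by rewrite lerDl ltrD2l ltz_nat lk.
have fb j y : 0 <= f j y <= b by rewrite expR_ge0 ab.
have := mixing_blocks c0 Ymix m mf fb.
have iE (j : nat) : has_mgf P (fun w => psum rho x (path Y w) (start j) (start j) k) a.
  apply: (@bounded_integrable _ _ _ P _ b).
    by apply: measurable_exp; exact: measurable_psum_path.
  by move=> w; rewrite ger0_norm ?expR_ge0.
have Ef j : \int[P]_w f j (path Y w) = expR (window_lmgf k a (shiftz (j * (k + e))%N%:Z x)).
  rewrite -[LHS]/(mgf P (fun w => psum rho x (path Y w) (start j) (start j) k) a).
  rewrite -(expR_lmgf (iE j)) psum_lmgf.
  by rewrite /start [1 + _]addrC addrK.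
under eq_bigr do rewrite Ef.
rewrite -expR_sum.
have -> : \int[P]_w (\prod_(j < m) f j (path Y w)) =
    expR (lmgf P (fun w => block_sum k e m x (path Y w)) a).
  rewrite expR_lmgf; last exact: block_has_mgf ab.
  by apply: eq_Rintegral => w _; rewrite /block_sum mulr_sumr expR_sum.
have -> : c ^+ m = expR (m%:R * ln c) by rewrite expRM_natl lnK.
rewrite -expRN -!expRD !ler_expR => /andP[lo hi].
by rewrite ler_norml lerBrDr lo lerBlDr hi.
Qed.

End windows.

Section lmgf_image.
Context {d d' : measure_display} {Omega : measurableType d}
  {T : measurableType d'} {R : realType}.

Lemma lmgf_image (mu : probability Omega R) (nu : probability T R)
    (phi : Omega -> T) (h : T -> R) a : measurable_fun setT phi ->
  (forall E, measurable E -> mu (phi @^-1` E) = nu E) -> measurable_fun setT h ->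
  lmgf mu (h \o phi) a = lmgf nu h a.
Proof.
move=> mphi muphi mh; rewrite /lmgf /mgf /Rintegral; congr (ln (fine _)).
apply: (ge0_integral_image mphi muphi (h := fun y => (expR (a * h y))%:E)).
  by apply/measurable_EFinP; exact: measurable_exp.
by move=> y; rewrite lee_fin expR_ge0.
Qed.

End lmgf_image.

(** * Independent letters *)

Lemma exponent_arith (R : realFieldType) (u v eps x1 x2 x3 x4 : R) :
  x1 <= x2 -> - x1 * 4 <= eps -> v + (x3 - x4) <= u ->
  - (x4 - v + eps) <= u - (x3 - x2 - x2) - eps / 2.
Proof. by move=> *; lra. Qed.

Section independent_letters.
Context {d1 d2 d : measure_display} {T1 : measurableType d1}
  {T2 : measurableType d2} {R : realType} (rho : T1 -> T2 -> R).
Hypothesis rho_ge0 : forall x y, 0 <= rho x y.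
Hypothesis mrho : measurable_fun setT (fun z : T1 * T2 => rho z.1 z.2).
Context {Omega : measurableType d} (P : probability Omega R).
Variables (X : int -> {mfun Omega >-> T1}) (Y : int -> {mfun Omega >-> T2}).
Hypotheses (sX : stationary P X) (eX : ergodic P X).
Hypotheses (sY : stationary P Y) (Ymix : mixing P Y 1 0).
Local Notation p := (distribution P (X 1)).
Local Notation q := (distribution P (Y 1)).
Hypothesis int_rho : (\int[p \x q]_z (rho z.1 z.2)%:E < +oo)%E.
Local Notation Lam := (mean_lmgf p q rho).

Lemma window_lmgf1 a x : window_lmgf rho P Y 1 a x = lmgf q (rho (x 1)) a.
Proof.
have mY : measurable_fun setT (Y 1) by exact: measurable_funPT.
have m := measurableT_comp mrho (pair1_measurable (x 1)).
have e : (fun w => psum rho x (path Y w) 1 1 1) = rho (x 1) \o Y 1.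
  by apply/funext => w; rewrite /psum big_ord1 /= !addr0.
rewrite /window_lmgf e.
exact: (@lmgf_image _ _ _ _ _ P q (Y 1) (rho (x 1)) a mY (fun E _ => erefl) m).
Qed.

(** With [c = 1] the two bounds of [block_lmgf] coincide. *)
Lemma window_lmgf_sum n a x : a <= 0 ->
  window_lmgf rho P Y n a x = \sum_(i < n) window_lmgf rho P Y 1 a (shiftz i%:Z x).
Proof.
move=> a0.
have ab y (i : int) : expR (a * psum rho x y i i 1) <= 1.
  by rewrite -[leRHS](@expR0 R) ler_expR mulr_le0_ge0 // psum_ge0.
have := block_lmgf mrho sY n ltr01 Ymix ab.
rewrite ln1 mulr0 normr_le0 subr_eq0 => /eqP h.
rewrite -[RHS](_ : \sum_(j < n) window_lmgf rho P Y 1 a (shiftz (j * (1 + 0))%N%:Z x) = _); last first.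
  by apply: eq_bigr => j _; rewrite muln1.
rewrite -h; congr (lmgf P _ a); apply/funext => w.
by apply: eq_bigr => j _; rewrite /psum big_ord1 muln1 addr0.
Qed.

Lemma window_lmgf_cvg a : a <= 0 -> {ae P, forall w,
  n%:R^-1 * window_lmgf rho P Y n a (path X w) @[n --> \oo] --> Lam a}.
Proof.
move=> a0.
have i1 := lmgf_integrable mrho rho_ge0 int_rho a0.
have mX : measurable_fun setT (X 1) by exact: measurable_funPT.
have e1 w : lmgf q (rho (X 1 w)) a = window_lmgf rho P Y 1 a (path X w).
  by rewrite window_lmgf1.
have iw : P.-integrable setT (fun w => (window_lmgf rho P Y 1 a (path X w))%:E).
  have := integrable_image (mu := P) (nu := p) mX (fun E _ => erefl) i1.
  by apply: eq_integrable => // w _; rewrite e1.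
have := birkhoff sX eX (measurable_window_lmgf mrho P Y 1 a) iw.
apply: filterS => w cw.
rewrite (_ : Lam a = \int[P]_w window_lmgf rho P Y 1 a (path X w)).
  by under eq_fun do rewrite window_lmgf_sum //.
rewrite /mean_lmgf /Rintegral -(integral_image (mu := P) (nu := p) mX (fun E _ => erefl) i1).
by congr fine; apply: eq_integral => w' _; rewrite e1.
Qed.

Variable D : R.
Hypothesis DavD : (D%:E < \int[p \x q]_z (rho z.1 z.2)%:E)%E.
Hypothesis finite_rate : exists2 k : R, k < 0 & - Lam k < - k * D.
Variable a : R.
Hypotheses (a0 : a < 0) (aD : mean_tilt p q rho a = D).

(** The log-moments are ergodic averages, with limit [Lam]. Chernoff's bound at [a]
    is one half; the other is [match_prob_lower] at a tilt [a'] of mean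
    [D' = D - del], so that the window around [D'] stays below [D]. The tilt is
    bounded by [maximizer_ge], so the loss in the exponent is of order [del]. *)
Theorem iid_match_prob (eps : R) : 0 < eps -> {ae P, forall w, \forall n \near \oo,
  expR (- (n%:R * (a * D - Lam a + eps))) <= match_prob rho P Y D n (path X w) <=
  expR (- (n%:R * (a * D - Lam a - eps)))}.
Proof.
move=> eps0; have [k k0 kD] := finite_rate.
(* [finite_rate] still holds at level [D - del] when [del < gap] *)
pose gap := D - Lam k / k.
have gap0 : 0 < gap.
  rewrite /gap; move: kD; move: (mean_lmgf p q rho k) => u kD.
  by rewrite subr_gt0 ltr_ndivrMr // -ltrN2 mulrC -mulNr.
pose del := Num.min (gap / 2) (eps / (- k * 4)).
have nk0 : 0 < - k by rewrite oppr_gt0.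
have del0 : 0 < del by rewrite lt_min !divr_gt0 // mulr_gt0.
have delg : del <= gap / 2 by rewrite ge_min lexx.
have dele : del * (- k * 4) <= eps.
  by rewrite -ler_pdivlMr ?mulr_gt0 // ge_min lexx orbT.
pose D' := D - del.
have kD' : - Lam k < - k * D'.
  move: gap0 delg; rewrite /D' /gap; move: (mean_lmgf p q rho k) => u gap0 delg.
  have : u / k < D - del by move: (u / k) gap0 delg => z; lra.
  by rewrite ltr_ndivrMr // mulrC mulNr ltrN2.
have D'av : (D'%:E < \int[p \x q]_z (rho z.1 z.2)%:E)%E.
  by apply: lt_trans DavD; rewrite lte_fin /D'; lra.
have [a' a'0 a'D] := mean_tilt_eq mrho rho_ge0 int_rho (ex_intro2 _ _ k k0 kD') D'av.
have ka' : k <= a'.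
  apply: (maximizer_ge mrho rho_ge0 int_rho k0 _ a'0 a'D).
  by move: kD'; rewrite mulNr ltrN2.
have cmt := continuous_mean_tilt mrho rho_ge0 int_rho a'0.
have [t [t0 at0 up dn]] : exists t : R, [/\ 0 < t, a' + t < 0,
    mean_tilt p q rho (a' + t) <= D' + del / 2 &
    D' - del / 2 <= mean_tilt p q rho (a' - t)].
  have d20 : 0 < del / 2 by rewrite divr_gt0.
  have [r /= r0 hr] : nbhs a' [set b | `|D' - mean_tilt p q rho b| < del / 2].
    by rewrite -a'D; move/cvgrPdist_lt : cmt => /(_ _ d20).
  exists (Num.min (r / 2) (- a' / 2)).
  set t := Num.min _ _.
  have t0 : 0 < t by rewrite lt_min !divr_gt0 ?oppr_gt0.
  have tr : t < r by rewrite gt_min ltr_pdivrMr // mulr_natr mulr2n ltrDr r0.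
  have ta : t <= - a' / 2 by rewrite ge_min lexx orbT.
  have h1 : `|D' - mean_tilt p q rho (a' + t)| < del / 2.
    by apply: hr => /=; rewrite opprD addNKr normrN gtr0_norm.
  have h2 : `|D' - mean_tilt p q rho (a' - t)| < del / 2.
    by apply: hr => /=; rewrite opprB addrCA subrr addr0 gtr0_norm.
  have h0 : a' + t < 0.
    rewrite -ltrBrDl sub0r; apply: le_lt_trans ta _.
    by rewrite ltr_pdivrMr // ltr_pMr ?oppr_gt0 // ltr1n.
  split; [exact: t0|exact: h0| |].
    by move: h1; rewrite ltr_distlC => /andP[_ /ltW].
  by move: h2; rewrite ltr_distlC => /andP[/ltW].
have at2 : a' - t < 0 by rewrite subr_lt0 (lt_trans a'0).
have up' : Lam (a' + t) - Lam a' <= t * (D' + del / 2).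
  have := mean_lmgf_tangent mrho rho_ge0 int_rho at0 (ltW a'0).
  rewrite opprD addNKr; move: up; rewrite -(ler_pM2l t0).
  move: (mean_lmgf _ _ _ _) (mean_lmgf _ _ _ _) (mean_tilt _ _ _ _) => u v s.
  rewrite mulNr => h h'; rewrite lerBlDr -lerBlDl.
  by apply: le_trans h'; rewrite lerB.
have dn' : Lam (a' - t) - Lam a' <= - t * (D' - del / 2).
  have := mean_lmgf_tangent mrho rho_ge0 int_rho at2 (ltW a'0).
  rewrite opprB addrCA subrr addr0; move: dn; rewrite -(ler_pM2l t0).
  move: (mean_lmgf _ _ _ _) (mean_lmgf _ _ _ _) (mean_tilt _ _ _ _) => u v s.
  rewrite mulNr => h h'; rewrite lerBlDl -lerBlDr opprK.
  by apply: le_trans h'; rewrite lerD.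
have e20 : 0 < eps / 2 by rewrite divr_gt0.
have c0 := window_lmgf_cvg (ltW a0).
have c1 := window_lmgf_cvg (ltW a'0).
pose cv b w := n%:R^-1 * window_lmgf rho P Y n b (path X w) @[n --> \oo] --> Lam b.
have c2 : {ae P, forall w, cv (a' + t) w /\ cv (a' - t) w}.
  apply: filterS2 (window_lmgf_cvg (ltW at0)) (window_lmgf_cvg (ltW at2)) => w h1 h2.
  by split; [exact: h1|exact: h2].
apply: filterS3 c0 c1 c2 => w cw0 cw1 [cw2 cw3].
have cw b : b \in [:: a'; a' + t; a' - t] ->
    n%:R^-1 * window_lmgf rho P Y n b (path X w) @[n --> \oo] --> Lam b.
  by rewrite !inE => /or3P[] /eqP ->; [exact: cw1|exact: cw2|exact: cw3].
have lo := match_prob_lower rho_ge0 mrho (ltW a'0) t0 (ltW at0) del0 up' dn' cw e20.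
have hi := match_prob_upper rho_ge0 mrho D (ltW a0) cw0 eps0.
have bound : - (a * D - Lam a + eps) <= Lam a' - a' * (D' - del) - eps / 2.
  have := mean_lmgf_tangent mrho rho_ge0 int_rho a0 (ltW a'0).
  rewrite aD; move: (mean_lmgf _ _ _ _) (mean_lmgf _ _ _ _) => u v.
  have h1 : k * del <= a' * del by rewrite ler_pM2r.
  have h2 : - (k * del) * 4 <= eps by rewrite -mulNr -mulrA mulrCA.
  rewrite /D' !mulrBr mulrBl.
  move: h1 h2; exact: exponent_arith.
apply: filterS2 lo hi => n lo hi.
rewrite hi andbT; move: lo; rewrite /D' subrK; apply: le_trans.
by rewrite ler_expR -mulrN ler_wpM2l.
Qed.

End independent_letters.

(** * Almost additive sequences *)
Section almost_additive.
Variables (R : realType) (u : nat -> R) (K : R).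
Hypothesis uK : forall n m, `|u (n + m)%N - u n - u m| <= K.

Let K0 : 0 <= K.
Proof. exact: le_trans (normr_ge0 _) (uK 0 0). Qed.

Let multiples j n : `|u (j.+1 * n)%N - j.+1%:R * u n| <= j.+1%:R * K.
Proof.
elim: j => [|j ih]; first by rewrite !mul1n !mul1r subrr normr0.
rewrite mulSn -[j.+2%:R]natr1 !mulrDl !mul1r.
have -> : u (n + j.+1 * n)%N - (j.+1%:R * u n + u n) =
    (u (n + j.+1 * n)%N - u n - u (j.+1 * n)%N) + (u (j.+1 * n)%N - j.+1%:R * u n).
  by ring.
by rewrite addrC (le_trans (ler_normD _ _)) // lerD.
Qed.

Let cross k n : (u k.+1 - K) / k.+1%:R <= (u n.+1 + K) / n.+1%:R.
Proof.
rewrite ler_pdivrMr // mulrAC ler_pdivlMr //.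
have h1 := multiples n k.+1; have h2 := multiples k n.+1.
rewrite mulnC in h2; move: h1 h2; rewrite !ler_norml => /andP[h1 _] /andP[_ h2].
rewrite !mulrDl mulNr; move: h1 h2.
rewrite [u k.+1 * _]mulrC [u n.+1 * _]mulrC [K * n.+1%:R]mulrC [K * k.+1%:R]mulrC; lra.
Qed.

(** Fekete's lemma with a rate: [u (k * n)] is within [k * K] of [k * u n] and
    within [n * K] of [n * u k], so the intervals [(u n - K) / n, (u n + K) / n]
    meet pairwise. *)
Lemma almost_additive : exists L : R, forall n, `|u n - n%:R * L| <= K.
Proof.
pose A := [set (u k.+1 - K) / k.+1%:R | k in setT].
have hA : has_sup A.
  split; first by exists ((u 1%N - K) / 1%:R); exists 0%N.
  by exists ((u 1%N + K) / 1%:R) => _ [k _ <-]; exact: cross.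
exists (sup A) => -[|n].
  by have := uK 0 0; rewrite addn0 mul0r subr0 subrr sub0r normrN.
have lo : (u n.+1 - K) / n.+1%:R <= sup A.
  by apply: ub_le_sup; [exact: hA.2|exists n].
have hi : sup A <= (u n.+1 + K) / n.+1%:R.
  by apply: ge_sup; [exact: hA.1|move=> _ [k _ <-]; exact: cross].
move: lo hi; rewrite ler_pdivrMr // ler_pdivlMr // [sup A * _]mulrC.
by rewrite ler_norml => lo hi; apply/andP; split; lra.
Qed.

End almost_additive.

(** * Log-moments of windows under mixing *)

Lemma scaled_dist (R : realFieldType) (n k l g eps : R) : 0 < n -> 0 < k ->
  `|n * (k * l) - k * g| <= n * (k * eps) -> `|l - n^-1 * g| <= eps.
Proof.
move=> n0 k0; have -> : n * (k * l) - k * g = n * (k * (l - n^-1 * g)).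
  by rewrite !mulrBr [k * (n^-1 * g)]mulrCA mulVKf ?gt_eqF.
by rewrite (normrM n) (normrM k) (gtr0_norm n0) (gtr0_norm k0) !ler_pM2l.
Qed.

Lemma unscaled_dist (R : realFieldType) (n m s z : R) : 0 < n ->
  `|m - n^-1 * s| <= z -> `|n * m - s| <= n * z.
Proof.
move=> n0; have -> : n * m - s = n * (m - n^-1 * s).
  by rewrite mulrBr mulVKf ?gt_eqF.
by rewrite normrM gtr0_norm // ler_pM2l.
Qed.

Lemma sum_telescope_window (R : realFieldType) (g : nat -> R) k n :
  \sum_(j < k) g (n + j)%N - \sum_(j < k) g j = \sum_(j < n) (g (j + k)%N - g j).
Proof.
elim: n => [|n ih]; first by rewrite big_ord0 subrr.
rewrite big_ord_recr /= -ih.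
have : \sum_(j < k.+1) g (n + j)%N = \sum_(j < k.+1) g (n + j)%N by [].
rewrite {1}big_ord_recl big_ord_recr /= addn0 => h.
have h' : \sum_(j < k) g (n.+1 + j)%N = \sum_(j < k) g (n + j)%N + g (n + k)%N - g n.
  rewrite -h addrC addKr; by apply: eq_bigr => j _; rewrite addSnnS.
by rewrite h'; ring.
Qed.

Lemma Rintegral_near (d : measure_display) (T : measurableType d) (R : realType)
    (P : probability T R) (F G H : T -> R) (K : R) :
  P.-integrable setT (EFin \o F) -> P.-integrable setT (EFin \o G) ->
  P.-integrable setT (EFin \o H) -> (forall w, `|F w - G w - H w| <= K) ->
  `|\int[P]_w F w - \int[P]_w G w - \int[P]_w H w| <= K.
Proof.
move=> iF iG iH FGH.
have iFG : P.-integrable setT (EFin \o (fun w => F w - G w)).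
  have := integrableB measurableT iF iG.
  by apply: eq_integrable => // w _; rewrite /= EFinB.
have iFGH : P.-integrable setT (EFin \o (fun w => F w - G w - H w)).
  have := integrableB measurableT iFG iH.
  by apply: eq_integrable => // w _; rewrite /= EFinB.
rewrite -RintegralB // -RintegralB // ler_norml.
rewrite -[X in X <= _ <= _](Rintegral_cst1 P) -[X in _ <= _ <= X](Rintegral_cst1 P).
apply/andP; split; apply: le_Rintegral => //; try exact: integrable_cst.
  by move=> w _; have := FGH w; rewrite ler_norml => /andP[].
by move=> w _; have := FGH w; rewrite ler_norml => /andP[].
Qed.

Lemma average_arith (R : realFieldType) (s v u g z K C : R) :
  `|v - s| <= z / 4 -> `|g - s| <= K + C -> `|v - u| <= K -> C <= z / 4 ->
  K * 4 <= z -> `|u - g| <= z.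
Proof.
rewrite !ler_norml => /andP[? ?] /andP[? ?] /andP[? ?] ? ?.
by apply/andP; split; lra.
Qed.

Section mixing_windows.
Context {d1 d2 d : measure_display} {T1 : measurableType d1}
  {T2 : measurableType d2} {R : realType} (rho : T1 -> T2 -> R) (M : R).
Hypothesis rho_ge0 : forall x y, 0 <= rho x y.
Hypothesis rho_le : forall x y, rho x y <= M.
Hypothesis mrho : measurable_fun setT (fun z : T1 * T2 => rho z.1 z.2).
Context {Omega : measurableType d} (P : probability Omega R).
Variable Y : int -> {mfun Omega >-> T2}.
Hypothesis sY : stationary P Y.
Implicit Types (x : int -> T1) (y : int -> T2) (n m k : nat).
Local Notation S1 := (pathType (T := T1) setT).
Local Notation Lw := (window_lmgf rho P Y).
Local Notation dist := (psum rho).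

Let M0 : 0 <= M.
Proof. exact: le_trans (rho_ge0 point point) (rho_le _ _). Qed.

Lemma psum_le x y (i j : int) n : dist x y i j n <= n%:R * M.
Proof.
rewrite /dist mulr_natl -[X in _ *+ X]card_ord -sumr_const.
by apply: ler_sum => k _.
Qed.

Lemma psum_bounds x y (i j : int) n : 0 <= dist x y i j n <= n%:R * M.
Proof. by rewrite psum_ge0 // psum_le. Qed.

Let mps := measurable_psum_path mrho Y.

Lemma window_lmgf_le_mono n a b x : a <= b -> b <= 0 ->
  Lw n a x <= Lw n b x.
Proof.
move=> ab b0; apply: (lmgf_mono (mps x 1 1 n)) => //.
- by move=> w; exact: psum_ge0.
- exact: (psum_has_mgf rho_ge0 mrho P Y x 1 1 n (le_trans ab b0)).
- exact: (psum_has_mgf rho_ge0 mrho P Y x 1 1 n b0).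
Qed.

(** The distortion of the [m] appended letters lies between [0] and [m * M]. *)
Lemma window_lmgf_extend n m a x : a <= 0 ->
  Lw n a x + a * (m%:R * M) <= Lw (n + m) a x <= Lw n a x.
Proof.
move=> a0; rewrite /window_lmgf; apply: (lmgf_shift P (mps x 1 1 n) (mps x 1 1 (n + m))) => //.
  by move=> w; exact: psum_ge0.
move=> w; rewrite psumD; have /andP[h1 h2] := psum_bounds x (path Y w) (1 + n%:Z) (1 + n%:Z) m.
by rewrite lerDl h1 lerD2l h2.
Qed.

Lemma window_lmgf0 a x : Lw 0 a x = 0.
Proof.
rewrite /window_lmgf (_ : (fun w => _) = cst 0); last first.
  by apply/funext => w; rewrite /psum big_ord0.
rewrite /lmgf (_ : mgf _ _ _ = 1) ?ln1 //.
by rewrite /mgf /=; under eq_Rintegral do rewrite mulr0; rewrite expR0 Rintegral_cst1.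
Qed.

Lemma window_lmgf_bounds n a x : a <= 0 -> a * (n%:R * M) <= Lw n a x <= 0.
Proof.
move=> a0; have := window_lmgf_extend 0 n x a0.
by rewrite add0n window_lmgf0 add0r.
Qed.

Section gap.
Variables (c : R) (e : nat).
Hypotheses (c1 : 1 <= c) (Ymix : mixing P Y c e).

Let c0 : 0 < c. Proof. exact: lt_le_trans c1. Qed.
Let lnc0 : 0 <= ln c. Proof. exact: ln_ge0. Qed.

Lemma window_pair n m a x (i := (n + e)%N%:Z) : a <= 0 ->
  `|lmgf P (fun w => dist x (path Y w) 1 1 n + dist x (path Y w) (1 + i) (1 + i) m) a
    - (Lw n a x + Lw m a (shiftz i x))| <= ln c.
Proof.
move=> a0.
pose f (y : int -> T2) := expR (a * dist x y 1 1 n).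
pose g (y : int -> T2) := expR (a * dist x y (1 + i) (1 + i) m).
have mf : measurable_fun setT (f : pathType [set j : int | j <= n%:Z] -> R).
  apply: measurable_exp; apply: measurable_psum_right => //.
have mg : measurable_fun setT (g : pathType [set j : int | n%:Z + e.+1%:Z <= j] -> R).
  apply: measurable_exp; apply: measurable_psum_right => // l lk /=.
  rewrite /i; lia.
have fb y : 0 <= f y <= 1.
  by rewrite expR_ge0 -[leRHS](@expR0 R) ler_expR mulr_le0_ge0 // psum_ge0.
have gb y : 0 <= g y <= 1.
  by rewrite expR_ge0 -[leRHS](@expR0 R) ler_expR mulr_le0_ge0 // psum_ge0.
have := mixing_integral c0 Ymix mf mg fb gb.
have hf := psum_has_mgf rho_ge0 mrho P Y x 1 1 n a0.
have hg := psum_has_mgf rho_ge0 mrho P Y x (1 + i) (1 + i) m a0.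
have -> : \int[P]_w f (path Y w) = expR (Lw n a x).
  by rewrite expR_lmgf.
have -> : \int[P]_w g (path Y w) = expR (Lw m a (shiftz i x)).
  rewrite -[LHS]/(mgf P (fun w => dist x (path Y w) (1 + i) (1 + i) m) a).
  by rewrite -(expR_lmgf hg) (psum_lmgf mrho sY) [1 + i]addrC addrK.
have -> : \int[P]_w (f (path Y w) * g (path Y w)) = expR (lmgf P (fun w =>
    dist x (path Y w) 1 1 n + dist x (path Y w) (1 + i) (1 + i) m) a).
  rewrite expR_lmgf; last first.
    apply: has_mgf_le0 => //; first by apply: measurable_funD; exact: mps.
    by move=> w; rewrite addr_ge0 // psum_ge0.
  by apply: eq_Rintegral => w _; rewrite /f /g -expRD mulrDr.
have cE : c = expR (ln c) by rewrite lnK.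
rewrite {1 2}cE -expRN -!expRD !ler_expR => /andP[lo hi].
by rewrite ler_norml lerBrDr lo lerBlDr hi.
Qed.

(** The factor [c] of mixing, and the distortion of [e] letters. *)
Definition gap_cost a := ln c - a * (e%:R * M).

(** Remove the first [e] letters of the second window: this costs at most
    [- a * (e * M)], and the two windows become almost independent. *)
Lemma window_additive n m a x : a <= 0 ->
  `|Lw (n + m) a x - Lw n a x - Lw m a (shiftz n%:Z x)|
    <= gap_cost a.
Proof.
move=> a0; have aM i : a * (i%:R * M) <= 0 by rewrite mulr_le0_ge0 // mulr_ge0.
have [em|me] := leqP e m; last first.
  have h1 := window_lmgf_extend n m x a0.
  have h2 := window_lmgf_bounds m (shiftz n%:Z x) a0.
  have h3 : a * (e%:R * M) <= a * (m%:R * M).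
    by rewrite ler_wnM2l // ler_wpM2r // ler_nat ltnW.
  move: h1 h2 h3 (aM e); rewrite /gap_cost.
  move: (Lw _ _ _) (Lw _ _ _) (Lw _ _ _) (a * _) (a * _) (ln c) lnc0.
  move=> v1 v2 v3 v4 v5 v6 lnc /andP[h1 h1'] /andP[h2 h2'] h3 h4.
  by rewrite ler_norml; apply/andP; split; lra.
rewrite -(subnKC em); set m' := (m - e)%N.
have h1 := window_pair n m' x a0.
have h2 : lmgf P (fun w => dist x (path Y w) 1 1 n +
      dist x (path Y w) (1 + (n + e)%N%:Z) (1 + (n + e)%N%:Z) m') a + a * (e%:R * M) <=
    Lw (n + (e + m')) a x <= lmgf P (fun w => dist x (path Y w) 1 1 n +
      dist x (path Y w) (1 + (n + e)%N%:Z) (1 + (n + e)%N%:Z) m') a.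
  apply: lmgf_shift => //.
  - by apply: measurable_funD; exact: mps.
  - by move=> w; rewrite addr_ge0 // psum_ge0.
  move=> w; rewrite addnA !psumD.
  have := psum_bounds x (path Y w) (1 + n%:Z) (1 + n%:Z) e.
  move: (dist _ _ _ _ _) (dist _ _ _ _ _) (dist _ _ _ _ _) => u1 u2 u3 /andP[? ?].
  by apply/andP; split; lra.
have h3 : Lw m' a (shiftz (n + e)%N%:Z x) + a * (e%:R * M) <=
    Lw (e + m') a (shiftz n%:Z x) <= Lw m' a (shiftz (n + e)%N%:Z x).
  have -> : shiftz (n + e)%N%:Z x = shiftz (1 + e%:Z - 1) (shiftz n%:Z x).
    by rewrite shiftzD [1 + _]addrC addrK -PoszD addnC.
  rewrite -(psum_lmgf mrho sY _ _ (1 + e%:Z)).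
  rewrite /window_lmgf; apply: lmgf_shift => //.
  - by move=> w; exact: psum_ge0.
  move=> w; rewrite psumD.
  have := psum_bounds (shiftz n%:Z x) (path Y w) 1 1 e.
  move: (dist _ _ _ _ _) (dist _ _ _ _ _) => u1 u2 /andP[? ?].
  by apply/andP; split; lra.
move: h1 h2 h3; rewrite /gap_cost.
move: (Lw _ _ _) (Lw _ _ _) (Lw _ _ _) (Lw _ _ _)
  (lmgf _ _ _) (a * _) (ln c).
move=> v1 v2 v3 v4 v5 v6 v7; rewrite !ler_norml => /andP[? ?] /andP[? ?] /andP[? ?].
by apply/andP; split; lra.
Qed.

(** By [window_additive], the log-moment of a short window at position [i] is the
    increment [Lw (i + k) - Lw i], up to [gap_cost]; the sum over [i] telescopes to
    about [k * Lw n]. This makes the log-moment of a long window an ergodic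
    average. *)
Lemma window_average k n a x : a <= 0 ->
  `|k%:R * Lw n a x - \sum_(i < n) Lw k a (shiftz i%:Z x)|
    <= n%:R * gap_cost a + 2 * (k%:R * (- a * (k%:R * M))).
Proof.
move=> a0; pose g n := Lw n a x.
pose B n := \sum_(j < k) g (n + j)%N.
have Bsum i : B i - B 0%N = \sum_(j < i) (g (j + k)%N - g j).
  exact: sum_telescope_window.
have s0 : 0 <= - a * (k%:R * M) by rewrite !mulr_ge0 // oppr_ge0.
have Bnear i : `|B i - k%:R * g i| <= k%:R * (- a * (k%:R * M)).
  rewrite /B [k%:R * g i]mulr_natl -[X in _ *+ X]card_ord -sumr_const -sumrB.
  apply: le_trans (ler_norm_sum _ _ _) _.
  rewrite [leRHS]mulr_natl -[X in _ *+ X]card_ord -sumr_const; apply: ler_sum => j _.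
  have /andP[h1 h2] := window_lmgf_extend i j x a0.
  have h3 : a * (k%:R * M) <= a * (j%:R * M).
    by rewrite ler_wnM2l // ler_wpM2r // ler_nat ltnW.
  move: h1 h2 h3; rewrite mulNr -/(g i) -/(g (i + j)%N).
  move: (g _) (g _) (a * _) (a * _) => *.
  by rewrite ler_norml; apply/andP; split; lra.
have diff : `|(B n - B 0%N) - \sum_(i < n) Lw k a (shiftz i%:Z x)| <= n%:R * gap_cost a.
  rewrite Bsum -sumrB; apply: le_trans (ler_norm_sum _ _ _) _.
  rewrite [leRHS]mulr_natl -[X in _ *+ X]card_ord -sumr_const; apply: ler_sum => i _.
  exact: window_additive.
have B0 := Bnear 0%N; rewrite {1}/g window_lmgf0 mulr0 subr0 in B0.
have Bn := Bnear n; move: diff B0 Bn; rewrite -/(g n).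
move: (B n) (B 0%N) (k%:R * g n) (k%:R * _) (\sum_(i < n) _) (n%:R * _).
move=> v1 v2 v3 v4 v5 v6; rewrite !ler_norml => /andP[? ?] /andP[? ?] /andP[? ?].
by apply/andP; split; lra.
Qed.

End gap.

Variable X : int -> {mfun Omega >-> T1}.
Hypotheses (sX : stationary P X) (eX : ergodic P X).

Definition mean_window n a : R := \int[P]_w Lw n a (path X w).

Let window_bounded n a x : a <= 0 -> `|Lw n a x| <= - a * (n%:R * M).
Proof.
by move=> /window_lmgf_bounds => /(_ n x) /andP[h1 h2]; rewrite ler0_norm // mulNr lerN2.
Qed.

Let window_integrable n a (phi : Omega -> S1) : a <= 0 -> measurable_fun setT phi ->
  P.-integrable setT (EFin \o (fun w => Lw n a (phi w))).
Proof.
move=> a0 mphi; apply: (@bounded_integrable _ _ _ P _ (- a * (n%:R * M))) => [|w]; last first.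
  exact: window_bounded.
exact: (measurableT_comp (measurable_window_lmgf mrho P Y n a)).
Qed.

Let mX : measurable_fun setT (path X : Omega -> S1).
Proof. exact: measurable_path. Qed.

Let mshift (i : int) : measurable_fun setT (fun w => shiftz i (path X w) : S1).
Proof. exact: measurableT_comp (@measurable_shiftz _ T1 i setT setT (fun _ _ => I)) mX. Qed.

Let mean_window_shiftz n a (i : int) : a <= 0 ->
  \int[P]_w Lw n a (shiftz i (path X w)) = mean_window n a.
Proof.
move=> a0.
have ih : (path_law P X).-integrable setT (fun x : S1 => (Lw n a x)%:E).
  apply: (@bounded_integrable _ _ _ (path_law P X) _ (- a * (n%:R * M))) => [|w].
    exact: measurable_window_lmgf.
  exact: window_bounded.
have e1 : (\int[P]_w (Lw n a (shiftz i (path X w)))%:E =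
    \int[path_law P X]_x (Lw n a x)%:E)%E.
  apply: (integral_image (mu := P) (nu := path_law P X) (mshift i) _ ih).
  by move=> E mE; exact: (stationary_shiftz i sX mE).
have e2 : (\int[P]_w (Lw n a (path X w))%:E = \int[path_law P X]_x (Lw n a x)%:E)%E.
  exact: (integral_image (mu := P) (nu := path_law P X) mX (fun E _ => erefl) ih).
exact: (congr1 fine (etrans e1 (esym e2))).
Qed.

Lemma mean_window_bounds n a : a <= 0 -> a * (n%:R * M) <= mean_window n a <= 0.
Proof.
move=> a0; have i0 := window_integrable n a0 mX.
rewrite -[X in X <= _ <= _](Rintegral_cst1 P) -[X in _ <= _ <= X](Rintegral_cst1 P).
apply/andP; split; apply: le_Rintegral => //; try exact: integrable_cst.
  by move=> w _; have /andP[] := window_lmgf_bounds n (path X w) a0.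
by move=> w _; have /andP[] := window_lmgf_bounds n (path X w) a0.
Qed.

Section rates.
Variables (c : R) (e : nat).
Hypotheses (c1 : 1 <= c) (Ymix : mixing P Y c e).

Lemma mean_window_additive n m a : a <= 0 ->
  `|mean_window (n + m) a - mean_window n a - mean_window m a| <= gap_cost c e a.
Proof.
move=> a0; rewrite -(mean_window_shiftz m n%:Z a0).
have i0 k := window_integrable k a0 mX.
have i1 := window_integrable m a0 (mshift n%:Z).
apply: (Rintegral_near (i0 _) (i0 _) i1) => w.
exact: (window_additive c1 Ymix n m (path X w) a0).
Qed.

(** [gap_cost] does not depend on the lengths, so [almost_additive] gives a rate
    of convergence, used to compare finite blocks with their limit. *)
Lemma mean_window_rate : exists L : R -> R, forall a, a <= 0 ->
  forall n, `|mean_window n a - n%:R * L a| <= gap_cost c e a.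
Proof.
have /choice[L HL] : forall a : R, exists l : R, a <= 0 ->
    forall n, `|mean_window n a - n%:R * l| <= gap_cost c e a.
  move=> a; have [a0|a0] := leP a 0; last by exists 0.
  have [l hl] := almost_additive (fun n m => mean_window_additive n m a0).
  by exists l.
by exists L.
Qed.

Variable L : R -> R.
Hypothesis meanL : forall a, a <= 0 ->
  forall n, `|mean_window n a - n%:R * L a| <= gap_cost c e a.

(** Birkhoff's theorem for windows of a fixed large length [k], transferred to
    long windows by [window_average] at the cost [gap_cost / k] per letter. *)
Theorem window_lmgf_rate a : a <= 0 -> {ae P, forall w,
  n%:R^-1 * Lw n a (path X w) @[n --> \oo] --> L a}.
Proof.
move=> a0.
have bk k := birkhoff sX eX (measurable_window_lmgf mrho P Y k a).
have {}bk k : {ae P, forall w, n%:R^-1 *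
     \sum_(i < n) Lw k a (shiftz i%:Z (path X w)) @[n --> \oo] --> mean_window k a}.
  exact: bk _ (window_integrable k a0 mX).
apply: filterS (ae_foralln bk) => w {}bk; apply/cvgrPdist_le => eps eps0.
set K := gap_cost c e a.
have K0 : 0 <= K by have := window_additive c1 Ymix 0 0 (path X w) a0; apply: le_trans.
pose k := (Num.truncn (4 * K / eps)).+1.
have k0 : 0 < k%:R :> R by rewrite ltr0n.
have Kk : K * 4 <= eps * k%:R.
  by rewrite mulrC [eps * _]mulrC -ler_pdivrMr // ltW // truncnS_gt.
pose C := 2 * (k%:R * (- a * (k%:R * M))).
have ek0 : 0 < k%:R * eps / 4 by rewrite divr_gt0 // mulr_gt0.
move/cvgrPdist_le : (bk k) => /(_ _ ek0) bkk.
near=> n.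
have n0 : (0 < n%:R :> R) by rewrite ltr0n; near: n; exists 1%N.
have h1 : `|mean_window k a - n%:R^-1 * \sum_(i < n) Lw k a (shiftz i%:Z (path X w))| <=
  k%:R * eps / 4 by near: n.
have hC : C <= n%:R * (k%:R * eps / 4).
  by rewrite -ler_pdivrMr //; near: n; exact: nbhs_infty_ger.
have h2 := window_average c1 Ymix k n (path X w) a0.
have h3 := meanL a0 k.
apply: (scaled_dist n0 k0).
have h1' : `|n%:R * mean_window k a - \sum_(i < n) Lw k a (shiftz i%:Z (path X w))| <=
    n%:R * (k%:R * eps / 4) by exact: unscaled_dist h1.
have h3' : `|n%:R * mean_window k a - n%:R * (k%:R * L a)| <= n%:R * K.
  by rewrite -mulrBr normrM gtr0_norm // ler_pM2l.
have Kn : n%:R * K * 4 <= n%:R * (eps * k%:R) by rewrite -mulrA ler_pM2l.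
move: h1' h2 h3' hC Kn; rewrite -/K -/C.
rewrite (_ : n%:R * (k%:R * eps / 4) = n%:R * (k%:R * eps) / 4); last by ring.
rewrite [eps * k%:R]mulrC.
exact: average_arith.
Unshelve. all: by end_near. Qed.

End rates.

End mixing_windows.

(** * Lower tails of almost independent sums *)
Section tilt_arithmetic.
Variable R : realFieldType.

(* The tilt [t = eta / (4 b^2)] balances the gain [t * eta] per term against the
   second-order term [2 * (t * b)^2]; the gain exceeds the mixing cost [lnc]. *)
Lemma tilt_arith (m b eta lnc u v G S : R) :
  0 < m -> 0 < b -> 0 < eta ->
  lnc * (32 * b ^+ 2) <= eta ^+ 2 -> 2 * (16 * b ^+ 2) <= m * eta ^+ 2 ->
  S - m * lnc <= u ->
  v <= S + G + m * (2 * (eta / (4 * b ^+ 2) * b) ^+ 2) + m * lnc ->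
  v - u - (G + eta / (4 * b ^+ 2) * (m * eta)) <= - 2.
Proof.
move=> m0 b0 e0 hc hm hu hv.
have b2 : 0 < b ^+ 2 by rewrite exprn_gt0.
pose z := m * eta ^+ 2 / b ^+ 2.
have e1 : m * (2 * (eta / (4 * b ^+ 2) * b) ^+ 2) = z / 8.
  by rewrite /z; field; rewrite gt_eqF.
have e2 : eta / (4 * b ^+ 2) * (m * eta) = z / 4.
  by rewrite /z; field; rewrite gt_eqF.
have z1 : m * lnc <= z / 32.
  rewrite /z -[_ / b ^+ 2 / 32]mulrA -invfM ler_pdivlMr ?mulr_gt0 //.
  by rewrite -mulrA ler_pM2l // [b ^+ 2 * _]mulrC.
have z2 : 2 * 16 <= z by rewrite /z ler_pdivlMr // -mulrA.
by rewrite e1 in hv; rewrite e2; lra.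
Qed.

Lemma norm_upper (x y z w : R) : `|x - y| <= z -> y <= w -> x <= w + z.
Proof. by rewrite ler_norml => /andP[? ?] ?; lra. Qed.

Lemma norm_lower (x y z : R) : `|x - y| <= z -> y - z <= x.
Proof. by rewrite ler_norml => /andP[? ?]; lra. Qed.

End tilt_arithmetic.

(** The setting: [h] behaves like the sum of [m] bounded independent variables, up
    to a factor in exponential moments that is small per variable. *)
Section almost_independent_sum.
Context {d : measure_display} {T : measurableType d} {R : realType}
  (q : probability T R) (m : nat) (f : 'I_m -> T -> R) (h : T -> R) (b lnc : R).
Hypotheses (m_gt0 : (0 < m)%N) (b_gt0 : 0 < b).
Hypothesis mf : forall j, measurable_fun setT (f j).
Hypothesis f_bounds : forall j y, 0 <= f j y <= b.
Hypothesis mh : measurable_fun setT h.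
Hypothesis h_has_mgf : forall a, has_mgf q h a.
Let G a := \sum_(j < m) lmgf q (f j) a.
Let G' a := \sum_(j < m) tilted_mean q (f j) a.
Hypothesis lmgf_h : forall a, `|lmgf q h a - G a| <= m%:R * lnc.

Let has_tilt_f j a : has_tilt q (f j) a.
Proof. exact: has_tilt_bounded (mf j) (f_bounds j). Qed.

Let mean_continuous : continuous G'.
Proof.
have ind (r : seq 'I_m) : continuous (fun a => \sum_(j <- r) tilted_mean q (f j) a).
  elim: r => [|j r ih] a.
    rewrite (_ : (fun _ => _) = cst 0); first exact: cvg_cst.
    by apply/funext => b'; rewrite big_nil.
  rewrite (_ : (fun a => _) = fun a => tilted_mean q (f j) a + \sum_(i <- r) tilted_mean q (f i) a); last first.
    by apply/funext => b'; rewrite big_cons.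
  apply: cvgD; last exact: ih.
  exact: continuous_tilted_mean_bounded (mf j) (f_bounds j).
exact: ind.
Qed.

Let G_tangent a : G a <= a * G' a.
Proof.
rewrite /G /G' mulr_sumr; apply: ler_sum => j _.
have [i2 _] := has_tilt_f j 0.
by have := lmgf_tangent (has_tilt_f j a) i2; rewrite lmgf0 sub0r mulNr subr_le0.
Qed.

Let G_quadratic a t : `|t| * b <= 1/2 ->
  G (a + t) <= G a + t * G' a + m%:R * (2 * (t * b) ^+ 2).
Proof.
move=> ht; rewrite [m%:R * _]mulr_natl -[X in _ *+ X]card_ord -sumr_const.
rewrite /G /G' mulr_sumr -!big_split /=; apply: ler_sum => j _.
exact: lmgf_quadratic.
Qed.

Variables (kap s eta : R).
Hypotheses (kap_gt0 : 0 < kap) (eta_gt0 : 0 < eta) (eta_le : eta <= 2 * b).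
Hypothesis hkap : - kap * s + m%:R * lnc <= lmgf q h (- kap).
Hypothesis hc : lnc * (32 * b ^+ 2) <= eta ^+ 2.
Hypothesis hm : 2 * (16 * b ^+ 2) <= m%:R * eta ^+ 2.

(* The tilt at which the tilted mean of the sum is [s], or [0] if the mean is
   already below [s]; [hkap] bounds it from below by [- kap]. *)
Let centring_tilt : exists a, [/\ - kap <= a, a <= 0, G' a <= s & a * G' a = a * s].
Proof.
have nk0 : - kap <= 0 by rewrite oppr_le0 ltW.
have [le0|gt0] := leP (G' 0) s.
  by exists 0; split; rewrite ?mul0r.
have Gk : G' (- kap) <= s.
  rewrite -(ler_nM2l (_ : - kap < 0)) ?oppr_lt0 //.
  apply: le_trans (G_tangent (- kap)); rewrite -(lerD2r (m%:R * lnc)).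
  by apply: le_trans hkap _; rewrite -lerBlDl; apply: le_trans (ler_norm _) (lmgf_h _).
have hs : Num.min (G' (- kap)) (G' 0) <= s <= Num.max (G' (- kap)) (G' 0).
  by rewrite ge_min Gk /= le_max (ltW gt0) orbT.
have [a] := IVT nk0 (continuous_subspaceT mean_continuous) hs.
rewrite in_itv /= => /andP[ka a0] Ga; exists a; split => //; by rewrite Ga.
Qed.

(** Tilt so as to centre the sum at [s]; then [tilted_lower_half] applies with
    [lo] and [hi] at distance [m * eta] from the tilted mean, since the variance
    per term is bounded by [b^2] and [lnc] is small against [(eta / b)^2]. *)
Lemma almost_independent_tail : exists a, [/\ - kap <= a, a <= 0 &
  expR (lmgf q h a - a * (s - m%:R * eta) - 1) <= fine (q [set y | h y <= s + m%:R * eta])].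
Proof.
have [a [ka a0 Ga aG]] := centring_tilt; exists a; split => //.
have mR : 0 < m%:R :> R by rewrite ltr0n.
pose t := eta / (4 * b ^+ 2).
have b2 : 0 < b ^+ 2 by rewrite exprn_gt0.
have t0 : 0 < t by rewrite divr_gt0 // mulr_gt0.
have tb : t * b <= 1/2.
  have -> : t * b = eta / (4 * b) by rewrite /t; field; rewrite gt_eqF.
  rewrite ler_pdivrMr ?mulr_gt0 //; apply: le_trans eta_le _.
  by rewrite mulrA ler_pM2r //; lra.
have up : lmgf q h (a + t) - lmgf q h a - t * (G' a + m%:R * eta) <= - 2.
  have q1 : `|t| * b <= 1/2 by rewrite gtr0_norm.
  rewrite mulrDr; apply: (tilt_arith (S := G a) mR b_gt0 eta_gt0 hc hm).
    exact: norm_lower (lmgf_h a).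
  exact: norm_upper (lmgf_h _) (G_quadratic a q1).
have dn : lmgf q h (a - t) - lmgf q h a + t * (G' a - m%:R * eta) <= - 2.
  have q1 : `|- t| * b <= 1/2 by rewrite normrN gtr0_norm.
  have -> : t * (G' a - m%:R * eta) = - (- t * G' a + t * (m%:R * eta)).
    by rewrite mulrBr mulNr opprD opprK.
  apply: (tilt_arith (S := G a) mR b_gt0 eta_gt0 hc hm).
    exact: norm_lower (lmgf_h a).
  have := norm_upper (lmgf_h _) (G_quadratic a q1).
  by rewrite [- t * b]mulNr sqrrN.
have := tilted_lower_half mh a0 (ltW t0) (h_has_mgf _) (h_has_mgf _) (h_has_mgf _) up dn.
rewrite mulrBr aG -mulrBr => tail; apply: le_trans tail _.
have ms z : measurable [set y | h y <= z].
  by rewrite -[X in measurable X]setTI; apply: measurable_fun_ler.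
rewrite fine_le ?fin_num_measure //; try exact: ms.
apply: le_measure; rewrite ?inE; try exact: ms.
by move=> y /= hy; rewrite (le_trans hy) // lerD2r.
Qed.

End almost_independent_sum.

Section block_lower_bound.
Context {d1 d2 d : measure_display} {T1 : measurableType d1}
  {T2 : measurableType d2} {R : realType} (rho : T1 -> T2 -> R) (M : R).
Hypothesis rho_ge0 : forall x y, 0 <= rho x y.
Hypothesis rho_le : forall x y, rho x y <= M.
Hypothesis M_gt0 : 0 < M.
Hypothesis mrho : measurable_fun setT (fun z : T1 * T2 => rho z.1 z.2).
Context {Omega : measurableType d} (P : probability Omega R).
Variable Y : int -> {mfun Omega >-> T2}.
Hypothesis sY : stationary P Y.
Implicit Types (x : int -> T1) (y : int -> T2) (n m k : nat).
Local Notation Lw := (window_lmgf rho P Y).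
Local Notation dist := (psum rho).
Local Notation blocks := (block_sum rho).

Lemma block_sum_le k e m x y :
  blocks k e m x y <= dist x y 1 1 (m * (k + e)) <= blocks k e m x y + m%:R * (e%:R * M).
Proof.
elim: m => [|m /andP[h1 h2]].
  by rewrite /block_sum /psum !big_ord0 mul0r addr0 lexx.
rewrite mulSn addnC !psumD /block_sum big_ord_recr /= -/(blocks k e m x y).
have /andP[h3 h4] := psum_bounds rho_ge0 rho_le x y (1 + (m * (k + e))%N%:Z + k%:Z)
  (1 + (m * (k + e))%N%:Z + k%:Z) e.
rewrite -[m.+1%:R]natr1 mulrDl mul1r; move: h1 h2 h3 h4.
move: (blocks k e m x y) (dist _ _ _ _ _) (dist _ _ _ _ _) (dist _ _ _ _ _) (_ * M) (_ * _).
by move=> u1 u2 u3 u4 u5 u6 *; apply/andP; split; lra.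
Qed.

Section tilting.
Variables (c : R) (e k m : nat).
Hypotheses (c1 : 1 <= c) (Ymix : mixing P Y c e) (k0 : (0 < k)%N) (m0 : (0 < m)%N).
Variable x : int -> T1.

Let c0 : 0 < c. Proof. exact: lt_le_trans c1. Qed.
Let bk (j : 'I_m) w := dist x (path Y w) (1 + (j * (k + e))%N%:Z) (1 + (j * (k + e))%N%:Z) k.
Let h w := blocks k e m x (path Y w).

Let mbk j : measurable_fun setT (bk j).
Proof. exact: measurable_psum_path. Qed.

Let bk_bounds j w : 0 <= bk j w <= k%:R * M.
Proof. exact: psum_bounds. Qed.

Let exp_bound a y (i : int) : expR (a * dist x y i i k) <= expR (`|a| * (k%:R * M)).
Proof.
rewrite ler_expR; apply: le_trans (ler_norm _) _; rewrite normrM ler_wpM2l //.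
have /andP[h1 h2] := psum_bounds rho_ge0 rho_le x y i i k.
by rewrite ger0_norm.
Qed.

Let h_has_mgf a : has_mgf P h a.
Proof. exact: block_has_mgf (exp_bound a). Qed.

Let lmgf_h a : `|lmgf P h a - \sum_(j < m) lmgf P (bk j) a| <= m%:R * ln c.
Proof.
have := block_lmgf mrho sY m c0 Ymix (exp_bound a).
have -> : \sum_(j < m) lmgf P (bk j) a = \sum_(j < m) Lw k a (shiftz (j * (k + e))%N%:Z x).
  apply: eq_bigr => j _.
  by rewrite /bk (psum_lmgf mrho sY) [1 + _]addrC addrK.
exact.
Qed.

Variables (kap D' eta : R).
Hypotheses (kap0 : 0 < kap) (eta0 : 0 < eta) (etaM : eta <= 2 * M).
Hypothesis hkap : - kap * (m%:R * (k%:R * D')) + m%:R * ln c <= Lw (m * (k + e)) (- kap) x.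
Hypothesis hc : ln c * (32 * M ^+ 2) <= eta ^+ 2.
Hypothesis hm : 2 * (16 * M ^+ 2) <= m%:R * eta ^+ 2.

Let window_le_blocks a : a <= 0 -> Lw (m * (k + e)) a x <= lmgf P h a.
Proof.
move=> a0; have /andP[_] := @lmgf_shift _ _ _ P h
  (fun w => dist x (path Y w) 1 1 (m * (k + e))) (m%:R * (e%:R * M)) a
  (measurable_block_sum mrho Y k e m x) (measurable_psum_path mrho Y x 1 1 _)
  (fun w => block_sum_ge0 rho_ge0 k e m x (path Y w))
  (fun w => block_sum_le k e m x (path Y w)) a0.
exact.
Qed.

(** The tilt depends on the path [x], as the mean distortion of its windows is not
    fixed. Omitting the gaps decreases the distortion, so the log-moment of the
    whole window is a lower bound for that of the blocks. *)
Lemma block_tail : exists a, [/\ - kap <= a, a <= 0 &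
  expR (Lw (m * (k + e)) a x - a * (m%:R * (k%:R * (D' - eta))) - 1) <=
  fine (P [set w | blocks k e m x (path Y w) <= m%:R * (k%:R * (D' + eta))])].
Proof.
have kR : 0 < k%:R :> R by rewrite ltr0n.
have k2 : 0 < k%:R ^+ 2 :> R by rewrite exprn_gt0.
have nk0 : - kap <= 0 by rewrite oppr_le0 ltW.
have b0 : 0 < k%:R * M by rewrite mulr_gt0.
have ke0 : 0 < k%:R * eta by rewrite mulr_gt0.
have ke2 : k%:R * eta <= 2 * (k%:R * M) by rewrite mulrCA ler_pM2l.
have hc' : ln c * (32 * (k%:R * M) ^+ 2) <= (k%:R * eta) ^+ 2.
  by rewrite !exprMn ![_ * (k%:R ^+ 2 * _)]mulrCA ler_pM2l.
have hm' : 2 * (16 * (k%:R * M) ^+ 2) <= m%:R * (k%:R * eta) ^+ 2.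
  by rewrite !exprMn ![_ * (k%:R ^+ 2 * _)]mulrCA ler_pM2l.
have mh : measurable_fun setT h by exact: measurable_block_sum.
have [a [ka a0 H]] := almost_independent_tail m0 b0 mbk bk_bounds mh h_has_mgf lmgf_h
  kap0 ke0 ke2 (le_trans hkap (window_le_blocks nk0)) hc' hm'.
exists a; split; [exact: ka|exact: a0|].
have -> : m%:R * (k%:R * (D' - eta)) = m%:R * (k%:R * D') - m%:R * (k%:R * eta) by ring.
have -> : m%:R * (k%:R * (D' + eta)) = m%:R * (k%:R * D') + m%:R * (k%:R * eta) by ring.
apply: le_trans H; rewrite ler_expR lerD2r lerD2r.
exact: window_le_blocks.
Qed.

End tilting.

End block_lower_bound.

(** * Matching probabilities under mixing *)

Lemma near_finite (Q : nat -> nat -> Prop) N :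
  (forall i, (i < N)%N -> \forall n \near \oo, Q i n) ->
  \forall n \near \oo, forall i, (i < N)%N -> Q i n.
Proof.
elim: N => [|N ih] h; first exact: nearW.
have h1 := ih (fun i iN => h i (ltnW iN)); have h2 := h N (ltnSn N).
apply: filterS2 h1 h2 => n h1 h2 i; rewrite ltnS leq_eqVlt => /predU1P[->//|].
exact: h1.
Qed.

Section exponent_arithmetic.
Variable R : realFieldType.

(* The hypothesis [hkap] of [block_tail], for long blocks [k]. *)
Lemma kap_arith (m k e kap D g del e1 lnc l v : R) :
  0 <= m -> 0 <= k -> 0 <= e -> 0 < kap -> 0 <= g ->
  l = - kap * D + 2 * kap * g -> e1 <= kap * g -> del <= g / 4 ->
  kap * e * D + lnc <= k * (kap * g / 2) -> m * (k + e) * (l - e1) <= v ->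
  - kap * (m * (k * (D - 2 * del))) + m * lnc <= v.
Proof.
move=> m0 k0 e0 kap0 g0 -> he1 hdel hk; apply: le_trans.
rewrite (_ : - kap * _ + m * lnc = m * (lnc - kap * (k * (D - 2 * del)))); last by ring.
rewrite -mulrA ler_wpM2l //.
have h1 : (k + e) * (kap * g) <= (k + e) * (- kap * D + 2 * kap * g - e1 + kap * D).
  by rewrite ler_wpM2l ?addr_ge0 //; move: he1; rewrite -mulrA; lra.
have h2 : kap * (k * (2 * del)) <= kap * (k * (g / 2)).
  by rewrite ler_pM2l // ler_wpM2l //; lra.
have h3 : 0 <= e * (kap * g) by rewrite !mulr_ge0 // ltW.
move: h1 h2 h3 hk.
rewrite (_ : (k + e) * (- kap * D + 2 * kap * g - e1 + kap * D) =
  (k + e) * (- kap * D + 2 * kap * g - e1) + k * (kap * D) + kap * e * D); last by ring.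
rewrite (_ : (k + e) * (kap * g) = k * (kap * g) + e * (kap * g)); last by ring.
rewrite (_ : kap * (k * (g / 2)) = k * (kap * g) / 2); last by ring.
rewrite (_ : k * (kap * g / 2) = k * (kap * g) / 2); last by ring.
rewrite (_ : kap * (k * (D - 2 * del)) = k * (kap * D) - kap * (k * (2 * del))); last by ring.
move: (_ * (_ - e1)) (k * (kap * D)) (kap * (k * (2 * del))) (k * (kap * g))
  (e * (kap * g)) (kap * e * D).
by move=> *; lra.
Qed.

(* The exponent of [block_tail] for [D' = D - 2 del] and [eta = del], at a tilt [a]
   within [th] above the grid point [ai]; each source of error costs [eps / 8]. *)
Lemma exponent_lower (m k e n kap D I del th e1 eps a ai li vi v : R) :
  0 <= m -> 0 <= k -> 0 <= e -> 0 <= D -> 0 <= I -> 0 <= del -> 0 <= eps ->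
  - kap <= a -> a - th <= ai ->
  ai * D - I <= li -> m * (k + e) * (li - e1) <= vi -> vi <= v ->
  kap * e * D <= k * (eps / 8) -> 3 * kap * del <= eps / 8 -> th * D <= eps / 8 ->
  e1 <= eps / 8 ->
  m * (k + e) <= n + (k + e) -> (k + e) * (I + eps / 2) + 1 <= n * (eps / 2) ->
  - (n * (I + eps)) <= v - a * (m * (k * (D - 2 * del - del))) - 1.
Proof.
move=> m0 k0 e0 D0 I0 del0 eps0 ka ai_a hli hvi hv h1 h2 h3 h4 hB hn.
have mk0 : 0 <= m * k by rewrite mulr_ge0.
have B0 : 0 <= m * (k + e) by rewrite mulr_ge0 // addr_ge0.
have step1 : m * (k + e) * (a * D - th * D - I - e1) <= v.
  apply: le_trans hv; apply: le_trans hvi; rewrite ler_wpM2l //.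
  have : (a - th) * D <= ai * D by rewrite ler_wpM2r.
  by rewrite mulrBl; lra.
have s1 : - (m * k * (eps / 8)) <= m * (e * (a * D)).
  have : - kap * (e * D) <= a * (e * D) by rewrite ler_wpM2r // mulr_ge0.
  move=> h; rewrite -mulrA -mulrN ler_wpM2l //.
  by move: h h1; rewrite mulNr mulrCA mulrA => h h1; lra.
have s2 : - (m * k * (eps / 8)) <= m * k * (3 * del * a).
  rewrite -mulrN ler_wpM2l //.
  have : - kap * (3 * del) <= a * (3 * del) by rewrite ler_wpM2r // mulr_ge0.
  by move: h2; rewrite mulNr [a * _]mulrC (_ : kap * (3 * del) = 3 * kap * del); [lra|ring].
have s3 : m * k * (eps / 8) <= m * (k + e) * (eps / 8).
  by rewrite ler_wpM2r ?divr_ge0 // ler_wpM2l // lerDl.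
have s4 : m * (k + e) * (th * D) <= m * (k + e) * (eps / 8) by rewrite ler_wpM2l.
have s5 : m * (k + e) * e1 <= m * (k + e) * (eps / 8) by rewrite ler_wpM2l.
have s6 : m * (k + e) * (I + eps / 2) <= (n + (k + e)) * (I + eps / 2).
  by rewrite ler_wpM2r // addr_ge0 // divr_ge0.
have -> : a * (m * (k * (D - 2 * del - del))) = m * (k + e) * (a * D) - m * (e * (a * D))
    - m * k * (3 * del * a) by ring.
move: step1 s1 s2 s3 s4 s5 s6 hn; move: (m * (k + e)) => B; move: (k + e) => b.
have -> : B * (a * D - th * D - I - e1) = B * (a * D) - B * (th * D) - B * I - B * e1 by ring.
have -> : (n + b) * (I + eps / 2) = n * I + b * I + n * eps / 2 + b * (eps / 2) by ring.
have -> : b * (I + eps / 2) = b * I + b * (eps / 2) by ring.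
have -> : B * (I + eps / 2) = B * I + B * eps / 2 by ring.
have -> : n * (I + eps) = n * I + n * eps by ring.
have -> : n * (eps / 2) = n * eps / 2 by ring.
have -> : B * (eps / 8) = B * eps / 8 by ring.
move: (B * (a * D)) (m * (e * (a * D))) (m * k * (3 * del * a))
  (B * (th * D)) (B * I) (B * e1) (B * eps)
  (m * k * (eps / 8)) (n * I) (n * eps) (b * I) (b * (eps / 2)).
by move=> *; lra.
Qed.

(* The distortion of the gaps and of the incomplete last block fits in [del]. *)
Lemma match_arith (m k e n D del eM : R) : 0 <= m -> 0 <= e -> 0 <= D ->
  eM <= k * del / 2 -> m * (k + e) <= n + (k + e) ->
  (k + e) * D <= m * (k * del / 2) ->
  m * (k * (D - 2 * del + del)) + m * eM <= n * D.
Proof.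
move=> m0 e0 D0 h1 h2 h3.
have h4 : m * eM <= m * (k * del / 2) by rewrite ler_wpM2l.
have h5 : m * (k + e) * D <= (n + (k + e)) * D by rewrite ler_wpM2r.
have h6 : 0 <= m * e * D by rewrite !mulr_ge0.
move: h3 h4 h5 h6.
have -> : m * (k * del / 2) = m * k * del / 2 by ring.
have -> : m * (k + e) * D = m * k * D + m * e * D by ring.
have -> : (n + (k + e)) * D = n * D + (k + e) * D by ring.
have -> : m * (k * (D - 2 * del + del)) = m * k * D - m * k * del by ring.
move: (m * k * D) (m * e * D) (m * k * del) (n * D) ((k + e) * D) (m * eM).
by move=> *; lra.
Qed.

End exponent_arithmetic.

Section mixing_process.
Context {d1 d2 d : measure_display} {T1 : measurableType d1}
  {T2 : measurableType d2} {R : realType} (rho : T1 -> T2 -> R) (M : R).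
Hypothesis rho_ge0 : forall x y, 0 <= rho x y.
Hypothesis rho_le : forall x y, rho x y <= M.
Hypothesis M_gt0 : 0 < M.
Hypothesis mrho : measurable_fun setT (fun z : T1 * T2 => rho z.1 z.2).
Context {Omega : measurableType d} (P : probability Omega R).
Variable Y : int -> {mfun Omega >-> T2}.
Hypothesis sY : stationary P Y.
Implicit Types (x : int -> T1) (y : int -> T2) (n m k : nat).
Local Notation Lw := (window_lmgf rho P Y).
Local Notation dist := (psum rho).
Local Notation blocks := (block_sum rho).

Lemma match_prob_blocks (n m k e : nat) (s D : R) x : (n <= m * (k + e))%N ->
  s + m%:R * (e%:R * M) <= n%:R * D ->
  fine (P [set w | blocks k e m x (path Y w) <= s]) <= match_prob rho P Y D n x.
Proof.
move=> nm hs; have ms1 : measurable [set w | blocks k e m x (path Y w) <= s].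
  rewrite -[X in measurable X]setTI; apply: measurable_fun_ler => //.
  exact: measurable_block_sum.
have ms2 : measurable [set w | dist x (path Y w) 1 1 n <= n%:R * D].
  rewrite -[X in measurable X]setTI; apply: measurable_fun_ler => //.
  exact: measurable_psum_path.
rewrite /match_prob fine_le ?fin_num_measure //.
apply: le_measure; rewrite ?inE // => w /= hw; apply: le_trans hs.
have /andP[_ h2] := block_sum_le rho_ge0 rho_le k e m x (path Y w).
apply: (@le_trans _ _ (dist x (path Y w) 1 1 (m * (k + e)))).
  by rewrite -(subnKC nm) psumD lerDl psum_ge0.
by apply: (le_trans h2); rewrite lerD2r.
Qed.

Hypothesis mixing_all : forall c : R, 1 < c -> exists e, mixing P Y c e.
Variables (L : R -> R) (D kap I : R).
Hypotheses (D_ge0 : 0 <= D) (kap_gt0 : 0 < kap) (I_ge0 : 0 <= I).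
Hypothesis L_kap : - kap * D < L (- kap).
Hypothesis I_ub : forall a, - kap <= a -> a <= 0 -> a * D - L a <= I.

(** Apply [block_tail] to long blocks with gaps. The mixing factor is chosen first,
    close to [1]; it fixes the gap [e], and then blocks of length [k >> e] make the
    gaps negligible. The tilt of [block_tail] depends on [x], so the log-moments are
    controlled on a finite grid, which suffices as they are monotone in the
    tilt. *)
Lemma mixing_match_prob_lower (eps : R) : 0 < eps ->
  exists (N : nat) (grid : nat -> R), (forall i, grid i <= 0) /\
  forall x, (forall i, (i < N)%N ->
      n%:R^-1 * Lw n (grid i) x @[n --> \oo] --> L (grid i)) ->
  \forall n \near \oo, expR (- (n%:R * (I + eps))) <= match_prob rho P Y D n x.
Proof.
move=> eps0.
pose g := (L (- kap) + kap * D) / (2 * kap).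
have g0 : 0 < g.
  by rewrite divr_gt0 ?mulr_gt0 // -ltrBlDr sub0r -mulNr.
have Lkg : L (- kap) = - kap * D + 2 * kap * g.
  by rewrite /g; field; rewrite gt_eqF.
pose del := Num.min (g / 4) (Num.min (eps / (24 * kap)) M).
have g40 : 0 < g / 4 by exact: divr_gt0.
have ek0 : 0 < eps / (24 * kap) by apply: divr_gt0 => //; exact: mulr_gt0.
have del0 : 0 < del by rewrite !lt_min M_gt0 g40 ek0.
have delg : del <= g / 4 by rewrite ge_min lexx.
have dele : 3 * kap * del <= eps / 8.
  have : del <= eps / (24 * kap) by rewrite !ge_min lexx orbT.
  rewrite ler_pdivlMr ?mulr_gt0 //.
  rewrite (_ : del * (24 * kap) = 8 * (3 * kap * del)); last by ring.
  by move: (3 * kap * del) => z hz; rewrite ler_pdivlMr // mulrC.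
have delM : del <= 2 * M.
  have : del <= M by rewrite !ge_min lexx !orbT.
  by move/le_trans; apply; rewrite ler_pMl // ler1n.
pose e1 := Num.min (kap * g) (eps / 8).
have kgp : 0 < kap * g by exact: mulr_gt0.
have e10 : 0 < e1 by rewrite lt_min kgp divr_gt0.
have e1g : e1 <= kap * g by rewrite ge_min lexx.
have e1e : e1 <= eps / 8 by rewrite ge_min lexx orbT.
pose N := (Num.truncn (8 * kap * D / eps)).+1.
have N0 : 0 < N%:R :> R by rewrite ltr0n.
pose th := kap / N%:R.
have th0 : 0 < th by rewrite divr_gt0.
have thD : th * D <= eps / 8.
  rewrite /th mulrAC ler_pdivrMr // mulrAC ler_pdivlMr // mulrAC mulrC mulrA.
  by rewrite [_ * 8]mulrC [D * kap]mulrC mulrA [eps * _]mulrC -ler_pdivrMr // ltW // truncnS_gt.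
(* the largest mixing factor that [block_tail] tolerates *)
pose c := expR (del ^+ 2 / (32 * M ^+ 2)).
have M2 : 0 < 32 * M ^+ 2 by rewrite mulr_gt0 // exprn_gt0.
have c1 : 1 < c by rewrite -[X in X < _]expR0 ltr_expR divr_gt0 // exprn_gt0.
have [e Ymix] := mixing_all c1.
have lncM : ln c * (32 * M ^+ 2) <= del ^+ 2.
  by rewrite /c expRK divfK ?gt_eqF.
pose grid (i : nat) := Num.min 0 (- kap + i%:R * th).
exists N.+1, grid; split=> [i|x cvL]; first by rewrite ge_min lexx.
have eM0 : 0 <= e%:R * M by rewrite mulr_ge0 // ltW.
have keD0 : 0 <= kap * e%:R * D by rewrite !mulr_ge0 // ltW.
have lnc0 : 0 <= ln c by rewrite ln_ge0 // ltW.
(* lower bounds on the block length *)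
pose k1 := 2 * (e%:R * M) / del.
pose k2 := (kap * e%:R * D + ln c) / (kap * g / 2).
pose k3 := kap * e%:R * D / (eps / 8).
have kg0 : 0 < kap * g / 2 by rewrite divr_gt0 // mulr_gt0.
have e80 : 0 < eps / 8 by rewrite divr_gt0.
have k10 : 0 <= k1 by rewrite divr_ge0 ?mulr_ge0 // ltW.
have k20 : 0 <= k2 by rewrite divr_ge0 ?addr_ge0 // ltW.
have k30 : 0 <= k3 by rewrite divr_ge0 // ltW.
pose k := (Num.truncn (k1 + k2 + k3)).+1.
have kk : k1 + k2 + k3 <= k%:R by rewrite ltW // truncnS_gt.
have hk1 : e%:R * M <= k%:R * del / 2.
  have : k1 <= k%:R by apply: le_trans kk; rewrite -addrA lerDl addr_ge0.
  by rewrite /k1 ler_pdivrMr // => h; rewrite ler_pdivlMr // mulrC.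
have hk2 : kap * e%:R * D + ln c <= k%:R * (kap * g / 2).
  have : k2 <= k%:R by apply: le_trans kk; rewrite addrAC lerDr addr_ge0.
  by rewrite /k2 ler_pdivrMr.
have hk3 : kap * e%:R * D <= k%:R * (eps / 8).
  have : k3 <= k%:R by apply: le_trans kk; rewrite lerDr addr_ge0.
  by rewrite /k3 ler_pdivrMr.
pose b := (k + e)%N.
have b0 : (0 < b)%N by [].
have kR : 0 < k%:R :> R by rewrite ltr0n.
have bR : b%:R = k%:R + e%:R :> R by rewrite natrD.
have [N1 _ HN1] : \forall n \near \oo, forall i, (i < N.+1)%N ->
    n%:R * (L (grid i) - e1) <= Lw n (grid i) x.
  apply: near_finite => i iN.
  have /cvgrPdist_le /(_ _ e10) := cvL i iN.
  have : \forall n \near \oo, (0 < n)%N by exists 1%N.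
  apply: filterS2 => n n0; rewrite ler_distlC => /andP[h _].
  by move: h; rewrite ler_pdivlMl // ltr0n.
near=> n.
pose m := (n %/ b).+1.
have nmb : (n <= m * b)%N by rewrite ltnW // ltn_ceil.
have mbn : (m * b <= n + b)%N by rewrite mulSn addnC leq_add2r leq_trunc_div.
have m0 : (0 < m)%N by [].
have mR : 0 < m%:R :> R by rewrite ltr0n.
have n1 : (N1 <= n)%N by near: n; exists N1.
have mlarge z : b%:R * z <= n%:R -> z <= m%:R.
  move=> h; have : b%:R * z <= m%:R * b%:R.
    by apply: le_trans h _; rewrite -natrM ler_nat.
  by rewrite mulrC ler_pM2r // ltr0n.
have hm1 : 2 * (16 * M ^+ 2) <= m%:R * del ^+ 2.
  rewrite -ler_pdivrMr ?exprn_gt0 //; apply: mlarge.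
  by near: n; exact: nbhs_infty_ger.
have hm2 : b%:R * D <= m%:R * (k%:R * del / 2).
  rewrite -ler_pdivrMr ?divr_gt0 ?mulr_gt0 //; apply: mlarge.
  by near: n; exact: nbhs_infty_ger.
have hn : b%:R * (I + eps / 2) + 1 <= n%:R * (eps / 2).
  by rewrite -ler_pdivrMr ?divr_gt0 //; near: n; exact: nbhs_infty_ger.
have HN := HN1 (m * b)%N (leq_trans n1 nmb).
have grid0 : grid 0%N = - kap.
  by rewrite /grid mul0r addr0 min_r // oppr_le0 ltW.
have hkap : - kap * (m%:R * (k%:R * (D - 2 * del))) + m%:R * ln c <= Lw (m * (k + e)) (- kap) x.
  apply: (kap_arith (e := e%:R) (ltW mR) (ltW kR) _ kap_gt0 (ltW g0) Lkg e1g delg hk2) => //.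
  have := HN 0%N (ltn0Sn _); rewrite grid0 natrM bR; exact.
have [a [ka a0 tail]] := block_tail rho_ge0 rho_le M_gt0 mrho sY (ltW c1) Ymix
  (ltn0Sn _ : (0 < k)%N) m0 kap_gt0 del0 delM hkap lncM hm1.
(* the grid point below the tilt *)
pose i := Num.truncn ((a + kap) / th).
have akth : 0 <= (a + kap) / th by rewrite divr_ge0 ?(ltW th0) // -lerBlDr sub0r.
have iN : (i < N.+1)%N.
  rewrite ltnS -(ler_nat R); apply: le_trans (_ : (a + kap) / th <= _).
    by rewrite truncn_le.
  by rewrite ler_pdivrMr // /th mulrC divfK ?gt_eqF // -lerBrDr subrr.
have i1 : i%:R * th <= a + kap by rewrite -ler_pdivlMr // truncn_le.
have i2 : a + kap <= (i%:R + 1) * th.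
  by rewrite -ler_pdivrMr // natr1 ltW // truncnS_gt.
have gridE : grid i = - kap + i%:R * th.
  by rewrite /grid min_r // addrC subr_le0 (le_trans i1) // gerDr.
have gi_a : grid i <= a by rewrite gridE addrC lerBlDr.
have a_gi : a - th <= grid i.
  by rewrite gridE; move: i2; rewrite mulrDl mul1r => i2; lra.
have gi_kap : - kap <= grid i by rewrite gridE lerDl mulr_ge0 // ltW.
have gi0 : grid i <= 0 by exact: le_trans a0.
have mbn' : m%:R * (k%:R + e%:R) <= n%:R + (k%:R + e%:R) :> R.
  by rewrite -bR -natrM -natrD ler_nat.
have hnD : m%:R * (k%:R * (D - 2 * del + del)) + m%:R * (e%:R * M) <= n%:R * D.
  by apply: (match_arith (ltW mR) (ler0n _ e) D_ge0 hk1 mbn'); rewrite -bR.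
apply: le_trans (match_prob_blocks x nmb hnD).
apply: le_trans tail; rewrite ler_expR.
have hLi : grid i * D - I <= L (grid i).
  by have := I_ub gi_kap gi0; rewrite lerBlDr lerBlDl addrC.
have hvi : m%:R * (k%:R + e%:R) * (L (grid i) - e1) <= Lw (m * (k + e)) (grid i) x.
  by have := HN i iN; rewrite natrM bR.
have hv := window_lmgf_le_mono rho_ge0 mrho P Y (m * (k + e)) x gi_a a0.
apply: (exponent_lower (I := I) (th := th) (ltW mR) (ltW kR) _ D_ge0 I_ge0 (ltW del0) (ltW eps0)
  ka a_gi hLi hvi hv hk3 dele thD e1e) => //.
by rewrite -bR.
Unshelve. all: by end_near. Qed.

End mixing_process.

Section mixing_rate.
Context {d1 d2 d : measure_display} {T1 : measurableType d1}
  {T2 : measurableType d2} {R : realType} (rho : T1 -> T2 -> R) (M : R).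
Hypothesis rho_ge0 : forall x y, 0 <= rho x y.
Hypothesis rho_le : forall x y, rho x y <= M.
Hypothesis M_gt0 : 0 < M.
Hypothesis mrho : measurable_fun setT (fun z : T1 * T2 => rho z.1 z.2).
Context {Omega : measurableType d} (P : probability Omega R).
Variables (X : int -> {mfun Omega >-> T1}) (Y : int -> {mfun Omega >-> T2}).
Hypotheses (sX : stationary P X) (eX : ergodic P X) (sY : stationary P Y).
Local Notation Lw := (window_lmgf rho P Y).
Local Notation mean := (mean_window rho P Y X).
Variables (c : R) (e : nat).
Hypotheses (c1 : 1 <= c) (Ymix : mixing P Y c e).
Variable L : R -> R.
Hypothesis meanL : forall a, a <= 0 ->
  forall n, `|mean n a - n%:R * L a| <= gap_cost M c e a.

Let lnc0 : 0 <= ln c. Proof. exact: ln_ge0. Qed.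

Let rate0 : L 0 = 0.
Proof.
apply/eqP/negP => /negP L0.
have h n : n%:R * `|L 0| <= ln c.
  have := meanL (lexx 0) n; have /andP[m1 m2] := mean_window_bounds rho_ge0 rho_le mrho P Y X n (lexx 0).
  have -> : mean n 0 = 0 by apply/eqP; rewrite eq_le m2; move: m1; rewrite mul0r.
  by rewrite sub0r normrN normrM normr_nat /gap_cost mul0r subr0.
have l0 : 0 < `|L 0| by rewrite normr_gt0.
have := h (Num.truncn (ln c / `|L 0|)).+1.
by rewrite -ler_pdivlMr // leNgt truncnS_gt.
Qed.

Variables (D kap : R).
Hypotheses (D_ge0 : 0 <= D) (kap_gt0 : 0 < kap).

Let values := [set a * D - L a | a in [set a | - kap <= a <= 0]].

(** The supremum may be restricted to a bounded range of tilts: for the levels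
    [D] considered, the maximising tilts lie above [- kap] ([maximizer_ge]). *)
Definition legendre_rate : R := sup values.
Local Notation I := legendre_rate.

Let cost_le a : - kap <= a -> gap_cost M c e a <= gap_cost M c e (- kap).
Proof.
by move=> ka; rewrite /gap_cost lerD2l lerN2 ler_wpM2r // mulr_ge0 // ltW.
Qed.

Let has_sup_values : has_sup values.
Proof.
split; first by exists (0 * D - L 0); exists 0 => //=; rewrite lexx oppr_le0 ltW.
exists (gap_cost M c e (- kap) + kap * M) => _ [a /= /andP[ka a0] <-].
have := meanL a0 1; have /andP[m1 m2] := mean_window_bounds rho_ge0 rho_le mrho P Y X 1 a0.
rewrite mul1r ler_norml => /andP[_ h1].
have h2 := cost_le ka.
have h3 : - kap * M <= a * M by rewrite ler_wpM2r // ltW.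
have h4 : a * D <= 0 by rewrite mulr_le0_ge0.
move: m1 h1 h2 h3 h4; rewrite mul1r mulNr.
by move: (gap_cost M c e a) (gap_cost M c e (- kap)) (mean 1%N a) (a * M) (kap * M) (a * D) (L a) => *; lra.
Qed.

Let I_ub a : - kap <= a -> a <= 0 -> a * D - L a <= I.
Proof.
by move=> ka a0; apply: ub_le_sup; [exact: has_sup_values.2|exists a => //=; rewrite ka].
Qed.

Lemma legendre_rate_ge0 : 0 <= I.
Proof.
have k0 : - kap <= 0 by rewrite oppr_le0 ltW.
by have := I_ub k0 (lexx 0); rewrite mul0r rate0 subrr.
Qed.

(** Finite-block rates are Legendre transforms of [mean n a / n], which is within
    [gap_cost / n] of [L a] uniformly over [- kap <= a <= 0]. *)
Theorem legendre_rate_cvg (r : nat -> R) :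
  (\forall n \near \oo, (exists a, [/\ - kap <= a, a <= 0 & r n = a * D - n%:R^-1 * mean n a]) /\
     (forall b, b <= 0 -> b * D - n%:R^-1 * mean n b <= r n)) ->
  r n @[n --> \oo] --> I.
Proof.
move=> hr; apply/cvgrPdist_le => eps eps0.
set K := gap_cost M c e (- kap).
have hK : \forall n \near \oo, K <= n%:R * eps.
  have : \forall n \near \oo, K / eps <= n%:R :> R by exact: nbhs_infty_ger.
  by apply: filterS => n; rewrite ler_pdivrMr.
have n1 : \forall n \near \oo, (0 < n)%N by exists 1%N.
apply: filterS3 hr hK n1 => n [[a [ka a0 ra]] rb] hK n0.
have nR : 0 < n%:R :> R by rewrite ltr0n.
have near_L b : - kap <= b -> b <= 0 -> `|n%:R^-1 * mean n b - L b| <= eps.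
  move=> kb b0; rewrite -(ler_pM2l nR) -[X in X * `|_| <= _]gtr0_norm // -normrM.
  rewrite mulrBr mulVKf ?gt_eqF //.
  exact: le_trans (meanL b0 n) (le_trans (cost_le kb) hK).
rewrite ler_norml; apply/andP; split.
  have := I_ub ka a0; have := near_L a ka a0; rewrite ra ler_norml => /andP[h1 h2] h3.
  move: h1 h2 h3; move: (n%:R^-1 * _) (a * D) (L a) I => u v w z *; lra.
rewrite lerBlDr; apply: ge_sup; first exact: has_sup_values.1.
move=> _ [b /= /andP[kb b0] <-].
have := rb b b0; have := near_L b kb b0; rewrite ler_norml => /andP[h1 h2] h3.
by move: h1 h2 h3; move: (n%:R^-1 * _) (b * D) (L b) (r n) => u v w z *; lra.
Qed.

Hypothesis mixing_all : forall c : R, 1 < c -> exists e, mixing P Y c e.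
Hypothesis L_kap : - kap * D < L (- kap).

(** The upper bound is Chernoff's at a nearly maximising tilt. *)
Theorem mixing_match_prob (eps : R) : 0 < eps -> {ae P, forall w, \forall n \near \oo,
  expR (- (n%:R * (I + eps))) <= match_prob rho P Y D n (path X w) <=
  expR (- (n%:R * (I - eps)))}.
Proof.
move=> eps0; have e20 : 0 < eps / 2 by rewrite divr_gt0.
have [N [grid [grid0 lower]]] := mixing_match_prob_lower rho_ge0 rho_le M_gt0 mrho sY
  mixing_all D_ge0 kap_gt0 legendre_rate_ge0 L_kap I_ub eps0.
have [_ [a /= /andP[ka a0] <-] aI] := sup_adherent e20 has_sup_values.
have cv b : b <= 0 -> {ae P, forall w, n%:R^-1 * Lw n b (path X w) @[n --> \oo] --> L b}.
  exact: (window_lmgf_rate rho_ge0 rho_le mrho sY sX eX c1 Ymix meanL).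
have cvgrid := ae_foralln (fun i => cv _ (grid0 i)).
apply: filterS2 cvgrid (cv a a0) => w cg ca.
have lo := lower (path X w) (fun i _ => cg i).
have up := match_prob_upper rho_ge0 mrho D a0 ca e20.
apply: filterS2 lo up => n lo up; rewrite lo /=; apply: le_trans up _.
rewrite ler_expR lerN2 ler_wpM2l //.
move: aI; rewrite -/I; move: (a * D - L a) => u aI.
by move: aI; rewrite /legendre_rate; move: (sup _) => z; lra.
Qed.

End mixing_rate.

(** * Rates of finite blocks *)
Section product_image.
Context {d d1 d2 : measure_display} {Omega : measurableType d}
  {S : measurableType d1} {T : measurableType d2} {R : realType}.
Variables (P : probability Omega R) (p : probability S R) (q : probability T R).
Variables (phi : Omega -> S) (psi : Omega -> T) (f : S -> T -> R).
Hypotheses (mphi : measurable_fun setT phi) (mpsi : measurable_fun setT psi).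
Hypothesis Pphi : forall E, measurable E -> P (phi @^-1` E) = p E.
Hypothesis Ppsi : forall E, measurable E -> P (psi @^-1` E) = q E.
Hypothesis mf : measurable_fun setT (fun z : S * T => f z.1 z.2).
Hypothesis f0 : forall x y, 0 <= f x y.

Lemma integral_prod_image :
  (\int[p \x q]_z (f z.1 z.2)%:E = \int[P]_w \int[P]_v (f (phi w) (psi v))%:E)%E.
Proof.
have mfE : measurable_fun setT (fun z : S * T => (f z.1 z.2)%:E) by exact/measurable_EFinP.
have f0E (z : S * T) : (0 <= (f z.1 z.2)%:E)%E by rewrite lee_fin.
rewrite (fubini_tonelli1 (fun z => (f z.1 z.2)%:E)) //.
have mF : measurable_fun setT (fubini_F q (fun z : S * T => (f z.1 z.2)%:E)).
  exact: (measurable_fun_fubini_tonelli_F (fun z => (f z.1 z.2)%:E)).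
have F0 x : (0 <= fubini_F q (fun z : S * T => (f z.1 z.2)%:E) x)%E.
  by apply: integral_ge0 => y _; rewrite lee_fin.
rewrite -(ge0_integral_image mphi Pphi mF F0).
apply: eq_integral => w _; rewrite /fubini_F /=.
rewrite -(ge0_integral_image mpsi Ppsi (h := fun y => (f (phi w) y)%:E)) //.
  exact: (measurableT_comp mfE (pair1_measurable (phi w))).
by move=> y; rewrite lee_fin.
Qed.

Hypothesis int_f : (\int[p \x q]_z (f z.1 z.2)%:E < +oo)%E.

Lemma mean_lmgf_image a : a <= 0 ->
  mean_lmgf p q f a = \int[P]_w lmgf P (fun v => f (phi w) (psi v)) a.
Proof.
move=> a0; have i1 := lmgf_integrable mf f0 int_f a0.
have e1 := integral_image (mu := P) (nu := p) mphi Pphi i1.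
rewrite /mean_lmgf /Rintegral -e1; congr fine.
apply: eq_integral => w _; congr EFin.
rewrite -(lmgf_image a mpsi Ppsi (h := f (phi w))) //.
exact: (measurableT_comp mf (pair1_measurable (phi w))).
Qed.

End product_image.

Lemma normalized_tangent (R : realFieldType) (n a b D u v : R) : 0 < n ->
  u + (b - a) * (n * D) <= v -> b * D - n^-1 * v <= a * D - n^-1 * u.
Proof.
move=> n0 h; rewrite lerBlDr -lerBlDl.
have -> : b * D - (a * D - n^-1 * u) = n^-1 * (u + (b - a) * (n * D)).
  by field; rewrite gt_eqF.
by rewrite ler_pM2l ?invr_gt0.
Qed.

Lemma mean_lmgf_scale (d1 d2 : measure_display) (S : measurableType d1)
    (T : measurableType d2) (R : realType) (p : probability S R) (q : probability T R)
    (f : S -> T -> R) (s a : R) :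
  mean_lmgf p q f (a * s) = mean_lmgf p q (fun x y => s * f x y) a.
Proof.
apply: eq_Rintegral => x _; congr ln; apply: eq_Rintegral => y _.
by rewrite mulrA.
Qed.

Section finite_blocks.
Context {d1 d2 d : measure_display} {T1 : measurableType d1}
  {T2 : measurableType d2} {R : realType} (rho : T1 -> T2 -> R).
Hypothesis rho_ge0 : forall x y, 0 <= rho x y.
Hypothesis mrho : measurable_fun setT (fun z : T1 * T2 => rho z.1 z.2).
Context {Omega : measurableType d} (P : probability Omega R).
Variables (X : int -> {mfun Omega >-> T1}) (Y : int -> {mfun Omega >-> T2}).
Hypotheses (sX : stationary P X) (sY : stationary P Y).
Local Notation mean := (mean_window rho P Y X).

Definition tsum n (x : n.-tuple T1) (y : n.-tuple T2) : R :=
  \sum_(i < n) rho (tnth x i) (tnth y i).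

Lemma tsum_ge0 n (x : n.-tuple T1) (y : n.-tuple T2) : 0 <= tsum x y.
Proof. by apply: sumr_ge0. Qed.

Lemma measurable_tsum n : measurable_fun setT
  (fun z : n.-tuple T1 * n.-tuple T2 => tsum z.1 z.2).
Proof.
apply: measurable_sum => i.
have m1 := measurableT_comp (@measurable_tnth _ T1 n i) (@measurable_fst _ _ (n.-tuple T1) (n.-tuple T2)).
have m2 := measurableT_comp (@measurable_tnth _ T2 n i) (@measurable_snd _ _ (n.-tuple T1) (n.-tuple T2)).
exact: (measurableT_comp mrho (measurable_fun_pair m1 m2)).
Qed.

Lemma tsum_block n w v : tsum (block X 1 n w) (block Y 1 n v) =
  psum rho (path X w) (path Y v) 1 1 n.
Proof. by apply: eq_bigr => i _; rewrite !tnth_mktuple. Qed.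

Let mbX n : measurable_fun setT (block X 1 n). Proof. exact: measurable_block. Qed.
Let mbY n : measurable_fun setT (block Y 1 n). Proof. exact: measurable_block. Qed.

Lemma stationary_coordinate (dT : measure_display) (T : measurableType dT)
    (Z : int -> {mfun Omega >-> T}) (i : int) E : stationary P Z -> measurable E ->
  P (Z (1 + i) @^-1` E) = distribution P (Z 1) E.
Proof.
move=> sZ mE; pose F : set (pathType (T := T) setT) := [set x | E (x 1)].
have mF : measurable F.
  rewrite -[F]setTI; exact: (@measurable_coord _ T setT 1 I measurableT E mE).
have := stationary_shiftz i sZ mF.
by rewrite /distribution /pushforward.
Qed.

Lemma integral_tsum n :
  (\int[law P X n \x law P Y n]_z (tsum z.1 z.2)%:E = n%:R%:E * D_av rho P X Y)%E.
Proof.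
rewrite (@integral_prod_image _ _ _ _ _ _ _ P (law P X n) (law P Y n) (block X 1 n) (block Y 1 n) _
  (@mbX n) (@mbY n) (fun _ _ => erefl) (fun _ _ => erefl)
  (@measurable_tsum n) (@tsum_ge0 n)).
have ms w i : measurable_fun setT (fun v => (rho (X (1 + i%:Z) w) (Y (1 + i%:Z) v))%:E).
  apply/measurable_EFinP; apply: measurableT_comp; last exact: measurable_funPT.
  exact: (measurableT_comp mrho (pair1_measurable _)).
have letter (i : nat) : (\int[P]_w \int[P]_v (rho (X (1 + i%:Z) w) (Y (1 + i%:Z) v))%:E =
    D_av rho P X Y)%E.
  rewrite /D_av.
  by rewrite (@integral_prod_image _ _ _ _ _ _ _ P (distribution P (X 1)) (distribution P (Y 1))
    (X (1 + i%:Z)) (Y (1 + i%:Z)) _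
    (measurable_funPT _) (measurable_funPT _) (fun E => @stationary_coordinate _ _ X i%:Z E sX)
    (fun E => @stationary_coordinate _ _ Y i%:Z E sY) mrho rho_ge0).
transitivity (\int[P]_w \sum_(i < n) \int[P]_v (rho (X (1 + i%:Z) w) (Y (1 + i%:Z) v))%:E)%E.
  apply: eq_integral => w _; rewrite -ge0_integral_sum //.
  - apply: eq_integral => v _; rewrite sumEFin; congr EFin.
    by apply: eq_bigr => i _; rewrite !tnth_mktuple.
  - by move=> i v _; rewrite lee_fin.
rewrite ge0_integral_sum //.
- under eq_bigr do rewrite letter.
  by rewrite sumr_const card_ord; exact/esym/mule_natl.
- move=> i.
  have mz : measurable_fun setT (fun z : Omega * Omega =>
      (rho (X (1 + i%:Z) z.1) (Y (1 + i%:Z) z.2))%:E).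
    have m1 := measurableT_comp (@measurable_funPT _ _ _ _ (X (1 + i%:Z)))
      (@measurable_fst _ _ Omega Omega).
    have m2 := measurableT_comp (@measurable_funPT _ _ _ _ (Y (1 + i%:Z)))
      (@measurable_snd _ _ Omega Omega).
    by apply/measurable_EFinP; exact: (measurableT_comp mrho (measurable_fun_pair m1 m2)).
  apply: (measurable_fun_fubini_tonelli_F (m2 := P) (fun z : Omega * Omega =>
      (rho (X (1 + i%:Z) z.1) (Y (1 + i%:Z) z.2))%:E)) => //.
  by move=> z; rewrite lee_fin.
- by move=> i w _; apply: integral_ge0 => v _; rewrite lee_fin.
Qed.

Hypothesis Dav_fin : (D_av rho P X Y < +oo)%E.

Let int_tsum n : (\int[law P X n \x law P Y n]_z (tsum z.1 z.2)%:E < +oo)%E.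
Proof.
rewrite integral_tsum; apply: lte_mul_pinfty; rewrite ?lee_fin //.
Qed.

Lemma mean_lmgf_tsum n a : a <= 0 ->
  mean_lmgf (law P X n) (law P Y n) (@tsum n) a = mean n a.
Proof.
move=> a0; rewrite (@mean_lmgf_image _ _ _ _ _ _ _ P (law P X n) (law P Y n) (block X 1 n) (block Y 1 n) _
  (@mbX n) (@mbY n) (fun _ _ => erefl) (fun _ _ => erefl)
  (@measurable_tsum n) (@tsum_ge0 n) (int_tsum n) a a0).
apply: eq_Rintegral => w _; rewrite /window_lmgf.
congr (lmgf P _ a); apply/funext => v; exact: tsum_block.
Qed.

Lemma mean_window_slope n a k : a <= k -> k < 0 -> a / k * mean n k <= mean n a.
Proof.
move=> ak k0; rewrite -(mean_lmgf_tsum n (ltW k0)) -(mean_lmgf_tsum n (le_trans ak (ltW k0))).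
exact: (mean_lmgf_slope (@measurable_tsum n) (@tsum_ge0 n) (int_tsum n) ak k0).
Qed.

Lemma rho_nE n (x : n.-tuple T1) (y : n.-tuple T2) : rho_n rho x y = n%:R^-1 * tsum x y.
Proof. by []. Qed.

Lemma rate_nE n (p : probability (n.-tuple T1) R) (q : probability (n.-tuple T2) R) (D : R) :
  (0 < n)%N -> rate_n rho p q D = ((n%:R^-1)%:E * ereal_inf
    [set relative_entropy V (p \x q)%E | V in
      [set V : probability (n.-tuple T1 * n.-tuple T2)%type R |
        (forall E, measurable E -> V (fst @^-1` E) = p E) /\
        (\int[V]_z (tsum z.1 z.2)%:E <= (n%:R * D)%:E)%E]])%E.
Proof.
move=> n0; have nR : 0 < n%:R :> R by rewrite ltr0n.
rewrite -ereal_inf_pZl ?invr_gt0 // /rate_n; congr ereal_inf.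
have adm V : admissible rho p D V <->
    (forall E, measurable E -> V (fst @^-1` E) = p E) /\
        (\int[V]_z (tsum z.1 z.2)%:E <= (n%:R * D)%:E)%E.
  rewrite /admissible.
  have -> : (\int[V]_z (rho_n rho z.1 z.2)%:E = (n%:R^-1)%:E * \int[V]_z (tsum z.1 z.2)%:E)%E.
    rewrite -ge0_integralZl //.
    - by apply/measurable_EFinP; exact: measurable_tsum.
    - by move=> z _; rewrite lee_fin tsum_ge0.
  by rewrite -[(n%:R * D)%:E](EFinM) lee_pdivrMl.
apply/seteqP; split.
  by move=> _ [V /adm hV <-]; exists (relative_entropy V (p \x q)%E) => //; exists V.
by move=> _ [_ [V hV <-] <-]; exists V => //; apply/adm.
Qed.

Section duality.
Variables (n : nat) (D : R).
Hypothesis n_gt0 : (0 < n)%N.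
Hypothesis D_lt_av : (D%:E < D_av rho P X Y)%E.

Let nR : 0 < n%:R :> R. Proof. by rewrite ltr0n. Qed.

(** [mean_lmgf_ess_inf] for the normalised distortion; the factor [n] goes into
    the tilt. *)
Lemma D_min_slope : (D_min_n rho (law P X n) (law P Y n) < D%:E)%E ->
  exists2 k : R, k < 0 & k * (n%:R * D) < mean n k.
Proof.
move=> Dmin.
have mr : measurable_fun setT (fun z : n.-tuple T1 * n.-tuple T2 => rho_n rho z.1 z.2).
  by apply: measurable_funM => //; exact: measurable_tsum.
have r0 (x : n.-tuple T1) (y : n.-tuple T2) : 0 <= rho_n rho x y.
  by rewrite mulr_ge0 ?invr_ge0 ?(ltW nR) ?tsum_ge0.
have int_r : (\int[law P X n \x law P Y n]_z (rho_n rho z.1 z.2)%:E < +oo)%E.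
  apply: le_lt_trans (int_tsum n); apply: ge0_le_integral => //.
  - by move=> z _; rewrite lee_fin.
  - exact/measurable_EFinP.
  - by apply/measurable_EFinP; exact: measurable_tsum.
  move=> z _; rewrite lee_fin rho_nE ler_piMl ?tsum_ge0 //.
  by rewrite invf_le1 // ler1n.
have [k k0 kD] := mean_lmgf_ess_inf mr r0 int_r Dmin.
exists (k / n%:R); first by rewrite pmulr_llt0 ?invr_gt0.
have kn0 : k / n%:R <= 0 by rewrite pmulr_lle0 ?invr_gt0 // ltW.
rewrite -mean_lmgf_tsum // mulrA divfK ?gt_eqF //.
have -> : mean_lmgf (law P X n) (law P Y n) (@tsum n) (k / n%:R) =
    mean_lmgf (law P X n) (law P Y n) (@rho_n _ _ T1 T2 R rho n) k.
  by rewrite (mean_lmgf_scale _ _ (@tsum n) n%:R^-1 k).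
by rewrite -ltrN2 -mulNr.
Qed.

(** [rate_duality] for blocks of length [n], normalised per letter. *)
Theorem rate_n_duality : (exists2 k : R, k < 0 & k * (n%:R * D) < mean n k) ->
  exists a : R, [/\ a < 0,
    rate_n rho (law P X n) (law P Y n) D = (a * D - n%:R^-1 * mean n a)%:E,
    forall b, b <= 0 -> b * D - n%:R^-1 * mean n b <= a * D - n%:R^-1 * mean n a &
    forall k, k < 0 -> k * (n%:R * D) < mean n k -> k <= a].
Proof.
move=> [k k0 kD].
have hk : exists2 k : R, k < 0 & - mean_lmgf (law P X n) (law P Y n) (@tsum n) k < - k * (n%:R * D).
  by exists k; rewrite // (mean_lmgf_tsum n (ltW k0)) mulNr ltrN2.
have hD : ((n%:R * D)%:E < \int[law P X n \x law P Y n]_z (tsum z.1 z.2)%:E)%E.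
  by rewrite integral_tsum EFinM lte_pmul2l.
have mt := @measurable_tsum n; have t0 := @tsum_ge0 n.
have [a [a0 aD rate]] := rate_duality mt t0 (int_tsum n) hk hD.
exists a; split; [exact: a0| | |].
- rewrite rate_nE // rate -EFinM; congr EFin.
  by rewrite (mean_lmgf_tsum n (ltW a0)) mulrBr mulrCA mulKf ?gt_eqF.
- move=> b b0.
  have := mean_lmgf_tangent mt t0 (int_tsum n) a0 b0.
  rewrite aD (mean_lmgf_tsum n (ltW a0)) (mean_lmgf_tsum n b0) => h.
  exact: normalized_tangent h.
- move=> k' k'0; rewrite -(mean_lmgf_tsum n (ltW k'0)) => k'D.
  exact: (maximizer_ge mt t0 (int_tsum n) k'0 k'D a0 aD).
Qed.

End duality.

End finite_blocks.

(** * The waiting time theorem *)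
Lemma steep_arith (R : realFieldType) (kap n D D0 em lnc mk l : R) :
  kap * (2 * em) <= kap * (n * (D - D0)) -> - (kap * (n * D0)) < mk ->
  mk - n * l <= lnc + kap * em -> 2 * lnc <= kap * (n * (D - D0)) ->
  - (n * (kap * D)) < n * l.
Proof.
have -> : kap * (n * (D - D0)) = n * (kap * D) - kap * (n * D0) by ring.
have -> : kap * (2 * em) = 2 * (kap * em) by ring.
move: (n * (kap * D)) (kap * (n * D0)) (kap * em) (n * l) => *; lra.
Qed.

Section waiting_times.
Context {d1 d2 d : measure_display} {T1 : measurableType d1}
  {T2 : measurableType d2} {R : realType} (rho : T1 -> T2 -> R).
Hypothesis rho_ge0 : forall x y, 0 <= rho x y.
Hypothesis mrho : measurable_fun setT (fun z : T1 * T2 => rho z.1 z.2).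
Context {Omega : measurableType d} (P : probability Omega R).
Variables (X : int -> {mfun Omega >-> T1}) (Y : int -> {mfun Omega >-> T2}).
Hypotheses (sX : stationary P X) (eX : ergodic P X) (sY : stationary P Y).
Hypothesis XY : independent_processes P X Y.
Local Notation mean := (mean_window rho P Y X).
Variable D : R.
Hypotheses (Dav_fin : (D_av rho P X Y < +oo)%E) (D_lt_av : (D%:E < D_av rho P X Y)%E).

(** The rate of [iid_match_prob] is computed for single letters and the rate in
    the statement for tuples of length [1]; both are the maximum of
    [a * D - Lam a]. *)
Theorem iid_waiting_time : iid P Y -> (D_min_1 rho P X Y < D%:E)%E ->
  {ae P, forall w,
     ((n%:R^-1)%:E * lne (waiting_time rho X Y D n w))%E @[n --> \oo]
       --> rate_n rho (law P X 1) (law P Y 1) D}.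
Proof.
move=> iidY Dmin; pose p := distribution P (X 1); pose q := distribution P (Y 1).
have Ymix := iid_mixing iidY.
have Lam1 a : a <= 0 -> mean_lmgf p q rho a = mean 1 a.
  move=> a0.
  rewrite (@mean_lmgf_image _ _ _ _ _ _ _ P p q (X 1) (Y 1) rho
    (@measurable_funPT _ _ _ _ _) (@measurable_funPT _ _ _ _ _)
    (fun _ _ => erefl) (fun _ _ => erefl) mrho rho_ge0 Dav_fin a a0).
  apply: eq_Rintegral => w _; rewrite /window_lmgf; congr (lmgf P _ a).
  by apply/funext => v; rewrite /psum big_ord1 /= !addr0.
have [k k0 kD] := mean_lmgf_ess_inf mrho rho_ge0 Dav_fin Dmin.
have slope : exists2 k : R, k < 0 & - mean_lmgf p q rho k < - k * D by exists k.
have [a a0 aD] := mean_tilt_eq mrho rho_ge0 Dav_fin slope D_lt_av.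
have kD1 : exists2 k : R, k < 0 & k * (1%:R * D) < mean 1 k.
  by exists k => //; rewrite mul1r -(Lam1 k (ltW k0)) -ltrN2 -mulNr.
have [b [b0 rateE b_max _]] :=
  rate_n_duality rho_ge0 mrho sX sY Dav_fin (ltn0Sn 0) D_lt_av kD1.
have inv1 (z : R) : 1%:R^-1 * z = z by rewrite invr1 mul1r.
have {}b_max z : z <= 0 -> z * D - mean 1 z <= b * D - mean 1 b.
  by move=> z0; rewrite -[mean 1 z]inv1 -[mean 1 b]inv1; exact: b_max.
rewrite (inv1 (mean 1%N b)) in rateE.
have rE : b * D - mean 1 b = a * D - mean_lmgf p q rho a.
  apply/eqP; rewrite eq_le; apply/andP; split; last first.
    by rewrite (Lam1 a (ltW a0)); exact: b_max a (ltW a0).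
  have := mean_lmgf_tangent mrho rho_ge0 Dav_fin a0 (ltW b0).
  rewrite aD (Lam1 b (ltW b0)) mulrBl.
  by move: (mean_lmgf _ _ _ _) (mean 1%N b) (a * D) (b * D) => *; lra.
rewrite rateE rE.
have r0 : 0 <= a * D - mean_lmgf p q rho a.
  have := mean_lmgf_tangent mrho rho_ge0 Dav_fin a0 (lexx 0).
  by rewrite aD mean_lmgf0 sub0r mulNr -lerBrDr sub0r opprK -subr_ge0.
apply: (waiting_time_cvg mrho sY XY (lexx 1) Ymix r0) => eps eps0.
exact: (iid_match_prob rho_ge0 mrho sX eX sY Ymix Dav_fin D_lt_av slope a0 aD).
Qed.

Section mixing.
Hypothesis psiY : psi_mixing P Y.
Variable M : R.
Hypotheses (rho_le : forall x y, rho x y <= M) (M_gt0 : 0 < M).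
Hypothesis Dmin : (D_min_sup rho P X Y < D%:E)%E.

Let D_min_n_lt n : (0 < n)%N -> (D_min_n rho (law P X n) (law P Y n) <= D_min_sup rho P X Y)%E.
Proof. by move=> n0; apply: ereal_sup_ubound; exists n. Qed.

(** This is where [D_min_sup < D] enters. For blocks of one length [n], the mean
    log-moment at some tilt [k] lies above the line of a slope [D0 < D]; moving further left keeps it so
    ([mean_window_slope]), until the difference [D - D0] absorbs the cost of passing
    from [n] to the limit. *)
Let steep_slope (c : R) (e : nat) (L : R -> R) : 1 <= c ->
  (forall a, a <= 0 -> forall n, `|mean n a - n%:R * L a| <= gap_cost M c e a) ->
  0 <= D /\ exists2 kap : R, 0 < kap & - kap * D < L (- kap).
Proof.
move=> c1 meanL.
have [D0 D0min D0D] : exists2 D0 : R, (D_min_sup rho P X Y < D0%:E)%E & D0 < D.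
  move: Dmin; case: (D_min_sup rho P X Y) => [z| |] // h.
    by exists ((z + D) / 2); rewrite ?lte_fin; move: h; rewrite lte_fin => /midf_lt[].
  by exists (D - 1); rewrite ?ltNyr // ltrBlDr ltrDl.
have gap0 : 0 < D - D0 by rewrite subr_gt0.
have eM0 : 0 <= e%:R * M by rewrite mulr_ge0 // ltW.
pose n := (Num.truncn (2 * (e%:R * M) / (D - D0))).+1.
have n0 : (0 < n)%N by [].
have nR : 0 < n%:R :> R by rewrite ltr0n.
have ngap : 2 * (e%:R * M) <= n%:R * (D - D0).
  by rewrite -ler_pdivrMr // ltW // truncnS_gt.
have ng0 : 0 < n%:R * (D - D0) by rewrite mulr_gt0.
have [k k0 kD] := D_min_slope rho_ge0 mrho sX sY Dav_fin n0 (le_lt_trans (D_min_n_lt n0) D0min).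
have kle0 : k <= 0 by exact: ltW.
split.
  have /andP[_ m2] := mean_window_bounds rho_ge0 rho_le mrho P Y X n kle0.
  have : k * (n%:R * D0) < 0 by exact: lt_le_trans m2.
  by rewrite nmulr_rlt0 // pmulr_rgt0 // => /lt_trans/(_ D0D)/ltW.
have lnc0 : 0 <= ln c by exact: ln_ge0.
pose kap := Num.max (- k) (2 * ln c / (n%:R * (D - D0))).
have kapk : - kap <= k by rewrite lerNl le_max lexx.
have kap0 : 0 < kap by rewrite lt_max oppr_gt0 k0.
have kaplnc : 2 * ln c <= kap * (n%:R * (D - D0)).
  by rewrite -ler_pdivrMr // le_max lexx orbT.
have nk0 : - kap <= 0 by rewrite oppr_le0 ltW.
exists kap => //.
have h1 : - kap * (n%:R * D0) < mean n (- kap).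
  apply: lt_le_trans (mean_window_slope rho_ge0 mrho sX sY Dav_fin n kapk k0).
  have kk0 : 0 < - kap / k by rewrite nmulr_rgt0 ?oppr_lt0 // invr_lt0.
  have -> : - kap * (n%:R * D0) = - kap / k * (k * (n%:R * D0)).
    by rewrite [RHS]mulrA divfK // ltr0_neq0.
  by rewrite ltr_pM2l.
have := meanL _ nk0 n; rewrite ler_norml => /andP[_ h2].
rewrite -(ltr_pM2l nR); move: h1 h2 kaplnc; rewrite /gap_cost.
have h3 : kap * (2 * (e%:R * M)) <= kap * (n%:R * (D - D0)) by rewrite ler_pM2l.
move: h3; rewrite !mulNr opprK mulrN.
exact: steep_arith.
Qed.

(** By [steep_slope] the optimal tilts of all long blocks lie in [- kap, 0], so the
    rates converge to [legendre_rate], which is also the rate of decay of the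
    matching probability. *)
Theorem mixing_waiting_time : cvgn (rate_seq rho P X Y D) /\
  {ae P, forall w,
     ((n%:R^-1)%:E * lne (waiting_time rho X Y D n w))%E @[n --> \oo]
       --> rate rho P X Y D}.
Proof.
have mixing_all c : 1 < c -> exists e, mixing P Y c e by exact: psi_mixing_mixing.
have [e Ymix] := mixing_all 2 (ltr1n R 2).
have c1 : 1 <= 2 :> R by rewrite ler1n.
have [L meanL] := mean_window_rate rho_ge0 rho_le mrho sY sX c1 Ymix.
have [D0 [kap kap0 Lkap]] := steep_slope c1 meanL.
pose I := legendre_rate L D kap.
have I0 : 0 <= I := legendre_rate_ge0 rho_ge0 rho_le M_gt0 mrho meanL D0 kap0.
pose K := gap_cost M 2 e (- kap).
have nk0 : - kap < 0 by rewrite oppr_lt0.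
have g0 : 0 < L (- kap) + kap * D by rewrite -ltrBlDr sub0r -mulNr.
have rates : \forall n \near \oo, (exists a, [/\ - kap <= a, a <= 0,
    rate_seq rho P X Y D n = (a * D - n%:R^-1 * mean n a)%:E &
     (forall b, b <= 0 -> b * D - n%:R^-1 * mean n b <= a * D - n%:R^-1 * mean n a)]).
  have hK : \forall n \near \oo, K < n%:R * (L (- kap) + kap * D).
    have : \forall n \near \oo, K / (L (- kap) + kap * D) < n%:R :> R by exact: nbhs_infty_gtr.
    by apply: filterS => n; rewrite ltr_pdivrMr.
  have n1 : \forall n \near \oo, (0 < n)%N by exists 1%N.
  apply: filterS2 hK n1 => n hK n0.
  have slope := D_min_slope rho_ge0 mrho sX sY Dav_fin n0 (le_lt_trans (D_min_n_lt n0) Dmin).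
  have [a [a0 rateE amax age]] := rate_n_duality rho_ge0 mrho sX sY Dav_fin n0 D_lt_av slope.
  exists a; split; [|exact: ltW|exact: rateE|exact: amax].
  apply: age => //; have := meanL _ (ltW nk0) n; rewrite -/K ler_norml => /andP[h _].
  move: h hK; rewrite mulrDr.
  have -> : n%:R * (kap * D) = - (- kap * (n%:R * D)) by ring.
  by move: (mean n (- kap)) (n%:R * L (- kap)) (- kap * _) K => *; lra.
have rI : (rate_seq rho P X Y D n @[n --> \oo] --> I%:E)%E.
  apply/fine_cvgP; split; first by apply: filterS rates => n [a [_ _ -> _]].
  apply: (legendre_rate_cvg rho_ge0 rho_le M_gt0 mrho meanL D0 kap0).
  apply: filterS rates => n [a [ka a0 rE amax]]; split.
    by exists a; split => //=; rewrite rE.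
  by rewrite /= rE.
split; first by apply/cvg_ex; exists I%:E.
rewrite /rate (cvg_lim _ rI) //.
apply: (waiting_time_cvg mrho sY XY c1 Ymix I0) => eps eps0.
exact: (mixing_match_prob rho_ge0 rho_le M_gt0 mrho sX eX sY c1 Ymix meanL D0 kap0
  mixing_all Lkap eps0).
Qed.

End mixing.

End waiting_times.

Theorem theorem14 (R : realType) (d : measure_display)
    (Omega : measurableType d) (P : probability Omega R)
    (A A' : completeMetricType R)
    (sepA : separable A) (sepA' : separable A')
    (X : int -> {RV P >-> borel A}) (Y : int -> {RV P >-> borel A'})
    (rho : borel A -> borel A' -> R)
    (rho_ge0 : forall x y, 0 <= rho x y)
    (mrho : measurable_fun [set: (borel A * borel A')%type]
              (fun z => rho z.1 z.2))
    (X_stationary : stationary P X) (X_ergodic : ergodic P X)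
    (Y_stationary : stationary P Y) (Y_ergodic : ergodic P Y)
    (XY_independent : independent_processes P X Y) :
  (iid P Y ->
   (D_av rho P X Y < +oo)%E ->
   (D_min_1 rho P X Y < D_av rho P X Y)%E ->
   forall D : R, (D_min_1 rho P X Y < D%:E)%E -> (D%:E < D_av rho P X Y)%E ->
   {ae P, forall w,
     ((n%:R^-1)%:E * lne (waiting_time rho X Y D n w))%E @[n --> \oo]
       --> rate_n rho (law P X 1) (law P Y 1) D})
  /\
  (psi_mixing P Y ->
   (exists M : R, forall x y, rho x y <= M) ->
   (D_min_sup rho P X Y < D_av rho P X Y)%E ->
   forall D : R, (D_min_sup rho P X Y < D%:E)%E -> (D%:E < D_av rho P X Y)%E ->
   cvgn (rate_seq rho P X Y D) /\
   {ae P, forall w,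
     ((n%:R^-1)%:E * lne (waiting_time rho X Y D n w))%E @[n --> \oo]
       --> rate rho P X Y D}).
Proof.
split; first by move=> iidY Dav_fin _ D Dmin D_lt_av; exact: iid_waiting_time.
move=> psiY [M rho_le] _ D Dmin D_lt_av.
pose M' := Num.max M 1.
have rho_le' x y : rho x y <= M' by rewrite le_max rho_le.
have M'_gt0 : 0 < M' by rewrite lt_max ltr01 orbT.
have Dav_fin : (D_av rho P X Y < +oo)%E.
  apply: (@le_lt_trans _ _ M'%:E); last exact: ltry.
  pose pq : probability (borel A * borel A')%type R :=
    (distribution P (X 1%R) \x distribution P (Y 1%R))%E.
  have mE : measurable_fun setT (fun z : borel A * borel A' => (rho z.1 z.2)%:E).
    exact/measurable_EFinP.
  apply: (@le_trans _ _ (\int[pq]_z (M'%:E))%E).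
    apply: ge0_le_integral => //.
    - by move=> z _; rewrite lee_fin.
    - by move=> z _; rewrite lee_fin.
  have -> : (\int[pq]_z M'%:E = M'%:E * pq setT)%E by exact: integral_cst.
  have -> : pq setT = 1%E by exact: probability_setT.
  by rewrite mule1.
exact: (mixing_waiting_time rho_ge0 mrho X_stationary X_ergodic Y_stationary
  XY_independent Dav_fin D_lt_av psiY rho_le' M'_gt0 Dmin).
Qed.
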